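(* Let $P=\prod_{j=1}^k(x\partial_x-r_j)$ with $r_j\in R$, let $Q\in t\cdot\mathrm{Diff}[[t]]$ with $\mathrm{Diff}=R[x^{\pm1},\partial_x]$, and $D=P+Q$. Let $s_1,\dots,s_l$ (with $s_i-s_j\notin\mathbb{Z}$ for $i\ne j$), $k_i$, $\lambda_{i,j}$ and $w_i(\varepsilon)=\prod_{j=1}^{k_i}(\varepsilon-\lambda_{i,j})\in\mathbf{k}[[t]][\varepsilon]$ be as defined in the context. Let $N\ge1$. (a) If $s_1,\dots,s_l\in\mathbb{Q}$, then there is $C_N$ such that for all primes $p>C_N$ $$\det(\rho_{p,\xi,\eta}(D))=(-1)^kw_1(-\xi^p\eta^p)\cdots w_l(-\xi^p\eta^p)\mod p,\ t^N.$$ (b) More generally, if $s_1,\dots,s_l\in\mathbf{k}$, then there is $C_N$ such that for all primes $p>C_N$ $$\det(\rho_{p,\xi,\eta}(D))=(-1)^kw_1(-\xi^p\eta^p-s_1+s_1^p)\cdots w_l(-\xi^p\eta^p-s_l+s_l^p)\mod p,\ t^N.$$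
   Context: $\mathbf{k}$ is a field of characteristic zero with algebraic closure $\bar{\mathbf{k}}$; $R\subset\mathbf{k}$ is a subring finitely generated over $\mathbb{Z}$ containing $r_1,\dots,r_k$. For given $N$, $R$ is enlarged (still finitely generated) so that the coefficients of $w_1,\dots,w_l$ modulo $t^N$ lie in $R$; ''mod $p$, $t^N$'' means equality of coefficients of $t^m$, $m<N$, after reduction to $R/(p)$. For a prime $p$ and formal parameters $\xi,\eta$, $\rho_{p,\xi,\eta}$ is the $p$-dimensional representation of $\mathrm{Diff}$ ($\partial_xx-x\partial_x=1$) on $R/(p)(\xi,\eta)[x]/(x^p)$ given by $\rho_{p,\xi,\eta}(x)=x+\xi$, $\rho_{p,\xi,\eta}(\partial_x)=\partial_x+\eta$ (with $\rho_{p,\xi,\eta}(x)$ invertible already over $R/(p)[\xi^{\pm1},\eta^{\pm 1}]$), extended coefficientwise to power series in $t$. Say $r_i\sim r_j$ iff $r_i-r_j\in\mathbb{Z}$, and let $s_1,\dots,s_l$ be the smallest representatives of the classes of $\{r_1,\dots,r_k\}$ (so $s_i-s_j\notin\mathbb{Z}$ for $i\neq j$, and each $r_i=s_j+m$ for some $j$ and integer $m\ge0$). Let $k_i$ be the number of indices $m$ with $r_m-s_i\in\mathbb{Z}$, so $k_1+\dots+k_l=k$. With formal symbols $x^{s}$, $\log x$ and the usual differentiation rules, the space $M_i$ of solutions of $(P+Q)f=0$ with $f\in x^{s_i}\mathbf{k}(\!(x)\!)[\log x][[t]]$ is a free $\mathbf{k}[[t]]$-module of rank $k_i$, and for some $L\ge1$,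 after extension of scalars to $\bar{\mathbf{k}}(\!(t^{1/L})\!)$, it has a basis $f_{i,1},\dots,f_{i,k_i}$ of the form $f_{i,j}=x^{s_i+\lambda_{i,j}}g_{i,j}$ with $\lambda_{i,j}\in t^{1/L}\bar{\mathbf{k}}[[t^{1/L}]]$ and $g_{i,j}\in\bar{\mathbf{k}}(\!(x)\!)[[t^{1/L}]][\log x]$ of degree $<k_i$ in $\log x$, where $x^{s_i+\lambda_{i,j}}=x^{s_i}\sum_{m\ge0}\lambda_{i,j}^m(\log x)^m/m!$. The $\lambda_{i,j}$ are these exponents; equivalently, $\lambda_{i,1},\dots,\lambda_{i,k_i}$ are the eigenvalues, with multiplicity, of the derivation $D_{\log}$ on $M_i$ ($D_{\log}$ kills $x^{s}$, $x$ and $t$, and $D_{\log}(\log x)=1$). *)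

(* Defs.v *)
From HB Require Import structures.
From mathcomp Require Import all_boot all_order all_algebra finmap boolp.

Set Implicit Arguments.
Unset Strict Implicit.
Unset Printing Implicit Defensive.

Import GRing.Theory.
Local Open Scope ring_scope.

Record fps (R : Type) := FPS { coef_fps :> nat -> R }.

Lemma fpsP (R : Type) (f g : fps R) : (forall n, f n = g n) -> f = g.
Proof. by case: f g => [f] [g] /= fg; congr FPS; apply/funext. Qed.

HB.instance Definition _ (R : Type) := gen_eqMixin (fps R).
HB.instance Definition _ (R : Type) := gen_choiceMixin (fps R).

Section FpsRing.
Context {R : comNzRingType}.
Implicit Types f g h : fps R.

Definition fps_zero : fps R := FPS (fun=> 0).
Definition fps_opp f : fps R := FPS (fun n => - f n).
Definition fps_add f g : fps R := FPS (fun n => f n + g n).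

Definition fpsC (c : R) : fps R := FPS (fun n => if n == 0%N then c else 0).
Definition fps_mul f g : fps R :=
  FPS (fun n => \sum_(m < n.+1) f m * g (n - m)%N).

Lemma fps_addA : associative fps_add.
Proof. by move=> f g h; apply: fpsP => n /=; rewrite addrA. Qed.
Lemma fps_addC : commutative fps_add.
Proof. by move=> f g; apply: fpsP => n /=; rewrite addrC. Qed.
Lemma fps_add0 : left_id fps_zero fps_add.
Proof. by move=> f; apply: fpsP => n /=; rewrite add0r. Qed.
Lemma fps_addN : left_inverse fps_zero fps_opp fps_add.
Proof. by move=> f; apply: fpsP => n /=; rewrite addNr. Qed.

HB.instance Definition _ :=
  GRing.isZmodule.Build (fps R) fps_addA fps_addC fps_add0 fps_addN.

Definition fps_trunc (N : nat) f : {poly R} := \poly_(i < N) f i.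

Lemma fps_mul_trunc N f g n : (n < N)%N ->
  fps_mul f g n = (fps_trunc N f * fps_trunc N g)`_n.
Proof.
move=> ltnN; rewrite coefM; apply: eq_bigr => m _; rewrite !coef_poly.
rewrite (leq_ltn_trans _ ltnN) ?(leq_ltn_trans _ ltnN) ?leq_subr //.
by rewrite -ltnS.
Qed.

Lemma coefM_eq (p q p' q' : {poly R}) n :
    (forall i, (i <= n)%N -> p`_i = p'`_i) ->
    (forall i, (i <= n)%N -> q`_i = q'`_i) ->
  (p * q)`_n = (p' * q')`_n.
Proof.
move=> pp' qq'; rewrite !coefM; apply: eq_bigr => m _.
by rewrite pp' ?qq' ?leq_subr // -ltnS.
Qed.

Lemma fps_trunc_mul N f g n : (n < N)%N ->
  (fps_trunc N (fps_mul f g))`_n = (fps_trunc N f * fps_trunc N g)`_n.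
Proof. by move=> ltnN; rewrite coef_poly ltnN (fps_mul_trunc _ _ ltnN). Qed.

Lemma fps_mulA : associative fps_mul.
Proof.
move=> f g h; apply: fpsP => n; rewrite !(fps_mul_trunc _ _ (ltnSn n)).
rewrite (@coefM_eq _ _ (fps_trunc n.+1 f) (fps_trunc n.+1 g * fps_trunc n.+1 h))
  // ?mulrA => [|i lein]; last by rewrite fps_trunc_mul.
by apply: coefM_eq => // i lein; rewrite fps_trunc_mul.
Qed.

Lemma fps_mulC : commutative fps_mul.
Proof.
by move=> f g; apply: fpsP => n; rewrite !(fps_mul_trunc _ _ (ltnSn n)) mulrC.
Qed.

Lemma fps_mul1 : left_id (fpsC 1) fps_mul.
Proof.
move=> f; apply: fpsP => n /=; rewrite big_ord_recl /= subn0 mul1r.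
by rewrite big1 ?addr0 // => i _; rewrite mul0r.
Qed.

Lemma fps_mulDl : left_distributive fps_mul fps_add.
Proof.
move=> f g h; apply: fpsP => n /=; rewrite -big_split /=.
by apply: eq_bigr => m _; rewrite mulrDl.
Qed.

Lemma fps_1neq0 : fpsC 1 != (0 : fps R).
Proof.
by apply/eqP => /(congr1 (fun f : fps R => f 0%N))/= /eqP; rewrite oner_eq0.
Qed.

HB.instance Definition _ := GRing.Zmodule_isComNzRing.Build (fps R)
  fps_mulA fps_mulC fps_mul1 fps_mulDl fps_1neq0.

End FpsRing.

Definition fps_map (R S : Type) (phi : R -> S) (f : fps R) : fps S :=
  FPS (fun n => phi (f n)).

(** The embedding K[[t]] -> L[[u]] with t = u^e, u standing for t^(1/e). *)
Definition fps_ramify (K S : nzRingType) (j : K -> S) (e : nat) (f : fps K) :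
    fps S :=
  FPS (fun n => if (e %| n)%N then j (f (n %/ e)%N) else 0).

(** Diff = R[x^{+-1}, d/dx] is a free left R-module on the x^a (d/dx)^b, a in Z,
    b in N; an element is given by its finitely many coefficients. *)
Definition diffop (R : nzRingType) : Type :=
  {fsfun (int * nat)%type -> R with 0}.

(** A series x^s sum_(n,a,b) f_(n,a,b) t^n x^a (log x)^b is stored as the array
    of its coefficients f_(n,a,b); the exponent s is an extra argument of the
    operations that need it. *)

Definition logser (K : Type) : Type := int -> nat -> K.
Definition tlogser (K : Type) : Type := nat -> logser K.

Section LogSeries.
Context {K : fieldType}.
Implicit Types (h : logser K) (f : tlogser K) (c : fps K).

(** x^s K((x))[log x] *)
Definition in_logser h : Prop :=
  (exists m : int, forall a b, (a < m)%R -> h a b = 0) /\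
  (exists d : nat, forall a b, (d <= b)%N -> h a b = 0).

(** x^s K((x))[log x][[t]] *)
Definition in_tlogser f : Prop := forall n, in_logser (f n).

Definition ls_mulx (c : int) h : logser K := fun a b => h (a - c) b.

(** d/dx (x^(s+a) (log x)^b)
    = (s+a) x^(s+a-1) (log x)^b + b x^(s+a-1) (log x)^(b-1) *)
Definition ls_dx (s : K) h : logser K := fun a b =>
  (s + (a + 1)%:~R) * h (a + 1) b + b.+1%:R * h (a + 1) b.+1.

Definition tls_scale c f : tlogser K := fun n a b =>
  \sum_(m < n.+1) c m * f (n - m)%N a b.

(** x^lam g, where x^lam = sum_m lam^m (log x)^m / m! *)
Definition tls_xpow (lam : fps K) (g : tlogser K) : tlogser K := fun n a b =>
  \sum_(m < b.+1) m`!%:R^-1 * tls_scale (lam ^+ m) g n a (b - m)%N.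

Section Action.
Context {R : comNzRingType} (iota : R -> K) (s : K).

Definition ls_diffop (q : diffop R) h : logser K := fun a b =>
  \sum_(e <- finsupp q) iota (q e) * ls_mulx e.1 (iter e.2 (ls_dx s) h) a b.

(** P = prod_j (x d/dx - r_j) *)
Definition ls_P (r : seq R) h : logser K :=
  foldr (fun z h' a b => ls_mulx 1 (ls_dx s h') a b - iota z * h' a b) h r.

(** (P + Q) f = 0, where Q n is the coefficient of t^n in Q *)
Definition is_sol (r : seq R) (Q : nat -> diffop R) f : Prop :=
  forall n a b,
    ls_P r (f n) a b + \sum_(m < n.+1) ls_diffop (Q m) (f (n - m)%N) a b = 0.

(** M = { f in x^s K((x))[log x][[t]] | (P + Q) f = 0 } *)
Definition in_M r Q f : Prop := in_tlogser f /\ is_sol r Q f.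

Definition is_basis_M r Q d (e : 'I_d -> tlogser K) : Prop :=
  [/\ forall i, in_M r Q (e i),
      forall f, in_M r Q f -> exists c : 'I_d -> fps K,
        forall n a b, f n a b = \sum_i tls_scale (c i) (e i) n a b
    & forall c : 'I_d -> fps K,
        (forall n a b, \sum_i tls_scale (c i) (e i) n a b = 0) ->
        forall i, c i = 0].
End Action.
End LogSeries.

Definition tls_ramify (K S : nzRingType) (j : K -> S) (e : nat)
    (f : tlogser K) : tlogser S :=
  fun n a b => if (e %| n)%N then j (f (n %/ e)%N a b) else 0.

(** The exponents of P + Q on the class of s: after extension of scalars to
    Kbar((u)), u = t^(1/L), the module M has a basis
    f_j = x^(s + lam_j) g_j, with lam_j in u Kbar[[u]] and
    g_j in Kbar((x))[[u]][log x] of degree < d in log x, d being the rank of M.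
    That the f_j form a basis over Kbar((u)) is expressed through the
    transition matrix u^-N A from a basis e of M over K[[t]]. *)
Definition is_exponents (K Kbar : fieldType) (j : K -> Kbar)
    (R : comNzRingType) (iota : R -> K) (s : K)
    (r : seq R) (Q : nat -> diffop R) (d L : nat) (lam : 'I_d -> fps Kbar) :
    Prop :=
  (forall i, lam i 0%N = 0) /\
  exists (e : 'I_d -> tlogser K) (g : 'I_d -> tlogser Kbar)
         (N : nat) (A : 'M[fps Kbar]_d),
    [/\ is_basis_M iota s r Q e,
        forall i b n, exists m : int, forall a, (a < m)%R -> g i n a b = 0,
        forall i n a b, (d <= b)%N -> g i n a b = 0,
        \det A != 0
      & forall i n a b,
          tls_scale (FPS (fun m => (m == N)%:R)) (tls_xpow (lam i) (g i)) n a b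
          = \sum_l tls_scale (A i l) (tls_ramify j L (e l)) n a b].

Definition fin_gen_ring (R : comNzRingType) : Prop :=
  exists gens : seq R, forall S : {pred R},
    GRing.subring_closed S -> {subset gens <= S} -> forall x, x \in S.

Definition int_diff (R : nzRingType) (x y : R) : Prop :=
  exists n : int, x - y = n%:~R.

Definition smallest_reps (R : nzRingType) (r : seq R) l (s : 'I_l -> R) :
    Prop :=
  [/\ forall i, s i \in r,
      forall i i', i != i' -> ~ int_diff (s i) (s i')
    & forall z, z \in r -> exists i (n : nat), z = s i + n%:R].

Definition class_mult (R : nzRingType) (r : seq R) (z : R) : nat :=
  count (fun y => `[< int_diff y z >]) r.

(** B is a ring over which the representation is defined: phi : R -> B
    identifies R/(p) with a subring of B, and xi, eta are invertible and
    algebraically independent over R/(p), so that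
    R/(p)[xi^{+-1}, eta^{+-1}] is a subring of B. *)
Definition is_param_ring (p : nat) (R : comNzRingType) (B : comUnitRingType)
    (phi : {rmorphism R -> B}) (xi eta : B) : Prop :=
  [/\ forall c, phi c = 0 <-> exists b, c = b *+ p,
      xi \is a GRing.unit, eta \is a GRing.unit
    & forall q : {poly {poly R}},
        (map_poly (map_poly phi) q).[xi, eta] = 0 ->
        map_poly (map_poly phi) q = 0].

Section Rho.
Context {R : comNzRingType} {B : comUnitRingType} (phi : {rmorphism R -> B}).
Context (p : nat) (xi eta : B).

(** Matrices in the basis 1, x, ..., x^(p-1) of B[x]/(x^p); column j is the
    image of x^j. *)
Definition rho_x : 'M[B]_p :=
  (\matrix_(i, j) (i == j.+1 :> nat)%:R) + xi%:M.
Definition rho_d : 'M[B]_p :=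
  (\matrix_(i, j) (j%:R *+ (j == i.+1 :> nat))) + eta%:M.

Definition rho_xpow (a : int) : 'M[B]_p :=
  match a with Posz n => rho_x ^+ n | Negz n => invmx rho_x ^+ n.+1 end.

Definition rho_diffop (q : diffop R) : 'M[B]_p :=
  \sum_(e <- finsupp q) phi (q e) *: (rho_xpow e.1 *m rho_d ^+ e.2).

Definition rho_P (r : seq R) : 'M[B]_p :=
  \prod_(z <- r) (rho_x *m rho_d - (phi z)%:M).

(** rho(P + Q), extended coefficientwise to power series in t *)
Definition rho_D (r : seq R) (Q : nat -> diffop R) : 'M[fps B]_p :=
  \matrix_(i, j) FPS (fun n =>
    (if n == 0%N then rho_P r i j else 0) + rho_diffop (Q n) i j).
End Rho.

(* Main.v *)
Require Import Defs.
From HB Require Import structures.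
From mathcomp Require Import all_boot all_order all_fingroup all_algebra all_field.
From mathcomp Require Import finmap boolp generic_quotient zify ring.

(** HEADER *)

(** Work modulo a fixed power of t and write D x^c as the sum over integers a of D_a(c) x^(c+a).
    Modulo t only D_0 survives, and it is the indicial polynomial; D_a vanishes once |a| exceeds a
    band width b. Let Theta_n(c) be the determinant of D on the window x^c, ..., x^(c+n-1). Leaving
    the diagonal costs powers of t, so F(c) = Theta_{n+1}(c) / Theta_n(c+1) does not depend on n for
    large n ([Theta_exchange]): F is the diagonal of a triangular factorisation of D.

    In characteristic p the operator theta = rho(x d/dx) satisfies theta^p - theta = xi^p eta^p.
    When c^p - c = xi^p eta^p there is an eigenvector of theta for c, and its first p translates by
    powers of rho(x) form a basis ([basis_mx_unit]) on which rho(D) is a cyclic band matrix with the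
    same entries D_a(c+j). Going once round the cycle costs too many powers of t when p is large, so
    the factorisation survives and det rho(D) is the product of F(c+i) over i < p
    ([cyclic_identity]).

    In characteristic zero F is compared with W(c), the product of the w_i(c - s_i). Near s_i, read
    c - s_i as d/d(log x). The module M_i becomes the set of finitely supported solutions of a long
    window around s_i, and d/d(log x) acts on it with characteristic polynomial w_i
    ([char_poly_exponents]). Therefore w_i(c - s_i) divides the window determinant, and modulo t the
    quotient does not vanish at s_i ([det_sol_module], [local_factor]). Window determinants are, up
    to controlled factors, products of translates of F, so long products of translates of F/W,
    suitably normalised, are regular at every s_i. Partial fractions and induction on the power of t
    then give F(c)/W(c) = g(c+1)/g(c), with g a series in t whose coefficients are rational
    functions of c ([mult_coboundary], [char_zero_identity]).

    With denominators cleared, this identity is reduced modulo p and multiplied over c, ..., c+p-1.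
    The g-factors cancel cyclically; the cancellation is legitimate for large p because R is
    Noetherian, so that a nonzero element of R is regular modulo almost every p
    ([regular_mod_prime]). What remains is the product of w_j(y+i) over i < p with y = c - s_j,
    equal to (-1)^d w_j(-(y^p - y)) with d the degree of w_j ([prod_monic_shift]); substituting c^p
    - c = xi^p eta^p gives (b). To have such a c at all, eta is first replaced by a polynomial h in
    a new variable, and the identity is carried back because substituting h is injective
    ([det_eq_target]). Part (a) follows since rational s_i satisfy s_i^p = s_i modulo large p
    ([frobenius_rational]). *)

Set Implicit Arguments.
Unset Strict Implicit.
Unset Printing Implicit Defensive.

Import GRing.Theory.
Local Open Scope ring_scope.

(** * Classical integral domains *)

Section ClassicalDomain.
Variable R : comNzRingType.
Hypothesis integral : forall x y : R, x * y = 0 -> x = 0 \/ y = 0.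

Let cunit : {pred R} := fun x => `[< exists y, y * x = 1 >].
Let cinv (x : R) : R :=
  match pselect (exists y, y * x = 1) with
  | left e => projT1 (cid e)
  | right _ => x
  end.

Let cmulVx : {in cunit, left_inverse 1 cinv *%R}.
Proof.
move=> x /asboolP xu; rewrite /cinv; case: pselect => // e.
by case: (cid e).
Qed.

Let cunitPl x y : y * x = 1 -> x \in cunit.
Proof. by move=> yx; apply/asboolP; exists y. Qed.

Let cinv_out : {in [predC cunit], cinv =1 id}.
Proof.
move=> x /negP nx; rewrite /cinv; case: pselect => // e.
by case: nx; apply/asboolP.
Qed.

Let cintegral (x y : R) : x * y = 0 -> (x == 0) || (y == 0).
Proof. by case/integral=> ->; rewrite eqxx ?orbT. Qed.

Let Runit : comUnitRingType :=
  HB.pack (GRing.ComNzRing.sort R)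
    (GRing.ComNzRing_hasMulInverse.Build R cmulVx cunitPl cinv_out).

(** The ring of the theorem is a domain, being embedded in a field, but carries no inverse
    operation; this packaging makes the fraction field of its polynomial ring available. *)
Definition idomain_of : idomainType :=
  HB.pack (GRing.ComUnitRing.sort Runit)
    (GRing.ComUnitRing_isIntegral.Build Runit cintegral).

End ClassicalDomain.

(** * Truncated power series *)

Section FpsCoef.
Variable R : comNzRingType.
Implicit Types f g : fps R.

Lemma fps_coefD f g m : (f + g) m = f m + g m. Proof. by []. Qed.
Lemma fps_coefN f m : (- f) m = - f m. Proof. by []. Qed.
Lemma fps_coef0 m : (0 : fps R) m = 0. Proof. by []. Qed.
Lemma fps_coef1 m : (1 : fps R) m = (m == 0%N)%:R.
Proof. by rewrite /GRing.one /=; case: (m == 0%N). Qed.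
Lemma fps_coefM f g m : (f * g) m = \sum_(i < m.+1) f i * g (m - i)%N.
Proof. by []. Qed.
Lemma fps_coef_sum (I : Type) (s : seq I) (P : pred I) (F : I -> fps R) m :
  (\sum_(i <- s | P i) F i) m = \sum_(i <- s | P i) F i m.
Proof. by elim/big_rec2: _ => // i x y _ <-. Qed.

Fact fpsC_is_zmod_morphism : zmod_morphism (@fpsC R).
Proof. by move=> x y; apply: fpsP => -[|m] //=; rewrite ?subr0. Qed.
Fact fpsC_is_monoid_morphism : monoid_morphism (@fpsC R).
Proof.
split=> // x y; apply: fpsP => m; rewrite fps_coefM big_ord_recl /= subn0.
rewrite big1 ?addr0 => [|i _]; last by rewrite mul0r.
by case: (m == 0%N); rewrite ?mulr0.
Qed.
HB.instance Definition _ :=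
  GRing.isZmodMorphism.Build R (fps R) (@fpsC R) fpsC_is_zmod_morphism.
HB.instance Definition _ :=
  GRing.isMonoidMorphism.Build R (fps R) (@fpsC R) fpsC_is_monoid_morphism.

Definition fps_const (f : fps R) : R := f 0%N.
Fact fps_const_is_zmod_morphism : zmod_morphism fps_const.
Proof. by []. Qed.
Fact fps_const_is_monoid_morphism : monoid_morphism fps_const.
Proof. by split=> // x y; rewrite /fps_const fps_coefM big_ord1. Qed.
HB.instance Definition _ :=
  GRing.isZmodMorphism.Build (fps R) R fps_const fps_const_is_zmod_morphism.
HB.instance Definition _ :=
  GRing.isMonoidMorphism.Build (fps R) R fps_const fps_const_is_monoid_morphism.

Definition fpsXn k : fps R := FPS (fun m => (m == k)%:R).

Lemma fps_coefXnM k f m : (fpsXn k * f) m = if (k <= m)%N then f (m - k)%N else 0.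
Proof.
rewrite fps_coefM; case: ifP => [lekm|nkm].
  rewrite (bigD1 (Ordinal (lekm : (k < m.+1)%N))) //= eqxx mul1r big1 ?addr0 //.
  move=> i nik; case: (i =P k :> nat) => [ik|_]; last by rewrite mul0r.
  by case/eqP: nik; apply/val_inj.
rewrite big1 // => i _ /=; case: (i =P k :> nat) => [ik|_]; last by rewrite mul0r.
by move: nkm; rewrite -ik -ltnS ltn_ord.
Qed.

Lemma fpsXnS k : fpsXn k.+1 = fpsXn 1 * fpsXn k.
Proof. by apply: fpsP => -[|m]; rewrite fps_coefXnM //= subn1 /= eqSS. Qed.

Lemma fpsXnE k : fpsXn k = fpsXn 1 ^+ k.
Proof.
elim: k => [|k IH]; last by rewrite fpsXnS IH exprS.
by apply: fpsP => m; rewrite expr0 fps_coef1.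
Qed.

End FpsCoef.

Section FpsMap.
Variables (R S : comNzRingType) (phi : {rmorphism R -> S}).
Fact fps_map_is_zmod_morphism : zmod_morphism (fps_map phi).
Proof. by move=> x y; apply: fpsP => m; rewrite /= rmorphB. Qed.
Fact fps_map_is_monoid_morphism : monoid_morphism (fps_map phi).
Proof.
split=> [|x y]; apply: fpsP => m.
  by case: m => [|m] /=; rewrite ?rmorph1 ?rmorph0.
rewrite [LHS]/= rmorph_sum /=; apply: eq_bigr => i _; exact: rmorphM.
Qed.
HB.instance Definition _ := GRing.isZmodMorphism.Build (fps R) (fps S)
  (fps_map phi) fps_map_is_zmod_morphism.
HB.instance Definition _ := GRing.isMonoidMorphism.Build (fps R) (fps S)
  (fps_map phi) fps_map_is_monoid_morphism.
End FpsMap.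

(** [tps N R] is R[t]/(t^(N+1)). *)
Record tps (N : nat) (R : comNzRingType) := Tps {
  tps_fps :> fps R;
  _ : `[< forall m, (N < m)%N -> tps_fps m = 0 >] }.

Arguments tps_fps : simpl never.

HB.instance Definition _ N R := gen_eqMixin (tps N R).
HB.instance Definition _ N R := gen_choiceMixin (tps N R).

Section Tps.
Variables (N : nat) (R : comNzRingType).
Implicit Types (x y z : tps N R) (f g : fps R).

Fact tps_of_subproof f :
  `[< forall m, (N < m)%N ->
        FPS (fun m => if (m <= N)%N then f m else 0) m = 0 >].
Proof. by apply/asboolP => m; rewrite ltnNge => /negPf /= ->. Qed.
Definition tps_of f : tps N R := Tps (tps_of_subproof f).
Arguments tps_of : simpl never.

Lemma tps_big x m : (N < m)%N -> x m = 0.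
Proof. by case: x => f Pf lt; exact: (asboolW Pf). Qed.

Lemma tpsP x y : (forall m, (m <= N)%N -> x m = y m) -> x = y.
Proof.
move=> xy; have {xy}: tps_fps x = tps_fps y.
  apply: fpsP => m; case: (leqP m N) => [/xy //|lt].
  by rewrite !tps_big.
case: x y => [x Px] [y Py]; rewrite /tps_fps => exy; case: _ / exy Py => Py.
by congr Tps; apply: bool_irrelevance.
Qed.

Lemma tps_ofE f m : (m <= N)%N -> tps_of f m = f m.
Proof. by rewrite /tps_of /tps_fps /= => ->. Qed.

Lemma tps_ofP f g :
  tps_of f = tps_of g <-> forall m, (m <= N)%N -> f m = g m.
Proof.
split=> [e m le|e]; last by apply: tpsP => m le; rewrite !tps_ofE ?e.
by rewrite -(tps_ofE f le) e tps_ofE.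
Qed.

Lemma tps_fpsK x : tps_of x = x.
Proof. by apply: tpsP => m le; rewrite tps_ofE. Qed.

Definition tps_add x y := tps_of ((x : fps R) + (y : fps R)).
Definition tps_mul x y := tps_of ((x : fps R) * (y : fps R)).
Definition tps_opp x := tps_of (- (x : fps R)).

(** Together with its two companions and the retraction [tps_fpsK], this lets every ring law be
    inherited from [fps R]. *)
Let tps_addE f g : tps_add (tps_of f) (tps_of g) = tps_of (f + g).
Proof. by apply/tps_ofP => m le; rewrite !fps_coefD !tps_ofE. Qed.
Let tps_mulE f g : tps_mul (tps_of f) (tps_of g) = tps_of (f * g).
Proof.
apply/tps_ofP => m le; rewrite !fps_coefM; apply: eq_bigr => i _.
rewrite !tps_ofE // ?(leq_trans (leq_subr _ _)) //.
by apply: leq_trans le; rewrite -ltnS ltn_ord.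
Qed.
Let tps_oppE f : tps_opp (tps_of f) = tps_of (- f).
Proof. by apply/tps_ofP => m le; rewrite !fps_coefN tps_ofE. Qed.

Let addA : associative tps_add.
Proof.
move=> x y z; rewrite -(tps_fpsK x) -(tps_fpsK y) -(tps_fpsK z).
by rewrite !tps_addE addrA.
Qed.
Let addC : commutative tps_add.
Proof. by move=> x y; rewrite /tps_add addrC. Qed.
Let add0 : left_id (tps_of 0) tps_add.
Proof. by move=> x; rewrite -(tps_fpsK x) tps_addE add0r. Qed.
Let addN : left_inverse (tps_of 0) tps_opp tps_add.
Proof. by move=> x; rewrite -(tps_fpsK x) tps_oppE tps_addE addNr. Qed.
HB.instance Definition _ :=
  GRing.isZmodule.Build (tps N R) addA addC add0 addN.

Let mulA : associative tps_mul.
Proof.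
move=> x y z; rewrite -(tps_fpsK x) -(tps_fpsK y) -(tps_fpsK z).
by rewrite !tps_mulE mulrA.
Qed.
Let mulC : commutative tps_mul.
Proof. by move=> x y; rewrite /tps_mul mulrC. Qed.
Let mul1 : left_id (tps_of 1) tps_mul.
Proof. by move=> x; rewrite -(tps_fpsK x) tps_mulE mul1r. Qed.
Let mulDl : left_distributive tps_mul tps_add.
Proof.
move=> x y z; rewrite -(tps_fpsK x) -(tps_fpsK y) -(tps_fpsK z).
by rewrite !(tps_addE, tps_mulE) mulrDl.
Qed.
Let one_neq0 : tps_of 1 != 0.
Proof.
apply/eqP => /tps_ofP /(_ 0%N isT) /eqP; rewrite fps_coef1 fps_coef0 /=.
by rewrite oner_eq0.
Qed.
HB.instance Definition _ := GRing.Zmodule_isComNzRing.Build (tps N R)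
  mulA mulC mul1 mulDl one_neq0.

Fact tps_of_is_zmod_morphism : zmod_morphism tps_of.
Proof. by move=> f g; rewrite -tps_addE -tps_oppE. Qed.
Fact tps_of_is_monoid_morphism : monoid_morphism tps_of.
Proof. by split=> // f g; rewrite -tps_mulE. Qed.
HB.instance Definition _ := GRing.isZmodMorphism.Build (fps R) (tps N R)
  tps_of tps_of_is_zmod_morphism.
HB.instance Definition _ := GRing.isMonoidMorphism.Build (fps R) (tps N R)
  tps_of tps_of_is_monoid_morphism.

Lemma tps_coef0 m : (0 : tps N R) m = 0.
Proof.
by case: (leqP m N) => [le|lt]; [exact: (tps_ofE 0) | exact: tps_big].
Qed.
Lemma tps_coef1 m : (1 : tps N R) m = (m == 0%N)%:R.
Proof.
case: (leqP m N) => [le|lt]; last by rewrite tps_big //; case: m lt.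
by rewrite -fps_coef1; exact: (tps_ofE 1).
Qed.
Lemma tps_coefD x y m : (x + y) m = x m + y m.
Proof.
case: (leqP m N) => [le|lt]; last by rewrite !tps_big // addr0.
exact: tps_ofE.
Qed.
Lemma tps_coefN x m : (- x) m = - x m.
Proof.
case: (leqP m N) => [le|lt]; last by rewrite !tps_big // oppr0.
exact: tps_ofE.
Qed.
Lemma tps_coefB x y m : (x - y) m = x m - y m.
Proof. by rewrite tps_coefD tps_coefN. Qed.
Lemma tps_coefM x y m : (m <= N)%N ->
  (x * y) m = \sum_(i < m.+1) x i * y (m - i)%N.
Proof. exact: tps_ofE. Qed.
Lemma tps_coef0M x y : (x * y) 0%N = x 0%N * y 0%N.
Proof. by rewrite tps_coefM // big_ord1. Qed.
Lemma tps_coef_sum (I : Type) (s : seq I) (P : pred I) (F : I -> tps N R) m :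
  (\sum_(i <- s | P i) F i) m = \sum_(i <- s | P i) F i m.
Proof.
elim/big_rec2: _ => [|i x y _ <-]; [exact: tps_coef0 | exact: tps_coefD].
Qed.

Fact tps_coef_is_zmod_morphism m : zmod_morphism (fun x : tps N R => x m).
Proof. by move=> x y; exact: tps_coefB. Qed.
Definition tps_const x := x 0%N.
Fact tps_const_is_zmod_morphism : zmod_morphism tps_const.
Proof. by move=> x y; exact: tps_coefB. Qed.
Fact tps_const_is_monoid_morphism : monoid_morphism tps_const.
Proof. by split=> [|x y]; [exact: tps_coef1 | exact: tps_coef0M]. Qed.
HB.instance Definition _ := GRing.isZmodMorphism.Build (tps N R) R
  tps_const tps_const_is_zmod_morphism.
HB.instance Definition _ := GRing.isMonoidMorphism.Build (tps N R) R
  tps_const tps_const_is_monoid_morphism.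

Definition tpsC (c : R) : tps N R := tps_of (fpsC c).
Fact tpsC_is_zmod_morphism : zmod_morphism tpsC.
Proof. by move=> x y; rewrite /tpsC !rmorphB. Qed.
Fact tpsC_is_monoid_morphism : monoid_morphism tpsC.
Proof. by split=> [|x y]; rewrite /tpsC ?rmorph1 ?rmorphM. Qed.
HB.instance Definition _ := GRing.isZmodMorphism.Build R (tps N R)
  tpsC tpsC_is_zmod_morphism.
HB.instance Definition _ := GRing.isMonoidMorphism.Build R (tps N R)
  tpsC tpsC_is_monoid_morphism.
Lemma tps_coefC c m : tpsC c m = if m == 0%N then c else 0.
Proof.
case: (leqP m N) => [le|lt]; first by rewrite tps_ofE.
by rewrite tps_big //; case: m lt.
Qed.
Lemma tps_coefCM c x m : (tpsC c * x) m = c * x m.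
Proof.
case: (leqP m N) => [le|lt]; last by rewrite !tps_big ?mulr0.
rewrite tps_coefM // big_ord_recl /= subn0 big1 ?addr0 // => i _.
by case: ifP; rewrite mul0r.
Qed.

Definition tpsX : tps N R := tps_of (fpsXn R 1).
Lemma tpsXnE k : tpsX ^+ k = tps_of (fpsXn R k).
Proof. by rewrite -rmorphXn /= -fpsXnE. Qed.
Lemma tpsX_nilp k : (N < k)%N -> tpsX ^+ k = 0.
Proof.
move=> lt; rewrite tpsXnE; apply: tpsP => m le; rewrite tps_ofE // tps_coef0 /=.
by case: eqP => // mk; move: lt; rewrite -mk ltnNge le.
Qed.
Lemma tps_coefXnM k x m : (m <= N)%N ->
  (tpsX ^+ k * x) m = if (k <= m)%N then x (m - k)%N else 0.
Proof.
move=> le; rewrite -fps_coefXnM -[RHS](tps_ofE _ le).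
congr (tps_fps _ m); rewrite -[x in LHS]tps_fpsK tpsXnE.
exact: esym (rmorphM _ _ _).
Qed.

Lemma tps_divX k x : (forall m, (m < k)%N -> x m = 0) ->
  exists y, x = tpsX ^+ k * y.
Proof.
move=> x0; exists (tps_of (FPS (fun m => x (m + k)%N))).
apply: tpsP => m le; rewrite tps_coefXnM //; case: leqP => [lekm|/x0 //].
by rewrite tps_ofE ?(leq_trans (leq_subr _ _)) //= subnK.
Qed.

End Tps.
Arguments tps_of : simpl never.
Arguments tpsC : simpl never.
Arguments tps_const : simpl never.

Section TpsMap.
Variables (N : nat) (R S : comNzRingType) (phi : {rmorphism R -> S}).
Definition tps_map (x : tps N R) : tps N S := tps_of N (fps_map phi x).
Lemma tps_mapE x m : tps_map x m = phi (x m).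
Proof.
case: (leqP m N) => [le|lt]; first exact: tps_ofE.
by rewrite !tps_big ?rmorph0.
Qed.
Lemma tps_map_of f : tps_map (tps_of N f) = tps_of N (fps_map phi f).
Proof. by apply: tpsP => m le; rewrite tps_mapE !tps_ofE. Qed.
Fact tps_map_is_zmod_morphism : zmod_morphism tps_map.
Proof. by move=> x y; apply: tpsP => m _; rewrite tps_coefB !tps_mapE tps_coefB rmorphB. Qed.
Fact tps_map_is_monoid_morphism : monoid_morphism tps_map.
Proof.
split=> [|x y]; first by rewrite /GRing.one /= tps_map_of rmorph1.
by rewrite -(tps_fpsK x) -(tps_fpsK y) -rmorphM /= !tps_map_of rmorphM rmorphM.
Qed.
HB.instance Definition _ := GRing.isZmodMorphism.Build (tps N R) (tps N S)
  tps_map tps_map_is_zmod_morphism.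
HB.instance Definition _ := GRing.isMonoidMorphism.Build (tps N R) (tps N S)
  tps_map tps_map_is_monoid_morphism.
Lemma tps_mapC c : tps_map (tpsC N c) = tpsC N (phi c).
Proof.
by apply: tpsP => m _; rewrite tps_mapE !tps_coefC; case: ifP; rewrite ?rmorph0.
Qed.
Lemma tps_mapX : tps_map (tpsX N R) = tpsX N S.
Proof. by apply: tpsP => m le; rewrite tps_mapE !tps_ofE //= rmorph_nat. Qed.
Lemma tps_map_inj : injective phi -> injective tps_map.
Proof.
move=> inj x y e; apply: tpsP => m _; apply: inj.
by rewrite -!tps_mapE e.
Qed.
End TpsMap.
Arguments tps_map : simpl never.
Arguments coef_fps : simpl never.
Arguments fps_const : simpl never.

(** * Noetherian rings *)

Definition ideal_prop (R : comNzRingType) (I : R -> Prop) : Prop :=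
  [/\ I 0, forall x y, I x -> I y -> I (x + y) & forall a x, I x -> I (a * x)].

Definition in_span (R : comNzRingType) (g : seq R) (x : R) : Prop :=
  exists c : nat -> R, x = \sum_(i < size g) c i * g`_i.

Definition noetherian (R : comNzRingType) : Prop :=
  forall I : R -> Prop, ideal_prop I ->
  exists g : seq R, (forall x, x \in g -> I x) /\ (forall x, I x -> in_span g x).

Section Noetherian.
Variable R : comNzRingType.

Lemma ideal_sum (I : R -> Prop) (n : nat) (F : 'I_n -> R) :
  ideal_prop I -> (forall i, I (F i)) -> I (\sum_i F i).
Proof. by case=> I0 ID _ IF; elim/big_ind: _. Qed.

Lemma ideal_span (I : R -> Prop) g x :
  ideal_prop I -> (forall y, y \in g -> I y) -> in_span g x -> I x.
Proof.
move=> idI gI [c ->]; apply: ideal_sum => // i.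
by case: idI => _ _; apply; apply: gI; exact: mem_nth.
Qed.

Lemma in_span_mem (g : seq R) x : x \in g -> in_span g x.
Proof.
move=> xg; exists (fun i => (i == index x g)%:R).
have lt : (index x g < size g)%N by rewrite index_mem.
rewrite (bigD1 (Ordinal lt)) //= eqxx mul1r nth_index // big1 ?addr0 // => i ni.
case: (i =P index x g :> nat) => [e|_]; last by rewrite mul0r.
by case/eqP: ni; apply/val_inj.
Qed.

Lemma in_span_ideal (g : seq R) : ideal_prop (in_span g).
Proof.
split=> [|x y [c ->] [c' ->]|a x [c ->]].
- by exists (fun=> 0); rewrite big1 // => i _; rewrite mul0r.
- exists (fun i => c i + c' i); rewrite -big_split; apply: eq_bigr => i _.
  by rewrite mulrDl.
- exists (fun i => a * c i); rewrite mulr_sumr; apply: eq_bigr => i _.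
  by rewrite mulrA.
Qed.

Lemma noetherian_chain (I : nat -> R -> Prop) :
  noetherian R -> (forall n, ideal_prop (I n)) ->
  (forall n x, I n x -> I n.+1 x) ->
  exists n, forall m x, I m x -> I n x.
Proof.
move=> noeR idI incI.
have mono n m x : (n <= m)%N -> I n x -> I m x.
  by move/subnKC <-; elim: (m - n)%N => [|k IH]; rewrite ?addn0 // addnS => /IH/incI.
have idU : ideal_prop (fun x => exists n, I n x).
  split=> [|x y [n Ix] [m Iy]|a x [n Ix]].
  - by exists 0%N; case: (idI 0%N).
  - exists (n + m)%N; case: (idI (n + m)%N) => _ ID _; apply: ID.
      by apply: mono Ix; rewrite leq_addr.
    by apply: mono Iy; rewrite leq_addl.
  - by exists n; case: (idI n) => _ _; apply.
have [g [gI Ig]] := noeR _ idU.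
have [n gn] : exists n, forall x, x \in g -> I n x.
  elim: (g) gI {Ig} => [|y s IH] sI; first by exists 0%N.
  have [x xs|n sn] := IH; first by apply: sI; rewrite in_cons xs orbT.
  have [m ym] := sI y (mem_head _ _).
  exists (n + m)%N => x; rewrite in_cons => /orP[/eqP ->|/sn].
    by apply: mono ym; rewrite leq_addl.
  by apply: mono; rewrite leq_addr.
by exists n => m x Ix; apply: (ideal_span (g := g)) => //; apply: Ig; exists m.
Qed.

Lemma noetherian_img (S : comNzRingType) (f : {rmorphism R -> S}) :
  (forall y, exists x, f x = y) -> noetherian R -> noetherian S.
Proof.
move=> surj noeR I [I0 ID IM].
have idJ : ideal_prop (fun x => I (f x)).
  split; first by rewrite rmorph0.
    by move=> x y Ix Iy; rewrite rmorphD; apply: ID.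
  by move=> a x Ix; rewrite rmorphM; apply: IM.
have [g [gI Ig]] := noeR _ idJ.
exists (map f g); split=> [y /mapP[x xg ->]|y Iy]; first exact: gI.
have [x fx] := surj y.
have [|c xE] := Ig x; first by rewrite fx.
exists (fun i => f (c i)); rewrite size_map -fx xE rmorph_sum.
by apply: eq_bigr => i _; rewrite rmorphM (nth_map 0).
Qed.

End Noetherian.

Lemma noetherian_int : noetherian int.
Proof.
move=> I [I0 ID IM].
case: (pselect (exists x, I x /\ x != 0)) => [[x [Ix x0]]|n0]; last first.
  exists [::]; split=> // x Ix; exists (fun=> 0); rewrite big_ord0.
  by apply/eqP/negP => x0; apply: n0; exists x; split=> //; apply/negP.
have IN y : I y -> I (- y) by move=> Iy; rewrite -mulN1r; apply: IM.
have ex : exists n, `[< I n%:Z /\ (0 < n)%N >].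
  exists `|x|%N; apply/asboolP; split; last by rewrite absz_gt0.
  case: (intP x) Ix => [|k|k] Ix //=.
  by move/IN: Ix; rewrite opprK.
pose n := ex_minn ex.
have [[In n0] nmin] : (I n%:Z /\ (0 < n)%N) /\
    forall m, I m%:Z -> (0 < m)%N -> (n <= m)%N.
  rewrite /n; case: ex_minnP => m /asboolP Hm mmin; split=> // k Ik k0.
  by apply: mmin; apply/asboolP.
exists [:: n%:Z]; split=> [y|y Iy]; first by rewrite inE => /eqP ->.
have Ir : I (y %% n%:Z)%Z.
  have -> : (y %% n%:Z)%Z = y + (- (y %/ n%:Z)%Z) * n%:Z.
    by rewrite {2}(divz_eq y n%:Z); ring.
  by apply: ID => //; apply: IM.
have r0 : (0 <= (y %% n%:Z)%Z) by apply: modz_ge0; lia.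
have rlt : ((y %% n%:Z)%Z < n%:Z) by apply: ltz_pmod; lia.
exists (fun=> (y %/ n%:Z)%Z); rewrite big_ord1 /=.
rewrite {1}(divz_eq y n%:Z) [X in _ + X](_ : _ = 0) ?addr0 //.
move: r0 rlt Ir; case: (y %% n%:Z)%Z => // k _ lt Ik.
case: k lt Ik => // k lt /nmin /(_ isT); lia.
Qed.

Section Hilbert.
Variable R : comNzRingType.
Hypothesis noeR : noetherian R.
Variable I : {poly R} -> Prop.
Hypothesis idI : ideal_prop I.

Let lead n (a : R) := exists p, [/\ I p, (size p <= n.+1)%N & p`_n = a].

Let lead_ideal n : ideal_prop (lead n).
Proof.
case: idI => I0 ID IM; split=> [|a b [p [Ip sp pa]] [q [Iq sq qb]]|a b [p [Ip sp pa]]].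
- by exists 0; rewrite size_poly0 coef0.
- exists (p + q); split; [exact: ID| |by rewrite coefD pa qb].
  by rewrite (leq_trans (size_polyD _ _)) // geq_max sp.
- exists (a%:P * p); split; [exact: IM| |by rewrite coefCM pa].
  by rewrite mul_polyC (leq_trans (size_scale_leq _ _)).
Qed.

Let lead_inc n a : lead n a -> lead n.+1 a.
Proof.
case=> p [Ip sp pa]; exists ('X * p); split.
- by case: idI => _ _; apply.
- by rewrite (leq_trans (size_polyMleq _ _)) // size_polyX.
- by rewrite coefXM.
Qed.

Let lead_gens n : exists g : seq {poly R},
  (forall p, p \in g -> I p /\ (size p <= n.+1)%N) /\
  (forall a, lead n a -> in_span [seq p`_n | p : {poly R} <- g] a).
Proof.
have [s [sI Is]] := noeR (lead_ideal n).
suff [g [gI gs]] : exists g : seq {poly R},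
    (forall p, p \in g -> I p /\ (size p <= n.+1)%N) /\ [seq p`_n | p : {poly R} <- g] = s.
  by exists g; split=> // a /Is; rewrite gs.
elim: s sI {Is} => [|a s IH] sI; first by exists [::].
have [x xs|g [gI gs]] := IH; first by apply: sI; rewrite in_cons xs orbT.
have [p [Ip sp pa]] := sI a (mem_head _ _).
exists (p :: g); split=> [q|]; last by rewrite /= pa gs.
by rewrite in_cons => /orP[/eqP ->|/gI].
Qed.

(** The ideals of leading coefficients grow with the degree and are constant from some d on.
    Elements of degree at most d realising their generators suffice: a combination of them,
    multiplied by powers of X, cancels the top coefficient of any member of [I]. *)
Lemma hilbert_basis_ideal : exists g : seq {poly R},
  (forall x, x \in g -> I x) /\ (forall x, I x -> in_span g x).
Proof.
have [d dmax] := noetherian_chain noeR lead_ideal lead_inc.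
pose G n := projT1 (cid (lead_gens n)).
have GP n : (forall p, p \in G n -> I p /\ (size p <= n.+1)%N) /\
    (forall a, lead n a -> in_span [seq p`_n | p : {poly R} <- G n] a).
  by rewrite /G; case: (cid _).
pose g := flatten [seq G n | n <- iota 0 d.+1].
have Gg n p : (n <= d)%N -> p \in G n -> p \in g.
  by move=> le pG; apply/flatten_mapP; exists n; rewrite // mem_iota.
exists g; split=> [p /flatten_mapP[n _ /(proj1 (GP n)) []] //|p].
have [spg0 spgD spgM] := in_span_ideal g.
have [I0 ID IM] := idI.
have IB x y : I x -> I y -> I (x - y).
  by move=> Ix Iy; apply: ID => //; rewrite -mulN1r; apply: IM.
have [m] := ubnP (size p); elim: m p => // m IH p; rewrite ltnS => sp Ip.
case: (eqVneq p 0) => [->//|p0].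
pose n := (size p).-1.
have spn : size p = n.+1 by rewrite /n prednK // lt0n size_poly_eq0.
(* Above degree d the generators of degree d are used, raised by ['X^(n - e)]. *)
pose e := minn n d.
have [c cE] : in_span [seq q`_e | q : {poly R} <- G e] (lead_coef p).
  apply: (proj2 (GP e)); rewrite /e; case: (leqP n d) => [le|lt].
    by exists p; split=> //; rewrite spn.
  apply: (dmax n).
  by exists p; split=> //; rewrite spn.
pose q := \sum_(i < size (G e)) c i *: ('X^(n - e) * (G e)`_i).
have le_e : (e <= n)%N by rewrite /e geq_minl.
have Gi i : (i < size (G e))%N -> (G e)`_i \in G e by move=> lt; exact: mem_nth.
have qspan : in_span g q.
  apply: ideal_sum; first exact: in_span_ideal.
  move=> i; rewrite -mul_polyC; apply: (spgM); apply: (spgM).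
  by apply: in_span_mem; apply: (Gg e); [rewrite /e geq_minr | exact: Gi].
have qI : I q.
  apply: ideal_sum => // i; rewrite -mul_polyC; apply: (IM); apply: (IM).
  by case: (proj1 (GP e) _ (Gi i (ltn_ord i))).
have sq : (size q <= n.+1)%N.
  apply: (leq_trans (size_sum _ _ _)); apply/bigmax_leqP => i _.
  apply: (leq_trans (size_scale_leq _ _)).
  apply: (leq_trans (size_polyMleq _ _)); rewrite size_polyXn /=.
  case: (proj1 (GP e) _ (Gi i (ltn_ord i))) => _ si.
  by rewrite (leq_trans (leq_add (leqnn _) si)) // addnS subnK.
have qn : q`_n = p`_n.
  rewrite coef_sum -[RHS]/(p`_(size p).-1) -lead_coefE cE size_map.
  apply: eq_bigr => i _; rewrite coefZ coefXnM ltnNge leq_subr /=.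
  by rewrite subKn // (nth_map 0).
have -> : p = q + (p - q) by rewrite addrC subrK.
apply: spgD => //; apply: IH; last exact: IB.
apply: (leq_trans _ sp); rewrite spn ltnS; apply/leq_sizeP => j.
rewrite leq_eqVlt coefB => /orP[/eqP <-|lt]; first by rewrite qn subrr.
by rewrite !nth_default ?subrr // ?spn // (leq_trans sq).
Qed.
End Hilbert.

Lemma noetherian_poly (R : comNzRingType) : noetherian R -> noetherian {poly R}.
Proof. by move=> noeR I; exact: hilbert_basis_ideal. Qed.

(** The ring is the image of an iterated polynomial ring over [int]: that image is a subring
    containing the generators. *)
Lemma fin_gen_noetherian (R : comNzRingType) : fin_gen_ring R -> noetherian R.
Proof.
case=> gens genR.
have [A [noeA [f fg]]] : exists A : comNzRingType, noetherian A /\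
    exists f : {rmorphism A -> R}, forall x, x \in gens -> exists a, f a = x.
  elim: (gens) => [|x s [A [noeA [f fs]]]].
    by exists int; split; [exact: noetherian_int | exists intr].
  exists {poly A}; split; first exact: noetherian_poly.
  have cfx : commr_rmorph f x by move=> a; exact: mulrC.
  exists (horner_morph cfx) => y; rewrite in_cons => /orP[/eqP ->|/fs[a <-]].
    by exists 'X; exact: horner_morphX.
  by exists a%:P; exact: horner_morphC.
apply: (noetherian_img (f := f)) noeA => y.
apply/asboolP; apply: (genR (fun y => `[< exists x, f x = y >])); last first.
  by move=> x /fg ?; apply/asboolP.
split; first by apply/asboolP; exists 1; rewrite rmorph1.
  move=> x z /asboolP[a <-] /asboolP[b <-]; apply/asboolP.
  by exists (a - b); rewrite rmorphB.
move=> x z /asboolP[a <-] /asboolP[b <-]; apply/asboolP.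
by exists (a * b); rewrite rmorphM.
Qed.

(* [R / h R] is Noetherian, so its Z-torsion is killed by one integer. *)
Lemma regular_mod_prime (R : comNzRingType) (h : R) : fin_gen_ring R ->
  (forall x, h * x = 0 -> x = 0) ->
  exists C : nat, forall p, prime p -> (C < p)%N ->
    forall x y, h * x = y *+ p -> exists z, x = z *+ p.
Proof.
move=> /fin_gen_noetherian noeR hreg.
(* [J] is the preimage in [R] of the additive torsion of [R / h R]. *)
pose J (x : R) := exists n y, (0 < n)%N /\ x *+ n = h * y.
have idJ : ideal_prop J.
  split=> [|x y [n [a [n0 xa]]] [m [b [m0 yb]]]|a x [n [b [n0 xb]]]].
  - by exists 1%N, 0; rewrite mulr0 mul0rn.
  - exists (n * m)%N, (a *+ m + b *+ n); split; first by rewrite muln_gt0 n0.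
    by rewrite mulrnDl mulrnA xa mulnC mulrnA yb mulrDr !mulrnAr.
  - by exists n, (a * b); split=> //; rewrite -mulrnAr xb; ring.
have [g [gJ Jg]] := noeR _ idJ.
have [n [n0 gn]] : exists n, (0 < n)%N /\ forall x, x \in g ->
    exists y, x *+ n = h * y.
  elim: (g) gJ {Jg} => [|x s IH] sJ; first by exists 1%N.
  have [y ys|n [n0 sn]] := IH; first by apply: sJ; rewrite in_cons ys orbT.
  have [m [b [m0 xb]]] := sJ x (mem_head _ _).
  exists (n * m)%N; split; first by rewrite muln_gt0 n0.
  move=> y; rewrite in_cons => /orP[/eqP ->|/sn[z yz]].
    by exists (b *+ n); rewrite mulnC mulrnA xb mulrnAr.
  by exists (z *+ m); rewrite mulrnA yz mulrnAr.
have Jn x : J x -> exists y, x *+ n = h * y.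
  case/Jg=> c ->; rewrite -sumrMnl; elim/big_ind: _.
  - by exists 0; rewrite mulr0.
  - by move=> u v [a ->] [b ->]; exists (a + b); rewrite mulrDr.
  - move=> i _; have [y yE] := gn _ (mem_nth 0 (ltn_ord i)).
    by exists (c i * y); rewrite -mulrnAr yE; ring.
exists n => p pp np x y hxy.
have [|z yz] := Jn y; first by exists p, x; rewrite prime_gt0.
have cop : coprime n p.
  by rewrite coprime_sym prime_coprime // gtnNdvd.
(* Bezout for n and p combines y n = h z and y p = h x into y = h (u z - v x), after which h
   cancels. *)
case: (egcdnP p n0) => u v uv _; rewrite (eqP cop) in uv.
exists (z *+ u - x *+ v); apply/eqP; rewrite -subr_eq0; apply/eqP; apply: hreg.
have yE : y = h * (z *+ u - x *+ v).
  rewrite mulrBr !mulrnAr -yz hxy -!mulrnA -mulrnBr; last by rewrite (mulnC n) uv mulnC leq_addr.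
  by rewrite (mulnC n) uv (mulnC p) addKn.
by rewrite mulrBr hxy {1}yE mulrnAr subrr.
Qed.

(** * Determinants of band matrices *)

Section Weight.
Variables (T : comNzRingType) (t : T) (b N : nat).
Hypothesis t_nilp : forall k, (N < k)%N -> t ^+ k = 0.

(* The filtration by t-adic order, an order [k] counting for [k * b]. *)
Definition wt (x : T) (e : nat) : Prop :=
  exists k y, x = t ^+ k * y /\ (e <= k * b)%N.

Lemma wt0r x : wt x 0.
Proof. by exists 0%N, x; rewrite mul1r. Qed.
Lemma wt_leq x e f : (f <= e)%N -> wt x e -> wt x f.
Proof. by move=> le [k [y [-> ek]]]; exists k, y; rewrite (leq_trans le). Qed.
Lemma wt_mul x y e f : wt x e -> wt y f -> wt (x * y) (e + f).
Proof.
move=> [k [u [-> ek]]] [m [v [-> fm]]]; exists (k + m)%N, (u * v).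
by split; [rewrite exprD; ring | rewrite mulnDl leq_add].
Qed.
Lemma wt_eq0 x e : (N * b < e)%N -> wt x e -> x = 0.
Proof.
move=> lt [k [y [-> ek]]]; rewrite t_nilp ?mul0r //.
by by rewrite ltnNge; apply/negP => le; move: (leq_mul le (leqnn b)); lia.
Qed.
Lemma wt_add x y e : wt x e -> wt y e -> wt (x + y) e.
Proof.
move=> [k [u [-> ek]]] [m [v [-> fm]]].
exists (minn k m), (t ^+ (k - minn k m) * u + t ^+ (m - minn k m) * v); split.
  by rewrite mulrDr !mulrA -!exprD !subnKC ?geq_minl ?geq_minr.
by case: (leqP k m).
Qed.
Lemma wt_opp x e : wt x e -> wt (- x) e.
Proof. by move=> [k [u [-> ek]]]; exists k, (- u); rewrite mulrN. Qed.
Lemma wt_mulr x y e : wt x e -> wt (x * y) e.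
Proof. by move=> xe; rewrite -(addn0 e); apply: wt_mul => //; exact: wt0r. Qed.
Lemma wt_mull x y e : wt y e -> wt (x * y) e.
Proof. by rewrite mulrC; exact: wt_mulr. Qed.
Lemma wt_sum (I : Type) (s : seq I) (P : pred I) (F : I -> T) e :
  wt 0 e -> (forall i, P i -> wt (F i) e) -> wt (\sum_(i <- s | P i) F i) e.
Proof. by move=> w0 wF; elim/big_ind: _ => // x y; exact: wt_add. Qed.
Lemma wt_prod (I : Type) (s : seq I) (P : pred I) (F : I -> T) (e : I -> nat) :
  (forall i, P i -> wt (F i) (e i)) ->
  wt (\prod_(i <- s | P i) F i) (\sum_(i <- s | P i) e i).
Proof.
move=> wF; elim/big_rec2: _ => [|i y x Pi w]; first exact: wt0r.
by apply: wt_mul => //; apply: wF.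
Qed.

Hypothesis b_gt0 : (0 < b)%N.

Lemma wt_0 e : wt 0 e.
Proof. by exists e, 0; rewrite mulr0; split=> //; rewrite leq_pmulr. Qed.

(** The terms of the cofactor come from permutations sending j to i. Displacements of a permutation
    add up to zero, so the other points are displaced by at least |i - j| in total. *)
Lemma wt_adj n (A : 'M[T]_n) :
  (forall i j, wt (A i j) `|i - j|%N) ->
  forall i j, wt (\adj A i j) `|i - j|%N.
Proof.
move=> wA i j; rewrite !mxE expand_cofactor; apply: wt_sum => [|s /eqP sj].
  exact: wt_0.
apply: wt_mull.
have w : wt (\prod_(k | j != k) A k (s k)) (\sum_(k : 'I_n | j != k) `|k - s k|%N)%N.
  by apply: wt_prod => k _; exact: wA.
apply: wt_leq w.
have sum_s : (i + \sum_(k : 'I_n | j != k) s k = j + \sum_(k : 'I_n | j != k) k)%N.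
  have e (F : 'I_n -> nat) : (\sum_k F k = F j + \sum_(k | j != k) F k)%N.
    by rewrite (bigD1 j) //=; congr (_ + _)%N; apply: eq_bigl => k; rewrite eq_sym.
  rewrite -(e (fun k => k : nat)) -{1}sj -(e (fun k => s k : nat)).
  by rewrite [RHS](reindex_inj (@perm_inj _ s)).
have le1 : (\sum_(k : 'I_n | j != k) s k <= \sum_(k : 'I_n | j != k) k + \sum_(k : 'I_n | j != k) `|k - s k|)%N.
  by rewrite -big_split /=; apply: leq_sum => k _; lia.
have le2 : (\sum_(k : 'I_n | j != k) k <= \sum_(k : 'I_n | j != k) s k + \sum_(k : 'I_n | j != k) `|k - s k|)%N.
  by rewrite -big_split /=; apply: leq_sum => k _; lia.
lia.
Qed.

(* A permutation moves every point forward cyclically, by a total of a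
   multiple of [p]; only the identity has total less than [p]. *)
Lemma det_cyclic p (A : 'M[T]_p) : (N * b < p)%N ->
  (forall i j, wt (A i j) ((j + p - i) %% p)) -> \det A = \prod_i A i i.
Proof.
move=> lt wA; rewrite /determinant (bigD1 1%g) //= odd_perm1 expr0 mul1r.
under eq_bigr do rewrite perm1.
rewrite [X in _ + X]big1 ?addr0 // => s s1.
rewrite (@wt_eq0 (\prod_i A i (s i)) (\sum_i ((s i + p - i) %% p)%N)%N) ?mulr0 //; last first.
  by apply: wt_prod => i _.
apply: (leq_trans lt).
have [i si] : exists i, s i != i.
  apply/existsP; apply: contraR s1 => /existsPn fix_s; apply/eqP/permP => i.
  by rewrite perm1; apply/eqP; move: (fix_s i); rewrite negbK.
have dv : (p %| \sum_(j < p) ((s j + p - j) %% p))%N.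
  rewrite /dvdn modn_summ.
  have e : (\sum_(j < p) (s j + p - j) + \sum_(j < p) j =
            \sum_(j < p) j + p * p)%N.
    rewrite -big_split /= (eq_bigr (fun j => s j + p)%N) => [|j _].
      rewrite big_split /= sum_nat_const card_ord; congr (_ + _)%N.
      by rewrite [RHS](reindex_inj (@perm_inj _ s)).
    by rewrite subnK // (leq_trans (ltnW (ltn_ord j))) ?leq_addl.
  have -> : (\sum_(j < p) (s j + p - j) = p * p)%N by lia.
  by rewrite modnMl.
have gt0 : (0 < \sum_(j < p) ((s j + p - j) %% p))%N.
  rewrite (bigD1 i) //= addn_gt0; apply/orP; left; rewrite lt0n.
  apply: contra si => /dvdnP[q qE]; apply/eqP/val_inj => /=.
  have := ltn_ord i; have := ltn_ord (s i).
  case: q qE => [|[|q]]; rewrite ?mulSn; lia.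
exact: dvdn_leq.
Qed.

Lemma det_cyclic_tr p (A : 'M[T]_p) : (N * b < p)%N ->
  (forall i j, wt (A i j) ((i + p - j) %% p)) -> \det A = \prod_i A i i.
Proof.
move=> lt wA; rewrite -det_tr det_cyclic // => [|i j]; last by rewrite mxE.
by apply: eq_bigr => i _; rewrite mxE.
Qed.

End Weight.

(** * Solution modules of polynomial matrices *)

Section PolyMatrix.
Variable T : comNzRingType.

Lemma coefpE i (p : {poly T}) : coefp i p = p`_i. Proof. by []. Qed.

(** A matrix over T[X] is handled as a polynomial in X with these matrices as coefficients. *)
Definition cmx m n (A : 'M[{poly T}]_(m, n)) (i : nat) : 'M[T]_(m, n) :=
  map_mx (coefp i) A.

Definition msize m n (A : 'M[{poly T}]_(m, n)) : nat :=
  \max_(ij : 'I_m * 'I_n) size (A ij.1 ij.2).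

Lemma cmx_big m n (A : 'M[{poly T}]_(m, n)) i : (msize A <= i)%N -> cmx A i = 0.
Proof.
move=> le; apply/matrixP => a b; rewrite !mxE coefpE nth_default //.
by apply: leq_trans le; rewrite (leq_bigmax (a, b)).
Qed.

Lemma cmxM m n q (A : 'M[{poly T}]_(m, n)) (B : 'M_(n, q)) k :
  cmx (A *m B) k = \sum_(i < k.+1) cmx A i *m cmx B (k - i).
Proof.
apply/matrixP => a b; rewrite !mxE coefpE coef_sum summxE.
transitivity (\sum_(j < n) \sum_(i < k.+1) (A a j)`_i * (B j b)`_(k - i)).
  by apply: eq_bigr => j _; rewrite coefM.
rewrite exchange_big; apply: eq_bigr => i _; rewrite mxE.
by apply: eq_bigr => j _; rewrite !mxE !coefpE.
Qed.

Lemma cmxD m n (A B : 'M[{poly T}]_(m, n)) k : cmx (A + B) k = cmx A k + cmx B k.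
Proof. exact: map_mxD. Qed.
Lemma cmxN m n (A : 'M[{poly T}]_(m, n)) k : cmx (- A) k = - cmx A k.
Proof. exact: map_mxN. Qed.
Lemma cmx_sum m n (I : Type) (s : seq I) (F : I -> 'M[{poly T}]_(m, n)) k :
  cmx (\sum_(i <- s) F i) k = \sum_(i <- s) cmx (F i) k.
Proof.
elim: s => [|i s IH]; first by rewrite !big_nil; exact: map_mx0.
by rewrite !big_cons cmxD IH.
Qed.
Lemma cmxP m n (A B : 'M[{poly T}]_(m, n)) :
  (forall k, cmx A k = cmx B k) -> A = B.
Proof.
move=> AB; apply/matrixP => i j; apply/polyP => k.
by have /matrixP/(_ i j) := AB k; rewrite !mxE.
Qed.

Definition constmx m n (A : 'M[T]_(m, n)) : 'M[{poly T}]_(m, n) := map_mx polyC A.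
Lemma cmx_const m n (A : 'M[T]_(m, n)) k :
  cmx (constmx A) k = if k == 0%N then A else 0.
Proof.
by apply/matrixP => i j; rewrite !mxE coefpE coefC; case: ifP; rewrite ?mxE.
Qed.
Lemma constmxM m n q (A : 'M[T]_(m, n)) (B : 'M_(n, q)) :
  constmx (A *m B) = constmx A *m constmx B.
Proof. exact: map_mxM. Qed.
Lemma cmx_constM m n q (A : 'M[T]_(m, n)) (B : 'M_(n, q)) k :
  cmx (constmx A *m B) k = A *m cmx B k.
Proof.
rewrite cmxM big_ord_recl cmx_const /= subn0 big1 ?addr0 // => i _.
by rewrite cmx_const mul0mx.
Qed.
Lemma cmx_Mconst m n q (A : 'M_(m, n)) (B : 'M[T]_(n, q)) k :
  cmx (A *m constmx B) k = cmx A k *m B.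
Proof.
rewrite cmxM big_ord_recr /= subnn cmx_const big1 ?add0r // => i _.
by rewrite cmx_const; case: eqP => [|_]; [have := ltn_ord i; lia | rewrite mulmx0].
Qed.
Lemma cmx_XnM m n (A : 'M[{poly T}]_(m, n)) j k :
  cmx ('X^j *: A) k = if (k < j)%N then 0 else cmx A (k - j).
Proof.
by apply/matrixP => a c; rewrite !mxE !coefpE coefXnM; case: ifP; rewrite !mxE.
Qed.

Lemma poly_mxE m n (A : 'M[{poly T}]_(m, n)) k : (msize A <= k)%N ->
  A = \sum_(i < k) 'X^i *: constmx (cmx A i).
Proof.
move=> le; apply: cmxP => j; rewrite cmx_sum.
have e (i : 'I_k) : cmx ('X^i *: constmx (cmx A i)) j =
    if i == j :> nat then cmx A i else 0.
  rewrite cmx_XnM cmx_const; case: ltngtP => [lt|lt|->]; rewrite ?subnn //.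
  by rewrite subn_eq0 leqNgt lt.
case: (ltnP j k) => [lt|ge].
  rewrite (bigD1 (Ordinal lt)) // e /= eqxx big1 ?addr0 // => i ni.
  by rewrite e; case: eqP => // ij; case/eqP: ni; apply/val_inj.
rewrite cmx_big ?(leq_trans le) // big1 // => i _; rewrite e; case: eqP => // ij.
by have := ltn_ord i; rewrite ij ltnNge ge.
Qed.

Section Factor.
Variables (d : nat) (Lam : 'M[T]_d).
Definition pencil : 'M[{poly T}]_d := 'X%:M - constmx Lam.

Lemma char_poly_pencil : char_poly Lam = \det pencil.
Proof. by []. Qed.

(** Noncommutative factor theorem. Subtracting the vanishing value at [Lam] writes C as the sum of
    (X^i - Lam^i) C_i, and X - Lam divides each difference of powers. *)
Lemma pencil_lfactor q (C : 'M[{poly T}]_(d, q)) k : (msize C <= k)%N ->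
  \sum_(i < k) Lam ^+ i *m cmx C i = 0 -> exists J, C = pencil *m J.
Proof.
move=> le C0.
have cX : GRing.comm ('X%:M : 'M[{poly T}]_d) (constmx Lam).
  by rewrite /GRing.comm -[LHS]/(_ *m _) -[RHS]/(_ *m _) scalar_mxC.
have XnE i : ('X^i)%:M = ('X%:M : 'M[{poly T}]_d) ^+ i.
  elim: i => [|i IH]; first by rewrite expr0.
  by rewrite [RHS]exprS -IH -[RHS]/(_ *m _) mul_scalar_mx scale_scalar_mx -exprS.
have LnE i : constmx (Lam ^+ i) = constmx Lam ^+ i.
  elim: i => [|i IH]; first by rewrite !expr0 /constmx map_mx1.
  by rewrite [RHS]exprS -IH -[RHS]/(_ *m _) -constmxM [X in constmx X]exprS.
pose J := \sum_(i < k) (\sum_(j < i) ('X%:M) ^+ (i.-1 - j) *m constmx Lam ^+ j)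
   *m constmx (cmx C i).
exists J; rewrite /J mulmx_sumr.
have CE : C = \sum_(i < k) (('X^i)%:M - constmx (Lam ^+ i)) *m constmx (cmx C i).
  under eq_bigr do rewrite mulmxBl mul_scalar_mx -constmxM.
  rewrite sumrB -poly_mxE // [X in _ - X](_ : _ = 0) ?subr0 //.
  have <- : constmx (\sum_(i < k) Lam ^+ i *m cmx C i) = \sum_(i < k) constmx (Lam ^+ i *m cmx C i).
    exact: (map_mx_sum polyC).
  by rewrite C0; exact: map_mx0.
rewrite [LHS]CE; apply: eq_bigr => i _; rewrite mulmxA XnE LnE; congr (_ *m _).
exact: (subrXX_comm i cX).
Qed.

End Factor.

Lemma pencil_rfactor d n (Lam : 'M[T]_d) (C : 'M[{poly T}]_(n, d)) k :
  (msize C <= k)%N -> \sum_(i < k) cmx C i *m Lam ^+ i = 0 ->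
  exists H, C = H *m pencil Lam.
Proof.
move=> le C0.
have cmxT i : cmx C^T i = (cmx C i)^T by rewrite /cmx map_trmx.
have [||J JE] := @pencil_lfactor d Lam^T n C^T k.
- apply: leq_trans le; apply/bigmax_leqP => -[i j] _ /=; rewrite mxE.
  exact: (leq_bigmax (j, i)).
- rewrite -[RHS]trmx0 -C0 raddf_sum; apply: eq_bigr => i _ /=.
  rewrite cmxT trmx_mul; congr (_ *m _).
  elim: (nat_of_ord i) => [|j IH]; first by rewrite !expr0 trmx1.
  by rewrite [in LHS]exprS [in RHS]exprSr IH -[RHS]/((_ *m _)^T) trmx_mul.
exists J^T; apply: trmx_inj; rewrite JE trmx_mul trmxK; congr (_ *m _).
by rewrite /pencil raddfB /= tr_scalar_mx /constmx map_trmx.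
Qed.

End PolyMatrix.

Lemma col_mulmx (T : comNzRingType) m n q (A : 'M[T]_(m, n)) (B : 'M_(n, q)) j :
  col j (A *m B) = A *m col j B.
Proof. by rewrite !colE mulmxA. Qed.

Lemma mulmx_ifl (T : comNzRingType) m n q (A : 'M[T]_(m, n)) (B : 'M_(n, q)) (c : bool) :
  (if c then A else 0) *m B = if c then A *m B else 0.
Proof. by case: c; rewrite ?mul0mx. Qed.
Lemma mulmx_ifr (T : comNzRingType) m n q (A : 'M[T]_(m, n)) (B : 'M_(n, q)) (c : bool) :
  A *m (if c then B else 0) = if c then A *m B else 0.
Proof. by case: c; rewrite ?mulmx0. Qed.

(** Reindexing behind [act_coefr] and [act_coefl]: on coefficients listed backwards from degree m-1,
    the shift action computes coefficient m-1-b of a product. *)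
Lemma conv_window (V : zmodType) m k b (G : nat -> nat -> V) :
  (forall i j, (k <= i)%N -> G i j = 0) ->
  \sum_(i < k) (if (b + i < m)%N then G i (m - 1 - (b + i))%N else 0) =
  if (b < m)%N then \sum_(i < (m - 1 - b).+1) G i (m - 1 - b - i)%N else 0.
Proof.
move=> G0; case: ltnP => [lt|ge]; last first.
  by rewrite big1 // => i _; rewrite ltnNge (leq_trans ge) ?leq_addr.
pose F i := if (b + i < m)%N then G i (m - 1 - (b + i))%N else 0.
have F0 j i : (k <= j)%N || (m - b <= j)%N -> (j <= i)%N -> F i = 0.
  rewrite /F => /orP[kj|mj] ji; first by rewrite G0 ?(leq_trans kj) ?if_same.
  by rewrite ifF //; lia.
have widen j j' : (k <= j)%N || (m - b <= j)%N -> (j <= j')%N ->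
    \sum_(i < j) F i = \sum_(i < j') F i.
  move=> kj le; rewrite -!(big_mkord xpredT F) [RHS](big_cat_nat (n := j)) //=.
  rewrite [X in _ + X]big_nat_cond [X in _ + X]big1 ?addr0 //.
  by move=> i /andP[/andP[ji _] _]; apply: (F0 j).
rewrite -[LHS]/(\sum_(i < k) F i) (widen k (k + (m - b))%N) ?leqnn ?leq_addr //.
rewrite -(widen (m - b)%N) ?leqnn ?orbT ?leq_addl //.
have -> : (m - 1 - b).+1 = (m - b)%N by lia.
apply: eq_bigr => i _; have lti := ltn_ord i; rewrite /F ifT; last by lia.
by congr G; lia.
Qed.

Section SolutionModule.
Variables (T : comNzRingType) (n d : nat).
Variables (D : 'M[{poly T}]_n) (X : 'M[T]_(n, d)) (Lam : 'M[T]_d).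

(* [D] acts on sequences through the shift, so that the sequences
   [b |-> X Lam^b c] are the image of the module with matrix [Lam]. *)
Definition seq_act q (y : nat -> 'M[T]_(n, q)) b : 'M[T]_(n, q) :=
  \sum_(i < msize D) cmx D i *m y (b + i)%N.

Hypothesis X_sol : \sum_(i < msize D) cmx D i *m (X *m Lam ^+ i) = 0.
Hypothesis X_span : forall y : nat -> 'cV[T]_n,
  (exists B, forall b, (B <= b)%N -> y b = 0) -> (forall b, seq_act y b = 0) ->
  exists c : 'cV[T]_d, forall b, y b = X *m (Lam ^+ b *m c).
Hypothesis X_free : forall c : 'cV[T]_d,
  (forall b, X *m (Lam ^+ b *m c) = 0) -> c = 0.
Variable B : nat.
Hypothesis X_nilp : forall b, (B <= b)%N -> X *m Lam ^+ b = 0.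
Variables (m : nat) (theta rest : {poly T}).
Hypothesis det_inv : \det D * theta = 'X^m + 'X^(m + B.+1) * rest.

Let X_free_mx q (c : 'M[T]_(d, q)) :
  (forall b, X *m (Lam ^+ b *m c) = 0) -> c = 0.
Proof.
move=> c0; apply/matrixP => i j; rewrite [RHS]mxE.
have /matrixP/(_ i 0) : col j c = 0.
  by apply: X_free => b; rewrite -!col_mulmx c0 col0.
by rewrite !mxE.
Qed.

Let Lam_nilp b : (B <= b)%N -> Lam ^+ b = 0.
Proof.
move=> le; rewrite -[LHS]mulmx1; apply: X_free_mx => b'.
rewrite mulmx1 -[Lam ^+ b' *m _]exprD X_nilp //.
by rewrite (leq_trans le) // leq_addl.
Qed.

(** A two-sided inverse of [D] up to the scalar [E], and [E] agrees with ['X^m] through degree m +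
    B. *)
Let Z : 'M[{poly T}]_n := theta *: \adj D.
Let E : {poly T} := 'X^m + 'X^(m + B.+1) * rest.
Let DZ : D *m Z = E%:M.
Proof. by rewrite /Z -scalemxAr mul_mx_adj scale_scalar_mx mulrC det_inv. Qed.
Let ZD : Z *m D = E%:M.
Proof. by rewrite /Z -scalemxAl mul_adj_mx scale_scalar_mx mulrC det_inv. Qed.
Let E_low k : (k < m)%N -> E`_k = 0.
Proof.
move=> lt; rewrite coefD coefXn coefXnM (leq_trans lt) ?leq_addr // addr0.
by case: eqP => // e; rewrite e ltnn in lt.
Qed.
Let E_m : E`_m = 1.
Proof. by rewrite coefD coefXn eqxx coefXnM ifT ?addr0 //; lia. Qed.
Let E_high k : (m < k)%N -> (k < m + B.+1)%N -> E`_k = 0.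
Proof.
move=> lt lt'; rewrite coefD coefXn coefXnM lt' addr0.
by case: eqP => // e; rewrite e ltnn in lt.
Qed.

(** Listing the coefficients below degree m backwards turns polynomial matrices into finitely
    supported sequences, the shift becoming a division by X. *)
Let rseq q (A : 'M[{poly T}]_(n, q)) b : 'M[T]_(n, q) :=
  if (b < m)%N then cmx A (m - 1 - b) else 0.

Let act_coefr q r (A : 'M[{poly T}]_(n, r)) (C : 'M[{poly T}]_(r, q)) k b :
  (msize C <= k)%N ->
  \sum_(i < k) rseq A (b + i) *m cmx C i = rseq (A *m C) b.
Proof.
move=> le; rewrite /rseq cmxM.
under eq_bigr do rewrite mulmx_ifl.
rewrite (@conv_window _ m k b (fun i j => cmx A j *m cmx C i)); last first.
  by move=> i j kj; rewrite (cmx_big (leq_trans le kj)) mulmx0.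
case: ifP => // lt; rewrite (reindex_inj rev_ord_inj) /=.
by apply: eq_bigr => i _; rewrite subSS subKn // -ltnS.
Qed.

Let act_coefl q (A : 'M[{poly T}]_(n, q)) b : seq_act (rseq A) b = rseq (D *m A) b.
Proof.
rewrite /seq_act /rseq cmxM.
under eq_bigr do rewrite mulmx_ifr.
rewrite (@conv_window _ m (msize D) b (fun i j => cmx D i *m cmx A j)) //.
by move=> i j kj; rewrite (cmx_big kj) mul0mx.
Qed.

Let span_mx q (y : nat -> 'M[T]_(n, q)) :
  (exists B, forall b, (B <= b)%N -> y b = 0) -> (forall b, seq_act y b = 0) ->
  exists c : 'M[T]_(d, q), forall b, y b = X *m (Lam ^+ b *m c).
Proof.
move=> [B' y0] ysol.
have /choice[c cP] : forall j : 'I_q, exists c : 'cV[T]_d,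
    forall b, col j (y b) = X *m (Lam ^+ b *m c).
  move=> j; apply: X_span => [|b].
    by exists B' => b le; rewrite y0 // col0.
  rewrite -[RHS](col0 _ _ j) -(ysol b) /seq_act.
  transitivity (\sum_(i < msize D) col j (cmx D i *m y (b + i)%N)).
    by apply: eq_bigr => i _; rewrite col_mulmx.
  by apply/colP => i; rewrite !(summxE, mxE); apply: eq_bigr => k _; rewrite mxE.
exists (\matrix_(i, j) c j i 0) => b; apply/matrixP => i j.
have /colP/(_ i) := cP j b; rewrite mxE => ->.
rewrite -[X in X *m _](mulmx1 X) -!mulmxA !mul1mx.
have -> : c j = col j (\matrix_(i, j) c j i 0).
  by apply/colP => a; rewrite !mxE.
by rewrite -!col_mulmx [LHS]mxE.
Qed.

(** The columns of the reversed [Z] are solutions, since [E] vanishes below degree m; [psi] records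
    their coordinates. Then X - Lam divides [psi D] on the left, [D X] on the right (with quotient
    [H]), and [1 - psi H] on the left. Put into a block matrix, the three quotients give a matrix
    whose determinant times [char_poly Lam] is [det D]. *)
Lemma det_sol_module : exists q, \det D = char_poly Lam * q.
Proof.
have rseq_scalar b : rseq (E%:M) b = 0.
  rewrite /rseq; case: ifP => // lt; apply/matrixP => i j.
  rewrite !mxE coefpE coefMn E_low ?mul0rn //; lia.
have [psi psiE] : exists psi, forall b, rseq Z b = X *m (Lam ^+ b *m psi).
  apply: span_mx => [|b]; last by rewrite act_coefl DZ.
  by exists m => b le; rewrite /rseq ltnNge le.
have evalE q (C : 'M[{poly T}]_(n, q)) k b : (msize C <= k)%N ->
    rseq (Z *m C) b = X *m (Lam ^+ b *m \sum_(i < k) Lam ^+ i *m (psi *m cmx C i)).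
  move=> le; rewrite -(act_coefr _ _ le) !mulmx_sumr.
  apply: eq_bigr => i _; rewrite psiE -!mulmxA; congr (_ *m _).
  by rewrite !mulmxA -[Lam ^+ b *m _]exprD.
have size_constM q (C : 'M[{poly T}]_(n, q)) k : (msize C <= k)%N ->
    (msize (constmx psi *m C) <= k)%N.
  move=> le; apply/bigmax_leqP => -[i j] _ /=; apply/leq_sizeP => a ka.
  have := cmx_constM psi C a; rewrite (cmx_big (leq_trans le ka)) mulmx0.
  by move/matrixP/(_ i j); rewrite !mxE.
have [J JE] : exists J, constmx psi *m D = pencil Lam *m J.
  apply: (@pencil_lfactor _ _ _ _ _ (msize D)); first exact: size_constM.
  apply: X_free_mx => b.
  under [X in _ *m (_ *m X)]eq_bigr do rewrite cmx_constM.
  by rewrite -evalE // ZD.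
have [H HE] : exists H, D *m constmx X = H *m pencil Lam.
  apply: (@pencil_rfactor _ _ _ _ _ (msize D)).
    apply/bigmax_leqP => -[i j] _ /=; apply/leq_sizeP => a ka.
    have := cmx_Mconst D X a; rewrite (cmx_big ka) mul0mx.
    by move/matrixP/(_ i j); rewrite !mxE.
  by under eq_bigr do rewrite cmx_Mconst -mulmxA.
pose V := Z *m H.
have VE : V *m pencil Lam = E%:M *m constmx X by rewrite -mulmxA -HE mulmxA ZD.
have Vk k : (if k is k'.+1 then cmx V k' else 0) - cmx V k *m Lam = E`_k *: X.
  have := congr1 (fun A => cmx A k) VE.
  rewrite cmx_Mconst /pencil mulmxBr cmxD cmxN cmx_Mconst mul_mx_scalar.
  have -> : cmx ('X *: V) k = if k is k'.+1 then cmx V k' else 0.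
    by rewrite -['X]expr1 cmx_XnM; case: k => [|k] //=; rewrite subn1.
  move=> ->; rewrite -[E`_k *: X]mul_scalar_mx; congr (_ *m _).
  by apply/matrixP => i j; rewrite !mxE coefpE coefMn.
(* The B zero coefficients of [E] above degree m give V_m = V_(m+B) Lam^B, and Lam^B = 0. *)
have V0 : cmx V m *m Lam = 0.
  have step i : (i <= B)%N -> cmx V m = cmx V (m + i) *m Lam ^+ i.
    elim: i => [|i IH] le; first by rewrite addn0 expr0 mulmx1.
    rewrite IH ?(ltnW le) // addnS exprS -[Lam * _]/(_ *m _) mulmxA; congr (_ *m _).
    have := Vk (m + i).+1; rewrite E_high ?scale0r; try lia.
    by move/eqP; rewrite subr_eq0 => /eqP.
  by rewrite (step B) // Lam_nilp // mulmx0 mul0mx.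
(* Hence the reversed [V] starts at [X], and the zero coefficients of [E] below degree m make it
   continue as [X Lam^b]. *)
have vv0 : rseq V 0 = X.
  have := Vk m; rewrite E_m scale1r V0 subr0 /rseq subn0.
  by case: (m) => [|m'] //=; rewrite subn1.
have vvS b : rseq V b.+1 = rseq V b *m Lam.
  rewrite /rseq; case: (ltnP b m) => [lt|ge]; last first.
    by rewrite mul0mx ltnNge (leq_trans ge).
  have := Vk (m - 1 - b)%N; rewrite E_low ?scale0r; last by lia.
  move/eqP; rewrite subr_eq0 => /eqP <-.
  case: ltnP => lt'; first by have -> : (m - 1 - b = (m - 1 - b.+1).+1)%N by lia.
  by have -> : (m - 1 - b = 0)%N by lia.
have vvE b : rseq V b = X *m Lam ^+ b.
  elim: b => [|b IH]; first by rewrite expr0 mulmx1 vv0.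
  by rewrite vvS IH exprSr -mulmxA.
have [Y YE] : exists Y, 1%:M - constmx psi *m H = pencil Lam *m Y.
  pose k := maxn 1 (msize H).
  apply: (@pencil_lfactor _ _ _ _ _ k).
    apply/bigmax_leqP => -[i j] _ /=; apply/leq_sizeP => a; rewrite geq_max => /andP[ka ka'].
    have : cmx (1%:M - constmx psi *m H) a = 0.
      rewrite cmxD cmxN cmx_constM (cmx_big ka') mulmx0 subr0.
      apply/matrixP => i' j'; rewrite !mxE coefpE coefMn coef1.
      by case: a ka {ka'} => // a _; rewrite mul0rn.
    by move/matrixP/(_ i j); rewrite !mxE.
  have -> : \sum_(i < k) Lam ^+ i *m cmx (1%:M - constmx psi *m H) i =
      1%:M - \sum_(i < k) Lam ^+ i *m (psi *m cmx H i).
    under eq_bigr do rewrite cmxD cmxN cmx_constM mulmxBr.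
    rewrite sumrB; congr (_ - _).
    have : (0 < k)%N by rewrite leq_max.
    case: k => // k _; rewrite big_ord_recl big1 ?addr0 => [|i _].
      rewrite expr0 mul1mx; apply/matrixP => i j.
      by rewrite !mxE coefpE coefMn coef1.
    rewrite [cmx _ _](_ : _ = 0) ?mulmx0 //; apply/matrixP => i' j'.
    by rewrite !mxE coefpE coefMn coef1 mul0rn.
  (* The value of [psi H] at [Lam] acts on the sequences [X Lam^b] as the reversed [V = Z H] does,
     that is as the identity. *)
  apply: X_free_mx => b; rewrite !mulmxBr !mulmx1 -evalE ?leq_maxr //.
  by rewrite vvE subrr.
pose Bl := block_mx D H (- J) Y.
have e : block_mx 1%:M 0 0 (pencil Lam) *m Bl =
    block_mx 1%:M 0 (- constmx psi) 1%:M *m block_mx D H 0 1%:M.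
  rewrite !mulmx_block !(mul1mx, mul0mx, mulmx1, mulmx0, addr0, add0r).
  by rewrite mulmxN -JE -YE !mulNmx [- _ + 1%:M]addrC.
exists (\det Bl); rewrite char_poly_pencil.
have := congr1 determinant e; rewrite !det_mulmx.
by rewrite det_ublock det_lblock det_ublock !det1 !mul1r mulr1 => ->.
Qed.

End SolutionModule.

(** * Inverting polynomials over truncated series near X = 0 *)

Section TpsPoly.
Variables (N : nat) (K : fieldType).

Lemma tps_const_div (R : comNzRingType) (x : tps N R) :
  tps_const x = 0 -> exists y, x = tpsX N R * y.
Proof.
by move=> x0; rewrite -[tpsX N R]expr1; apply: tps_divX => -[|m].
Qed.

Lemma tps_poly_div (R : comNzRingType) (p : {poly tps N R}) :
  map_poly (@tps_const N R) p = 0 -> exists q, p = (tpsX N R) *: q.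
Proof.
move=> p0; have /choice[f fP] : forall i, exists y, p`_i = tpsX N R * y.
  by move=> i; apply: tps_const_div; rewrite -coef_map /= p0 coef0.
exists (\poly_(i < size p) f i); apply/polyP => i; rewrite coefZ coef_poly.
by case: ltnP => [_|ge]; [exact: fP | rewrite nth_default // mulr0].
Qed.

(** Modulo t, u is invertible modulo every power of X. The part of [Th] divisible by t is nilpotent,
    so a geometric sum turns [Th] into the (N+1)-st power of its reduction. *)
Lemma tps_poly_inv (Th : {poly tps N K}) d (u : {poly K}) :
  map_poly (@tps_const N K) Th = 'X^d * u -> u`_0 != 0 ->
  forall M, exists m theta rest, Th * theta = 'X^m + 'X^(m + M) * rest.
Proof.
move=> Th0 u0 M.
pose C (q : {poly K}) := map_poly (@tpsC N K) q.
have CK q : map_poly (@tps_const N K) (C q) = q.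
  rewrite -map_poly_comp_id0; last exact: rmorph0.
  by rewrite map_poly_id // => x _ /=; rewrite /tps_const tps_coefC.
have [n nE] : exists n, Th - C ('X^d * u) = tpsX N K *: n.
  by apply: tps_poly_div; rewrite rmorphB /= CK Th0 subrr.
have cop : coprimep (u ^+ N.+1) 'X^M.
  apply: coprimep_expl; apply: coprimep_expr.
  by rewrite -['X]subr0 -polyC0 coprimep_XsubC rootE horner_coef0.
have [[v v'] /= vE] := Bezout_eq1_coprimepP _ _ cop.
pose a := C ('X^d * u); pose e := - (tpsX N K *: n).
have ThE : Th = a - e by rewrite opprK -nE addrC subrK.
have eN : e ^+ N.+1 = 0.
  by rewrite /e exprNn exprZn tpsX_nilp // scale0r mulr0.
(* The multiplier is the geometric sum times [v], the inverse of u^(N+1) modulo X^M. *)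
exists (d * N.+1)%N, ((\sum_(i < N.+1) a ^+ (N.+1.-1 - i) * e ^+ i) * C v), (- C v').
rewrite mulrA ThE -(subrXX_comm _ (mulrC a e)) eN subr0.
have -> : a ^+ N.+1 = 'X^(d * N.+1) * C (u ^+ N.+1).
  by rewrite /a /C rmorphM /= map_polyXn exprMn -exprM rmorphXn.
rewrite -mulrA exprD -mulrA -[in RHS](mulr1 'X^(d * N.+1)) -mulrA mul1r -mulrDr.
congr (_ * _).
have -> : C (u ^+ N.+1) * C v = C (1 - 'X^M * v').
  by rewrite -rmorphM; congr (C _); rewrite -vE; ring.
by rewrite /C rmorphB rmorph1 rmorphM /= map_polyXn mulrN.
Qed.
End TpsPoly.

(** * Characteristic polynomials from generalized eigenvectors *)

Section GeneralizedEigenbasis.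
Variable F : fieldType.

(* [char_poly] of a commuting sum [Delta + nilpotent]: in one more variable s,
   det (X - Delta - s Nil) divides a polynomial not involving s. *)
Lemma char_poly_diag_nilp n (lam : 'rV[F]_n) (Nl : 'M[F]_n) k :
  diag_mx lam *m Nl = Nl *m diag_mx lam -> Nl ^+ k = 0 ->
  char_poly (diag_mx lam + Nl) = \prod_i ('X - (lam 0 i)%:P).
Proof.
move=> comm Nk.
pose a : 'M[{poly F}]_n := 'X%:M - map_mx polyC (diag_mx lam).
pose nn : 'M[{poly F}]_n := map_mx polyC Nl.
have cpa : \det a = \prod_i ('X - (lam 0 i)%:P).
  rewrite -[LHS]/(char_poly (diag_mx lam)) char_poly_trig ?diag_mx_is_trig //.
  by apply: eq_bigr => i _; rewrite mxE eqxx.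
pose a' := map_mx polyC a; pose n' : 'M[{poly {poly F}}]_n := 'X *: map_mx polyC nn.
have cnn : a *m nn = nn *m a.
  rewrite /a mulmxBl mulmxBr scalar_mxC; congr (_ - _).
  by rewrite -!map_mxM comm.
have c : GRing.comm a' n'.
  rewrite /GRing.comm -[LHS]/(_ *m _) -[RHS]/(_ *m _) -scalemxAr -scalemxAl.
  by rewrite -!map_mxM cnn.
have nk : n' ^+ k = 0.
  have e j : n' ^+ j = 'X^j *: map_mx polyC (map_mx polyC (Nl ^+ j)).
    elim: j => [|j IH].
      by rewrite !expr0 scale1r !map_mx1.
    rewrite [LHS]exprS IH [in RHS]exprS -[LHS]/(_ *m _) -scalemxAr -scalemxAl scalerA.
    by rewrite -!map_mxM mulrC [Nl ^+ j.+1]exprS.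
  by rewrite e Nk !map_mx0 scaler0.
pose S : 'M[{poly {poly F}}]_n := \sum_(i < k) a' ^+ (k.-1 - i) * n' ^+ i.
have aS : (a' - n') *m S = a' ^+ k.
  by rewrite -[RHS]subr0 -nk (subrXX_comm k c).
have detX (A : 'M[{poly {poly F}}]_n) j : \det (A ^+ j) = (\det A) ^+ j.
  by elim: j => [|j IH]; rewrite ?expr0 ?det1 // !exprS -[_ * A ^+ j]/(_ *m _) det_mulmx IH.
have := congr1 determinant aS; rewrite det_mulmx detX /a' det_map_mx cpa.
set c0 := \prod_i _; set f := \det (_ - n').
have c00 : c0 != 0 by apply/prodf_neq0 => i _; rewrite polyXsubC_eq0.
rewrite -rmorphXn /= => fS.
have nz : f * \det S != 0 by rewrite fS polyC_eq0 expf_neq0.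
have f0 : f != 0 by apply: contraNneq nz => ->; rewrite mul0r.
have S0 : \det S != 0 by apply: contraNneq nz => ->; rewrite mulr0.
(* A divisor of a nonzero polynomial free of s is free of s, so s = 1 and s = 0 give the same
   determinant. *)
have sf : (size f <= 1)%N.
  have := size_mul f0 S0; rewrite fS size_polyC expf_neq0 //=.
  have : (0 < size f)%N by rewrite size_poly_gt0.
  have : (0 < size (\det S))%N by rewrite size_poly_gt0.
  by case: (size f) => [|[|?]]; case: (size (\det S)) => // ? _ _; rewrite addSn addnS.
have fx x : f.[x] = \det (a - x *: nn).
  rewrite -horner_evalE /f -det_map_mx; congr determinant; apply/matrixP => i j.
  by rewrite !mxE /= horner_evalE !hornerE /=.
have f10 : f.[1] = f.[0] by rewrite (size1_polyC sf) !hornerC.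
move: f10; rewrite !fx scale1r scale0r subr0 cpa -/c0 => <-.
by rewrite /char_poly /char_poly_mx map_mxD opprD addrA.
Qed.

(** In the basis [A] the unit vectors are generalized eigenvectors, so the matrix [M] is block
    diagonal by eigenvalue: a diagonal matrix plus a commuting nilpotent one. *)
Lemma char_poly_generalized_eigenbasis n (Lam A : 'M[F]_n) (lam : 'I_n -> F) :
  A \in unitmx ->
  (forall i, row i A *m (Lam - (lam i)%:M) ^+ n = 0) ->
  char_poly Lam = \prod_i ('X - (lam i)%:P).
Proof.
case: n Lam A lam => [|n'] Lam A lam Au AL.
  by rewrite big_ord0 /char_poly det_mx00.
have [M MA] : exists M, M *m A = A *m Lam.
  by exists (A *m Lam *m invmx A); rewrite -mulmxA mulVmx ?mulmx1.
have MLA c j : (M - c%:M) ^+ j *m A = A *m (Lam - c%:M) ^+ j.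
  elim: j => [|j IH]; first by rewrite !expr0 mul1mx mulmx1.
  rewrite [in LHS]exprS [in RHS]exprS -[_ * (M - _) ^+ _]/(_ *m _).
  rewrite -[_ * (_ ^+ j)]/(_ *m _) -mulmxA IH !mulmxA; congr (_ *m _).
  by rewrite mulmxBl mulmxBr MA scalar_mxC.
have dM i : delta_mx 0 i *m (M - (lam i)%:M) ^+ n'.+1 = 0 :> 'rV_n'.+1.
  rewrite -[LHS]mulmx1 -(mulmxV Au) mulmxA -(mulmxA (delta_mx 0 i)) MLA.
  by rewrite mulmxA -rowE AL mul0mx.
have hM (c : F) : horner_mx M (('X - c%:P) ^+ n'.+1) = (M - c%:M) ^+ n'.+1.
  by rewrite rmorphXn rmorphB /= horner_mx_X horner_mx_C.
have rowM i : delta_mx 0 i *m M = \sum_j M i j *: delta_mx 0 j :> 'rV_n'.+1.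
  by rewrite -rowE [LHS]row_sum_delta; apply: eq_bigr => j _; rewrite mxE.
have commh p q : horner_mx M p *m horner_mx M q = horner_mx M q *m horner_mx M p.
  by rewrite -[LHS]rmorphM -[RHS]rmorphM mulrC.
have M0 i j : lam i != lam j -> M i j = 0.
  move=> nij.
  pose p : {poly F} := ('X - (lam i)%:P) ^+ n'.+1.
  pose q : {poly F} := \prod_(k | lam i != lam k) ('X - (lam k)%:P) ^+ n'.+1.
  have cop : coprimep p q.
    rewrite /q; elim/big_ind: _ => [|x z px pz|k nk]; first exact: coprimep1.
      by rewrite coprimepMr px.
    apply: coprimep_expl; apply: coprimep_expr.
    by rewrite coprimep_XsubC rootE !hornerE subr_eq0 eq_sym.
  have [[u v] /= uv] := Bezout_eq1_coprimepP _ _ cop.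
  (* [y] is the part of row i of [M] along the other eigenvalues; it is killed by the coprime
     polynomials p and q evaluated at [M], hence zero. *)
  pose y := \sum_(k | lam i != lam k) M i k *: (delta_mx 0 k : 'rV[F]_n'.+1).
  have yq : y *m horner_mx M q = 0.
    rewrite mulmx_suml big1 // => k nk; rewrite -scalemxAl /q (bigD1 k) //=.
    by rewrite rmorphM /= [_ * _]/(_ *m _) mulmxA hM dM mul0mx scaler0.
  have yp : y *m horner_mx M p = 0.
    have -> : y = delta_mx 0 i *m M - \sum_(k | lam i == lam k) M i k *: delta_mx 0 k.
      by rewrite rowM (bigID (fun k => lam i == lam k)) /= addrAC subrr add0r.
    rewrite mulmxBl mulmx_suml big1 ?subr0 => [|k /eqP ik].
      have -> : delta_mx 0 i *m M *m horner_mx M p = delta_mx 0 i *m horner_mx M p *m M :> 'rV_n'.+1.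
        by have := commh 'X p; rewrite horner_mx_X -!mulmxA => ->.
      by rewrite /p hM dM mul0mx.
    by rewrite -scalemxAl /p ik hM dM scaler0.
  have y0 : y = 0.
    have e : 1%:M = horner_mx M (u * p + v * q) by rewrite uv; exact: esym (rmorph1 _).
    rewrite -[y]mulmx1 e rmorphD !rmorphM /= mulmxDr.
    by rewrite -![_ * _]/(_ *m _) (commh u) (commh v) !mulmxA yp yq !mul0mx addr0.
  have := congr1 (fun z : 'rV_n'.+1 => z 0 j) y0.
  rewrite /y summxE (bigD1 j) //= !mxE !eqxx mulr1 big1 ?addr0 // => k /andP[_ kj].
  by rewrite !mxE eqxx eq_sym (negPf kj) mulr0.
pose Dl := \row_i lam i; pose Nl := M - diag_mx Dl.
have cMD : diag_mx Dl *m M = M *m diag_mx Dl.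
  apply/matrixP => i j; rewrite mul_diag_mx mul_mx_diag !mxE.
  by case: (eqVneq (lam i) (lam j)) => [->|/M0 ->]; rewrite ?mulr0 ?mul0r // mulrC.
have powE k i : delta_mx 0 i *m Nl ^+ k = delta_mx 0 i *m (M - (lam i)%:M) ^+ k :> 'rV_n'.+1.
  elim: k i => [|k IH] i; first by rewrite !expr0.
  rewrite [in LHS]exprS [in RHS]exprS -![_ * _ ^+ k]/(_ *m _) !mulmxA.
  have -> : delta_mx 0 i *m Nl = delta_mx 0 i *m (M - (lam i)%:M) :> 'rV_n'.+1.
    rewrite /Nl !mulmxBr; congr (_ - _); rewrite -rowE row_diag_mx mxE.
    by rewrite mul_mx_scalar.
  rewrite mulmxBr rowM mul_mx_scalar.
  have -> : \sum_j M i j *: delta_mx 0 j - lam i *: delta_mx 0 i =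
    \sum_(j | lam i == lam j) (M i j - lam i * (i == j)%:R) *: delta_mx 0 j :> 'rV[F]_n'.+1.
    rewrite (bigID (fun k => lam i == lam k)) /= [X in _ + X - _]big1 => [|j /M0 ->]; last by rewrite scale0r.
    rewrite addr0; under [RHS]eq_bigr do rewrite scalerBl; rewrite sumrB; congr (_ - _).
    rewrite (bigD1 i) //= eqxx mulr1 big1 ?addr0 // => j /andP[_ ji].
    by rewrite eq_sym (negPf ji) mulr0 scale0r.
  rewrite !mulmx_suml; apply: eq_bigr => j /eqP ij.
  by rewrite -!scalemxAl IH ij.
have Nn : Nl ^+ n'.+1 = 0.
  by apply/row_matrixP => i; rewrite rowE powE dM row0.
have cDN : diag_mx Dl *m Nl = Nl *m diag_mx Dl by rewrite /Nl mulmxBr mulmxBl cMD.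
have := char_poly_diag_nilp cDN Nn; rewrite /Nl addrC subrK => cM.
have -> : \prod_i ('X - (lam i)%:P) = char_poly M.
  by rewrite cM; apply: eq_bigr => i _; rewrite mxE.
have e : char_poly_mx M *m map_mx polyC A = map_mx polyC A *m char_poly_mx Lam.
  by rewrite /char_poly_mx mulmxBl mulmxBr scalar_mxC -!map_mxM MA.
move: e => /(congr1 determinant); rewrite !det_mulmx [RHS]mulrC => e.
apply/esym; apply: (mulIf _ e).
by rewrite det_map_mx polyC_eq0 -unitfE -unitmxE.
Qed.
End GeneralizedEigenbasis.

(** * Products over the residues modulo p *)

Section Shifts.
Variables (T : comNzRingType) (p : nat).
Hypotheses (p_pr : prime p) (charT : p%:R = 0 :> T).

Let pcharT : p \in [pchar T].
Proof. by rewrite inE p_pr charT eqxx. Qed.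

(** Over ['F_p] this is the factorisation of X^p - X. The difference of the two sides is defined
    over the integers, so its coefficients are multiples of p and vanish in [T]. *)
Lemma prod_shiftX : \prod_(i < p) ('X + (i%:R)%:P) = 'X^p - 'X :> {poly T}.
Proof.
pose q : {poly int} := \prod_(i < p) ('X + (i%:R)%:P) - ('X^p - 'X).
have qF : map_poly (intr : int -> 'F_p) q = 0.
  rewrite /q rmorphB rmorphB rmorph_prod /= map_polyXn map_polyX.
  have -> : 'X^p - 'X = \prod_(x : 'F_p) ('X - x%:P) :> {poly 'F_p}.
    by rewrite -finField_genPoly card_Fp.
  rewrite (reindex_inj oppr_inj) /=; apply/eqP; rewrite subr_eq0; apply/eqP.
  pose h (x : 'F_p) : 'I_p := cast_ord (Fp_cast p_pr) x.
  rewrite (reindex h) /=; last first.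
    apply: onW_bij; exists (cast_ord (esym (Fp_cast p_pr))) => x; exact: val_inj.
  apply: eq_bigr => x _; rewrite rmorphD /= map_polyX map_polyC /= rmorph_nat.
  by rewrite polyCN opprK natr_Zp.
suff : map_poly (intr : int -> T) q = 0.
  rewrite /q rmorphB rmorphB rmorph_prod /= map_polyXn map_polyX.
  move/eqP; rewrite subr_eq0 => /eqP <-; apply: eq_bigr => i _.
  by rewrite rmorphD /= map_polyX map_polyC /= mulrz_nat.
apply/polyP => i; rewrite coef_map coef0 /=.
have := congr1 (fun r : {poly 'F_p} => r`_i) qF; rewrite coef_map coef0 /=.
move: (q`_i) => z /eqP.
have chF := pchar_Fp p_pr.
suff dv m : (m%:R == 0 :> 'F_p) -> m%:R = 0 :> T.
  case: z => m; first by move/dv.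
  rewrite NegzE !mulrNz oppr_eq0 => /dv e.
  by rewrite -[X in - X]/(m.+1%:R) e oppr0.
rewrite -(dvdn_pcharf chF) => /dvdnP[k ->].
by rewrite natrM charT mulr0.
Qed.

Lemma prod_shift (x : T) : \prod_(i < p) (x + i%:R) = x ^+ p - x.
Proof.
have := congr1 (fun q : {poly T} => q.[x]) prod_shiftX.
rewrite horner_prod !hornerE => <-; apply: eq_bigr => i _; by rewrite !hornerE.
Qed.

End Shifts.

Section ProdMonic.
Variables (N : nat) (A : comNzRingType) (p : nat).
Hypotheses (p_pr : prime p) (charA : p%:R = 0 :> A).
Local Notation T := (tps N A).

Let charT : p%:R = 0 :> T.
Proof. by rewrite -(rmorph_nat (@tpsC N A)) charA rmorph0. Qed.

(* With [Lam] the companion matrix of [w], the product is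
   det ((y - Lam)^p - (y - Lam)), and [Lam^p = 0]. *)
Lemma prod_monic_shift (w : {poly T}) d (y : T) :
  w \is monic -> map_poly (@tps_const N A) w = 'X^d -> (d * N.+1 <= p)%N ->
  \prod_(i < p) w.[y + i%:R] = (-1) ^+ d * w.[- (y ^+ p - y)].
Proof.
move=> wm w0 lep.
have sw : size w = d.+1.
  have := congr1 (fun q : {poly A} => size q) w0; rewrite size_polyXn.
  rewrite size_map_poly_id0 //.
  by rewrite (monicP wm) rmorph1 oner_eq0.
case: d w0 lep sw => [|d] w0 lep sw.
  have -> : w = 1.
    rewrite (size1_polyC (eq_leq sw)); congr (_%:P).
    by have /monicP := wm; rewrite lead_coefE sw.
  by rewrite expr0 mul1r !hornerE big1 // => i _; rewrite !hornerE.
pose Lam := companionmx w.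
have := companionmxK wm; rewrite -/Lam; move: Lam; rewrite sw /= => Lam cw.
have CH : horner_mx Lam w = 0 by rewrite -cw Cayley_Hamilton.
have [r rE] : exists r, w - 'X^(d.+1) = tpsX N A *: r.
  by apply: tps_poly_div; rewrite rmorphB /= w0 map_polyXn subrr.
have Ld : Lam ^+ d.+1 = tpsX N A *: horner_mx Lam (- r).
  have -> : Lam ^+ d.+1 = horner_mx Lam ('X^(d.+1)) by rewrite rmorphXn /= horner_mx_X.
  have -> : 'X^(d.+1) = w - tpsX N A *: r by rewrite -rE opprB addrC subrK.
  by rewrite rmorphB /= CH sub0r horner_mxZ rmorphN scalerN.
(* By Cayley-Hamilton the power of [Lam] of exponent the degree of w is divisible by t, and p is at
   least N+1 times that degree. *)
have Lp : Lam ^+ p = 0.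
  rewrite -(subnKC lep) exprD exprM Ld exprZn tpsX_nilp // scale0r mul0r //.
have wE z : w.[z] = \det (z%:M - Lam).
  rewrite -cw -horner_evalE /char_poly -det_map_mx; congr determinant.
  by apply/matrixP => i j; rewrite !mxE /= horner_evalE !hornerE hornerMn hornerX.
have -> : \prod_(i < p) w.[y + i%:R] = \det (horner_mx Lam (\prod_(i < p) (y%:P - 'X + i%:R%:P))).
  rewrite rmorph_prod /=.
  have -> : \det (\prod_(i < p) horner_mx Lam (y%:P - 'X + i%:R%:P)) =
      \prod_(i < p) \det (horner_mx Lam (y%:P - 'X + i%:R%:P)).
    by apply: (big_morph _ (@det_mulmx _ _)); exact: det1.
  apply: eq_bigr => i _; rewrite wE; congr determinant.
  rewrite [in RHS]rmorphD [in RHS]rmorphB /= !horner_mx_C horner_mx_X.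
  by rewrite raddfD /= addrAC.
have -> : \prod_(i < p) (y%:P - 'X + i%:R%:P) = (y%:P - 'X) ^+ p - (y%:P - 'X) :> {poly T}.
  rewrite -(prod_shift p_pr (T := {poly T})); last by rewrite -polyC_natr charT.
  by apply: eq_bigr => i _; rewrite polyC_natr.
have cT : p \in [pchar {poly T}] by rewrite inE p_pr -polyC_natr charT eqxx.
have -> : (y%:P - 'X) ^+ p = (y ^+ p)%:P - 'X^p :> {poly T}.
  rewrite -!(pFrobenius_autE cT) pFrobenius_autB_comm; last exact: mulrC.
  by rewrite !pFrobenius_autE rmorphXn.
rewrite wE.
have -> : (- (y ^+ p - y))%:M - Lam = -1 *: horner_mx Lam ((y ^+ p)%:P - 'X^p - (y%:P - 'X)).
  have hX : horner_mx Lam 'X^p = 0 by rewrite rmorphXn /= horner_mx_X.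
  rewrite !(rmorphB (horner_mx Lam)) /= !horner_mx_C horner_mx_X hX subr0.
  by rewrite scaleN1r [in LHS]opprB raddfB /= [in RHS]opprB addrAC.
by rewrite detZ mulrA -exprMn mulrNN mulr1 expr1n mul1r.
Qed.

End ProdMonic.

(** * The operator on the basis x^(c + j) *)

Lemma wt_map (T S : comNzRingType) (f : {rmorphism T -> S}) t b x e :
  wt t b x e -> wt (f t) b (f x) e.
Proof.
by move=> [k [y [-> le]]]; exists k, (f y); rewrite rmorphM rmorphXn.
Qed.

Lemma adj_widen (T : comNzRingType) n (A : 'M[T]_n.+1) :
  \adj A 0 0 = \det (\matrix_(i < n, j < n) A (lift 0 i) (lift 0 j)).
Proof.
rewrite mxE /cofactor expr0 mul1r; congr determinant.
by apply/matrixP => i j; rewrite !mxE.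
Qed.

Section Symbol.
Variables (R : comNzRingType) (N : nat) (r : seq R) (Q : nat -> diffop R).
Local Notation T := (tps N R).

(** The falling factorial by which the e-th derivative multiplies x^c. *)
Definition ffactX e : {poly R} := \prod_(i < e) ('X - (i%:R)%:P).

(** As a polynomial in c, the coefficient of x^(c+a) in q x^c. *)
Definition symb (q : diffop R) (a : int) : {poly R} :=
  \sum_(e <- finsupp q | e.1 - e.2%:Z == a) q e *: ffactX e.2.

Definition poly_tpsC : {poly R} -> {poly T} := map_poly (@tpsC N R).
HB.instance Definition _ := GRing.RMorphism.on poly_tpsC.

Definition indicial : {poly R} := \prod_(z <- r) ('X - z%:P).

(* (P + Q) x^c = sum_a Dsym_a(c) x^(c + a) modulo t^(N+1). *)
Definition Dsym (a : int) : {poly T} :=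
  (if a == 0 then poly_tpsC indicial else 0) +
  \sum_(m < N.+1) tpsX N R ^+ m *: poly_tpsC (symb (Q m) a).

Definition Xplus (S : comNzRingType) (j : int) : {poly S} := 'X + (j%:~R)%:P.

(** The coefficient of x^(c+i) in D x^(c+j), with the variable standing for c. *)
Definition Dent (i j : int) : {poly T} := Dsym (i - j) \Po Xplus T j.

Lemma Dent_shift i j a : Dent (i + a) (j + a) = Dent i j \Po Xplus T a.
Proof.
rewrite /Dent -comp_polyA.
have -> : i + a - (j + a) = i - j by rewrite opprD addrACA subrr addr0.
congr (_ \Po _); rewrite /Xplus comp_polyD comp_polyX comp_polyC rmorphD /= polyCD.
by rewrite addrAC addrA.
Qed.

Definition window n : 'M[{poly T}]_n := \matrix_(i < n, j < n) Dent i j.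
Definition Theta n : {poly T} := \det (window n).

Lemma Theta_shift n a :
  \det (\matrix_(i < n, j < n) Dent (i%:Z + a) (j%:Z + a)) = Theta n \Po Xplus T a.
Proof.
rewrite /Theta -[RHS]/(comp_poly _ _) -det_map_mx; congr determinant.
by apply/matrixP => i j; rewrite !mxE Dent_shift.
Qed.

Lemma adj_window n : \adj (window n.+1) 0 0 = Theta n \Po Xplus T 1.
Proof.
rewrite adj_widen -Theta_shift; congr determinant.
by apply/matrixP => i j; rewrite !mxE /= !intS ![1 + _]addrC.
Qed.

Hypothesis Q0 : Q 0%N = [fsfun].

Lemma symb0 a : symb (Q 0%N) a = 0.
Proof.
rewrite /symb Q0; have -> : finsupp ([fsfun] : diffop R) = fset0.
  by apply/fsetP => e; rewrite mem_finsupp fsfunE eqxx.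
by rewrite big1_seq // => e; rewrite in_fset0 andbF.
Qed.

Lemma Dsym_const a : map_poly (@tps_const N R) (Dsym a) =
  if a == 0 then indicial else 0.
Proof.
have CK q : map_poly (@tps_const N R) (poly_tpsC q) = q.
  apply/polyP => i; rewrite !coef_map /= /tps_const tps_coefC //.
rewrite /Dsym rmorphD rmorph_sum /= big1 => [|m _]; last first.
  case: m => -[|m] lt /=; first by rewrite symb0 /poly_tpsC rmorph0 scaler0 rmorph0.
  rewrite -mul_polyC rmorphM /= map_polyC /=.
  rewrite [tps_const _](_ : _ = 0) ?mul0r // rmorphXn /=.
  by rewrite [tps_const _](_ : _ = 0) ?expr0n //= /tps_const /tpsX tps_ofE.
by rewrite addr0; case: ifP => _; rewrite ?CK ?rmorph0.
Qed.

Lemma Dent_const i j : map_poly (@tps_const N R) (Dent i j) =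
  if i == j then indicial \Po Xplus R j else 0.
Proof.
rewrite /Dent map_comp_poly Dsym_const subr_eq0.
have -> : map_poly (@tps_const N R) (Xplus T j) = Xplus R j.
  by rewrite /Xplus rmorphD /= map_polyX map_polyC /= rmorph_int.
by case: ifP => // _; rewrite comp_poly0.
Qed.

Lemma Theta_const n : map_poly (@tps_const N R) (Theta n) =
  \prod_(j < n) (indicial \Po Xplus R j%:Z).
Proof.
rewrite /Theta -det_map_mx; rewrite det_trig.
  by apply: eq_bigr => i _; rewrite !mxE /= Dent_const eqxx.
apply/is_trig_mxP => i j lt; rewrite !mxE /= Dent_const; case: eqP => // -[] e.
by rewrite e ltnn in lt.
Qed.

Lemma band_exists : exists b, (0 < b)%N /\
  forall m e, (m <= N)%N -> e \in finsupp (Q m) -> (`|e.1 - e.2%:Z| <= b)%N.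
Proof.
pose bm m := \max_(e <- finsupp (Q m)) `|e.1 - e.2%:Z|%N.
exists (\max_(m < N.+1) bm m).+1; split=> // m e le eQ.
have : (bm m <= \max_(m < N.+1) bm m)%N.
  exact: (leq_bigmax (Ordinal (le : (m < N.+1)%N))).
have : (`|e.1 - e.2%:Z| <= bm m)%N by rewrite /bm (big_rem e) //= leq_maxl.
lia.
Qed.

Variable b : nat.
Hypothesis b_gt0 : (0 < b)%N.
Hypothesis bandQ : forall m e, (m <= N)%N -> e \in finsupp (Q m) ->
  (`|e.1 - e.2%:Z| <= b)%N.
Local Notation t := ((tpsX N R)%:P).
Local Notation wtT := (wt t b).

Lemma tX_nilp k : (N < k)%N -> t ^+ k = 0.
Proof. by move=> lt; rewrite -rmorphXn /= tpsX_nilp. Qed.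

Lemma Dsym_band a : (b < `|a|)%N -> Dsym a = 0.
Proof.
move=> lt; rewrite /Dsym ifF ?add0r; last by apply/eqP => a0; rewrite a0 in lt.
rewrite big1 // => m _; rewrite [symb _ _](_ : _ = 0) ?rmorph0 ?scaler0 //.
rewrite /symb big1_seq // => e /andP[/eqP ea eQ].
by move: lt; rewrite -ea ltnNge (bandQ (m := m)) // -ltnS.
Qed.

(** Off the diagonal an entry is divisible by t, and beyond distance b it vanishes: one factor t
    pays for a displacement of at most b. *)
Lemma wt_Dent i j : wtT (Dent i j) `|i - j|.
Proof.
rewrite /Dent; case: (ltnP b `|i - j|) => [lt|le].
  by rewrite Dsym_band // comp_poly0; exact: wt_0.
case: (eqVneq (i - j) 0) => [->|n0]; first exact: wt0r.
have [y yE] : exists y, Dsym (i - j) = tpsX N R *: y.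
  by apply: tps_poly_div; rewrite Dsym_const (negPf n0).
exists 1%N, (y \Po Xplus T j); rewrite mul1n expr1; split=> //.
by rewrite yE comp_polyZ mul_polyC.
Qed.

Section WindowColumn.
Variable n : nat.
Hypothesis n_big : (N * b <= n)%N.

(** Coefficients of a combination of x^c, ..., x^(c+n) that D sends to Theta_(n+1)(c) x^c plus lower
    powers of x: a column of the triangular factorisation. [wimg] gives the coefficients of its
    image. *)
Definition wcol (j : 'I_n.+1) : {poly T} := \adj (window n.+1) j 0.

Lemma wt_wcol j : wtT (wcol j) j.
Proof.
have := @wt_adj _ t b b_gt0 n.+1 (window n.+1) _ j 0.
rewrite subr0 /=; apply=> i j'; rewrite !mxE; exact: wt_Dent.
Qed.

Lemma wcol0 : wcol 0 = Theta n \Po Xplus T 1.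
Proof. exact: adj_window. Qed.

Definition wimg (i : int) : {poly T} := \sum_(j < n.+1) Dent i j%:Z * wcol j.

Lemma wt_wimg i : wtT (wimg i) `|i|.
Proof.
apply: wt_sum => [|j _]; first exact: wt_0.
apply: (@wt_leq _ _ _ _ (`|i - j%:Z| + j)%N); first by lia.
by apply: wt_mul; [exact: wt_Dent | exact: wt_wcol].
Qed.

(** For rows inside the window this is the adjugate identity; for rows beyond it the weight exceeds
    N b, so the entry is zero. *)
Lemma wimg_pos i : (0 < i)%R -> wimg i = 0.
Proof.
case: i => // i i0; case: (leqP i n) => [le|lt]; last first.
  by apply: (wt_eq0 tX_nilp (leq_ltn_trans n_big lt)); exact: wt_wimg.
have /matrixP/(_ (Ordinal (le : (i < n.+1)%N)) 0) := mul_mx_adj (window n.+1).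
rewrite !mxE (_ : (_ == _) = false) ?mulr0n => [<-|].
  by apply: eq_bigr => j _; rewrite /wcol !mxE.
by apply/eqP => /(congr1 val) /= e; rewrite e in i0.
Qed.

Lemma wimg0 : wimg 0 = Theta n.+1.
Proof.
have /matrixP/(_ 0 0) := mul_mx_adj (window n.+1).
rewrite /Theta !mxE eqxx mulr1n => <-.
by apply: eq_bigr => j _; rewrite /wcol !mxE.
Qed.
End WindowColumn.

(** The column [wcol] of the small window, padded with zeros, is still sent by the larger window to
    a multiple of the first basis vector, hence is proportional to the first column of the larger
    adjugate. Thus Theta_(n+1)(c) / Theta_n(c+1) is independent of n. *)
Lemma Theta_exchange n m : (N * b <= n)%N -> (n <= m)%N ->
  Theta n.+1 * (Theta m \Po Xplus T 1) = Theta m.+1 * (Theta n \Po Xplus T 1).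
Proof.
move=> nb nm.
pose v : 'cV[{poly T}]_m.+1 :=
  \col_i (if insub (val i) is Some j then wcol (n := n) j else 0).
have Wv : window m.+1 *m v = Theta n.+1 *: delta_mx 0 0.
  apply/colP => i; rewrite !mxE.
  transitivity (wimg n i%:Z).
    pose F (j : nat) := Dent i%:Z j%:Z *
      (if insub j is Some j' then wcol (n := n) j' else 0).
    have -> : wimg n i%:Z = \sum_(j < n.+1) F j.
      apply: eq_bigr => j _; rewrite /F insubT ?ltn_ord // => lt.
      by congr (_ * wcol _); exact: val_inj.
    rewrite (big_ord_widen m.+1 F) ?ltnS // [RHS]big_mkcond.
    apply: eq_bigr => j _; rewrite !mxE /F.
    by case: insubP => [j' -> //|/negPf ->]; rewrite mulr0.
  case: (unliftP 0 i) => [i' ->|->]; last by rewrite wimg0 // !eqxx mulr1.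
  by rewrite wimg_pos //= mulr0.
have := congr1 (mulmx (\adj (window m.+1))) Wv.
rewrite mulmxA mul_adj_mx mul_scalar_mx -scalemxAr -colE => /matrixP/(_ 0 0) e.
have {e} e : Theta m.+1 * v 0 0 = Theta n.+1 * \adj (window m.+1) 0 0.
  by move: e; rewrite !mxE.
rewrite -adj_window -e; congr (_ * _); rewrite mxE insubT //.
by rewrite -wcol0; congr wcol; exact: val_inj.
Qed.
End Symbol.

(** * Local analysis at one class of exponents *)

Section ShiftAction.
Variable K : comNzRingType.
Implicit Types (p q : {poly K}) (phi : nat -> K).

(* ['X] acts as the shift; on [b |-> b! h_b] it is d/d(log x). *)
Definition sact p phi b := \sum_(i < size p) p`_i * phi (b + i)%N.

Lemma sact_widen k p phi b : (size p <= k)%N ->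
  sact p phi b = \sum_(i < k) p`_i * phi (b + i)%N.
Proof.
move=> le; rewrite /sact (big_ord_widen k (fun i => p`_i * phi (b + i)%N)) //.
rewrite big_mkcond; apply: eq_bigr => i _; case: ltnP => // ge.
by rewrite nth_default ?mul0r.
Qed.

Lemma sactD p q phi b : sact (p + q) phi b = sact p phi b + sact q phi b.
Proof.
pose k := maxn (size p) (size q).
rewrite !(@sact_widen k) ?leq_maxl ?leq_maxr ?(leq_trans (size_polyD _ _)) //.
by rewrite -big_split; apply: eq_bigr => i _; rewrite coefD mulrDl.
Qed.
Lemma sactZ c p phi b : sact (c *: p) phi b = c * sact p phi b.
Proof.
rewrite !(@sact_widen (size p)) ?size_scale_leq // mulr_sumr.
by apply: eq_bigr => i _; rewrite coefZ mulrA.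
Qed.
Lemma sact0 phi b : sact 0 phi b = 0.
Proof. by rewrite /sact size_poly0 big_ord0. Qed.
Lemma sactC c phi b : sact c%:P phi b = c * phi b.
Proof.
rewrite (@sact_widen 1) ?size_polyC ?leq_b1 // big_ord1 coefC addn0 //.
Qed.
Lemma sact1 phi b : sact 1 phi b = phi b.
Proof. by rewrite sactC mul1r. Qed.
Lemma sactXM p phi b : sact ('X * p) phi b = sact p (fun b => phi b.+1) b.
Proof.
rewrite (@sact_widen (size p).+1); last first.
  by rewrite (leq_trans (size_polyMleq _ _)) // size_polyX.
rewrite big_ord_recl coefXM eqxx mul0r add0r; apply: eq_bigr => i _.
by rewrite coefXM /= addnS.
Qed.
Lemma sact_shift p phi b : sact p (fun b => phi b.+1) b = sact p phi b.+1.
Proof. by apply: eq_bigr => i _; rewrite addSn. Qed.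
Lemma sactM p q phi b : sact (p * q) phi b = sact p (sact q phi) b.
Proof.
elim/poly_ind: p phi b => [|p c IH] phi b; first by rewrite mul0r !sact0.
rewrite mulrDl !sactD mul_polyC sactZ sactC; congr (_ + _).
by rewrite [p * 'X]mulrC -mulrA !sactXM sact_shift IH -sact_shift.
Qed.
Lemma sact_sum (I : Type) (s : seq I) (P : pred I) (F : I -> {poly K}) phi b :
  sact (\sum_(i <- s | P i) F i) phi b = \sum_(i <- s | P i) sact (F i) phi b.
Proof. by elim/big_rec2: _ => [|i x y _ <-]; rewrite ?sact0 ?sactD. Qed.
Lemma sact_eq p phi psi b : phi =1 psi -> sact p phi b = sact p psi b.
Proof. by move=> e; apply: eq_bigr => i _; rewrite e. Qed.
Lemma sact_eq0 p phi b : (forall b, phi b = 0) -> sact p phi b = 0.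
Proof. by move=> e; rewrite /sact big1 // => i _; rewrite e mulr0. Qed.
Lemma sact_linear p c phi psi b :
  sact p (fun b => c * phi b + psi b) b = c * sact p phi b + sact p psi b.
Proof.
rewrite /sact mulr_sumr -big_split; apply: eq_bigr => i _ /=.
by rewrite mulrDr mulrCA.
Qed.
Lemma sactXC c phi b : sact ('X + c%:P) phi b = phi b.+1 + c * phi b.
Proof. by rewrite sactD sactC -['X]mulr1 sactXM sact1. Qed.

End ShiftAction.

(** The shift is nilpotent on finitely supported sequences, so a nonzero constant term is enough for
    injectivity; the proof descends from the end of the support. *)
Lemma sact_inj (K : idomainType) (p : {poly K}) phi B :
  p`_0 != 0 -> (forall b, (B <= b)%N -> phi b = 0) ->
  (forall b, sact p phi b = 0) -> forall b, phi b = 0.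
Proof.
move=> p0 phiB pphi.
suff H k b : (B <= b + k)%N -> phi b = 0 by move=> b; apply: (H B); rewrite leq_addl.
elim: k b => [|k IH] b le; first by apply: phiB; rewrite addn0 in le.
have := pphi b; rewrite (@sact_widen _ (size p).+1) //.
rewrite big_ord_recl big1 ?addr0 /= => [|i _].
  by move/eqP; rewrite mulf_eq0 (negPf p0) addn0 => /eqP.
by rewrite IH ?mulr0 // /bump /=; lia.
Qed.

(** * Logarithmic series and the operator acting on them *)

Section LogSeriesOps.
Variable K : fieldType.
Implicit Types h : logser K.

Lemma in_logser0 : in_logser (fun _ _ => 0 : K).
Proof. by split; exists 0. Qed.
Lemma in_logserD h h' : in_logser h -> in_logser h' ->
  in_logser (fun a b => h a b + h' a b).
Proof.
case=> -[m hm] [d hd] [[m' hm'] [d' hd']]; split.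
  exists (- (`|m| + `|m'|)%N%:Z) => a b am.
  by rewrite hm ?hm' ?addr0 //; lia.
exists (maxn d d') => a b; rewrite geq_max => /andP[db db'].
by rewrite hd ?hd' ?addr0.
Qed.
Lemma in_logserZ c h : in_logser h -> in_logser (fun a b => c * h a b).
Proof.
case=> -[m hm] [d hd]; split; first by exists m => a b /hm ->; rewrite mulr0.
by exists d => a b /hd ->; rewrite mulr0.
Qed.
Lemma in_logser_sum (I : Type) (l : seq I) (F : I -> logser K) :
  (forall i, in_logser (F i)) -> in_logser (fun a b => \sum_(i <- l) F i a b).
Proof.
move=> HF; elim: l => [|i l IH].
  by under eq_fun do under eq_fun do rewrite big_nil; exact: in_logser0.
by under eq_fun do under eq_fun do rewrite big_cons; exact: in_logserD.
Qed.
Lemma in_logser_mulx c h : in_logser h -> in_logser (ls_mulx c h).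
Proof.
case=> -[m hm] [d hd]; split; last by exists d => a b db; rewrite /ls_mulx hd.
by exists (m + c) => a b am; apply: hm; lia.
Qed.
Lemma in_logser_dx s h : in_logser h -> in_logser (ls_dx s h).
Proof.
case=> -[m hm] [d hd]; split.
  by exists (m - 1) => a b am; rewrite /ls_dx !hm ?mulr0 ?addr0 //; lia.
by exists d => a b db; rewrite /ls_dx !hd ?mulr0 ?addr0 //; lia.
Qed.
Lemma in_logser_diffop (R : comNzRingType) (iota : R -> K) s q h :
  in_logser h -> in_logser (ls_diffop iota s q h).
Proof.
move=> hh; apply: in_logser_sum => e; apply: in_logserZ; apply: in_logser_mulx.
by elim: (e.2) => //= k IH; exact: in_logser_dx.
Qed.

Hypothesis charK : [pchar K] =i pred0.

Lemma natr_neq0 n : (n%:R == 0 :> K) = (n == 0%N).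
Proof. by move/pcharf0P: charK => ->. Qed.
Lemma intr_eq0_char0 (z : int) : (z%:~R == 0 :> K) = (z == 0).
Proof.
case: z => n; first exact: natr_neq0.
by rewrite NegzE mulrNz !oppr_eq0; exact: natr_neq0.
Qed.
Lemma fact_neq0 b : b`!%:R != 0 :> K.
Proof. by rewrite natr_neq0 -lt0n fact_gt0. Qed.

(** With the factor b!, d/d(log x) is the plain shift in b, and x d/dx acts on the row of x^(s+a) as
    ['X + (s + a)] through [sact]. *)
Definition hat h (a : int) b : K := b`!%:R * h a b.

Lemma hat_eq0 h a b : hat h a b = 0 -> h a b = 0.
Proof. by move/eqP; rewrite mulf_eq0 (negPf (fact_neq0 _)) => /eqP. Qed.

Variable s : K.
Definition Xs (a : int) : {poly K} := 'X + (s + a%:~R)%:P.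

Lemma hat_dx h a b : hat (ls_dx s h) a b = sact (Xs (a + 1)) (hat h (a + 1)) b.
Proof. by rewrite sactXC /hat /ls_dx factS natrM; ring. Qed.

Lemma hat_iter_dx e h a b :
  hat (iter e (ls_dx s) h) a b =
  sact (\prod_(i < e) (Xs (a + e%:Z - i%:Z))) (hat h (a + e%:Z)) b.
Proof.
elim: e a b => [|e IH] a b; first by rewrite big_ord0 sact1 addr0.
rewrite /= hat_dx big_ord_recr /= mulrC sactM.
have -> : a + e.+1%:Z - e%:Z = a + 1 by lia.
apply: sact_eq => b'; rewrite IH.
have -> : a + 1 + e%:Z = a + e.+1%:Z by lia.
by [].
Qed.

Lemma ls_mulx_dx h a b z :
  b`!%:R * (ls_mulx 1 (ls_dx s h) a b - z * h a b) =
  sact ('X + (s + a%:~R - z)%:P) (hat h a) b.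
Proof.
rewrite sactXC /hat /ls_mulx /ls_dx factS natrM.
have -> : a - 1 + 1 = a by lia.
ring.
Qed.

Lemma hat_ls_P (R : comNzRingType) (iota : R -> K) (r : seq R) h a b :
  hat (ls_P iota s r h) a b =
  sact (\prod_(z <- r) ('X + (s + a%:~R - iota z)%:P)) (hat h a) b.
Proof.
elim: r b => [|z r IH] b; first by rewrite big_nil sact1.
rewrite big_cons sactM {1}/hat /= ls_mulx_dx.
by apply: sact_eq => b'; exact: IH.
Qed.

(** On the row of x^(s+a) the equation is (X + al a) psi = h. If [al a] is zero, one integrates once
    in log x; otherwise X + al a is inverted by a geometric series, finite because the degree in log
    x is bounded. *)
Lemma ls_factor_surj z h : in_logser h ->
  exists h', in_logser h' /\
    (fun a b => ls_mulx 1 (ls_dx s h') a b - z * h' a b) = h.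
Proof.
case=> -[m hm] [d hd].
pose al a := s + a%:~R - z.
pose psi a b := if al a == 0 then (if b is b'.+1 then hat h a b' else 0) else
  \sum_(k < d) (-1) ^+ k * (al a) ^- k.+1 * hat h a (b + k)%N.
have hatd a b : (d <= b)%N -> hat h a b = 0 by move=> /hd; rewrite /hat => ->; rewrite mulr0.
pose h' a b := psi a b / b`!%:R.
have hath' a : hat h' a =1 psi a.
  by move=> b; rewrite /hat /h' mulrC divfK ?fact_neq0.
exists h'; split.
  split.
    exists m => a b am; rewrite /h' [psi _ _](_ : _ = 0) ?mul0r //.
    have h0 b' : hat h a b' = 0 by rewrite /hat hm ?mulr0.
    rewrite /psi; case: ifP => _; first by case: b.
    by rewrite big1 // => k _; rewrite h0 mulr0.
  exists d.+1 => a b db; rewrite /h' [psi _ _](_ : _ = 0) ?mul0r //.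
  rewrite /psi; case: ifP => _; first by case: b db => // b db; rewrite hatd.
  by rewrite big1 // => k _; rewrite hatd ?mulr0 //; lia.
apply/funext => a; apply/funext => b; apply: (mulfI (fact_neq0 b)).
rewrite ls_mulx_dx sactXC !hath' -/(hat h a b) -/(al a) /psi.
case: eqP => [->|/eqP al0]; first by rewrite mul0r addr0.
rewrite mulr_sumr -big_split /=.
pose G k := - (-1) ^+ k * (al a) ^- k * hat h a (b + k)%N.
rewrite (eq_bigr (fun k : 'I_d => G k.+1 - G k)) => [|k _]; last first.
  rewrite /G addSnnS !exprS invfM; field; rewrite ?al0 ?expf_neq0 //.
rewrite -(big_mkord xpredT (fun k => G k.+1 - G k)) telescope_sumr // /G.
by rewrite hatd ?leq_addl // mulr0 expr0 invr1 addn0; ring.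
Qed.

Lemma ls_P_surj (R : comNzRingType) (iota : R -> K) (r : seq R) h : in_logser h ->
  exists h', in_logser h' /\ ls_P iota s r h' = h.
Proof.
elim: r h => [|z r IH] h hh; first by exists h.
have [h1 [h1l h1E]] := ls_factor_surj (iota z) hh.
have [h' [h'l h'E]] := IH h1 h1l.
by exists h'; split=> //=; rewrite -/(ls_P iota s r h') h'E.
Qed.

Section Lift.
Variables (R : comNzRingType) (iota : R -> K) (r : seq R) (Q : nat -> diffop R).
Hypothesis Q0 : Q 0%N = [fsfun].

Lemma ls_diffop_Q0 h a b : ls_diffop iota s (Q 0%N) h a b = 0.
Proof.
rewrite /ls_diffop Q0 big1_seq // => e.
by rewrite mem_finsupp fsfunE eqxx andbF.
Qed.

(** P is surjective and Q is divisible by t, so the coefficients of t^n for n > N can be solved for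
    one after the other. *)
Lemma lift_solution (N : nat) (f0 : tlogser K) :
  (forall n, (n <= N)%N -> in_logser (f0 n)) ->
  (forall n a b, (n <= N)%N -> ls_P iota s r (f0 n) a b +
     \sum_(m < n.+1) ls_diffop iota s (Q m) (f0 (n - m)%N) a b = 0) ->
  exists f, in_M iota s r Q f /\ forall n, (n <= N)%N -> f n = f0 n.
Proof.
move=> f0l f0s.
have /choice[inv invP] : forall h, exists h', in_logser h ->
    in_logser h' /\ ls_P iota s r h' = h.
  move=> h; case: (pselect (in_logser h)) => [/ls_P_surj -/(_ _ iota r)[h' h'P]|nh].
    by exists h'.
  by exists h.
pose rhs (g : nat -> logser K) n : logser K := fun a b =>
  - \sum_(m < n) ls_diffop iota s (Q m.+1) (g (n - m.+1)%N) a b.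
pose z0 : logser K := fun _ _ => 0.
(* Course-of-values recursion: the list holds the coefficients already found. *)
pose step (l : seq (logser K)) :=
  if (size l <= N)%N then f0 (size l) else inv (rhs (nth z0 l) (size l)).
pose g n := iter n (fun l => rcons l (step l)) [::].
have sg n : size (g n) = n by elim: n => //= n IH; rewrite size_rcons IH.
pose f n := nth z0 (g n.+1) n.
have gf m n : (n < m)%N -> nth z0 (g m) n = f n.
  elim: m => // m IH; rewrite ltnS leq_eqVlt => /orP[/eqP -> //|lt].
  by rewrite /= nth_rcons sg lt IH.
have fE n : f n = if (n <= N)%N then f0 n else inv (rhs f n).
  rewrite /f /= nth_rcons sg ltnn eqxx /step sg; case: ifP => // _.
  congr inv; apply/funext => a; apply/funext => b; congr (- _).
  by apply: eq_bigr => m _; rewrite gf // subnSK ?leq_subr //; lia.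
have rhsl n : (forall k, (k < n)%N -> in_logser (f k)) -> in_logser (rhs f n).
  move=> fl; rewrite /rhs.
  have -> : (fun a b => - \sum_(m < n) ls_diffop iota s (Q m.+1) (f (n - m.+1)%N) a b)
    = (fun a b => (-1) * \sum_(m < n) ls_diffop iota s (Q m.+1) (f (n - m.+1)%N) a b).
    by apply/funext => a; apply/funext => b; rewrite mulN1r.
  apply: in_logserZ; apply: in_logser_sum => m; apply: in_logser_diffop.
  by apply: fl; have := ltn_ord m; lia.
have fl n : in_logser (f n).
  have [k] := ubnP n; elim: k n => // k IH n le; rewrite fE.
  case: leqP => [/f0l //|lt].
  have /invP[//] : in_logser (rhs f n) by apply: rhsl => j lj; apply: IH; lia.
exists f; split; last by move=> n le; rewrite fE le.
split=> // n a b; case: (leqP n N) => [le|lt].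
  rewrite -[RHS](f0s n a b le) fE le; congr (_ + _); apply: eq_bigr => m _.
  by rewrite fE ifT // (leq_trans (leq_subr _ _)).
have [_ fs] := invP _ (rhsl n (fun k _ => fl k)).
rewrite big_ord_recl ls_diffop_Q0 add0r [in X in X + _]fE leqNgt lt /= fs /rhs.
by rewrite addrC subrr.
Qed.

End Lift.
End LogSeriesOps.

Lemma coef_FPS (S : Type) (F : nat -> S) n : FPS F n = F n. Proof. by []. Qed.

Section Slice.
Variables (N : nat) (S : comNzRingType).
Implicit Types p : {poly tps N S}.

Definition slice m p : {poly S} := \poly_(i < size p) ((p`_i : tps N S) m).
Lemma coef_slice m p i : (slice m p)`_i = (p`_i : tps N S) m.
Proof. by rewrite coef_poly; case: ltnP => // le; rewrite nth_default // tps_coef0. Qed.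
Lemma size_slice m p : (size (slice m p) <= size p)%N.
Proof. exact: size_poly. Qed.
Lemma sliceD m p q : slice m (p + q) = slice m p + slice m q.
Proof. by apply/polyP => i; rewrite coefD !coef_slice coefD tps_coefD. Qed.
Lemma slice0 m : slice m 0 = 0.
Proof. by apply/polyP => i; rewrite coef_slice !coef0 tps_coef0. Qed.
Lemma slice_sum m (I : Type) (s : seq I) (F : I -> {poly tps N S}) :
  slice m (\sum_(i <- s) F i) = \sum_(i <- s) slice m (F i).
Proof. by elim/big_rec2: _ => [|i x y _ <-]; rewrite ?slice0 ?sliceD. Qed.
Lemma slice_comp m p c :
  slice m (p \Po ('X + (tpsC N c)%:P)) = slice m p \Po ('X + c%:P).
Proof.
elim/poly_ind: p => [|p x IH]; first by rewrite slice0 !comp_poly0 slice0.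
rewrite comp_poly_MXaddC !sliceD mulrDr sliceD.
have sX q : slice m (q * 'X) = slice m q * 'X.
  apply/polyP => i; rewrite coef_slice !coefMX.
  by case: (i == 0%N); rewrite ?tps_coef0 ?coef_slice.
have sC q z : slice m (q * (tpsC N z)%:P) = slice m q * z%:P.
  apply/polyP => i; rewrite coef_slice !coefMC coef_slice mulrC tps_coefCM.
  by rewrite mulrC.
have sc z : slice m z%:P = (z m)%:P.
  apply/polyP => i; rewrite coef_slice !coefC.
  by case: (i == 0%N); rewrite ?tps_coef0.
by rewrite !sX sC !sc IH comp_polyD comp_polyM comp_polyX comp_polyC mulrDr.
Qed.
End Slice.

Lemma slice_map (N : nat) (S S' : comNzRingType) (f : {rmorphism S -> S'}) m
    (p : {poly tps N S}) :
  slice m (map_poly (@tps_map N _ _ f) p) = map_poly f (slice m p).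
Proof.
apply/polyP => i; rewrite coef_slice !coef_map /= coef_slice.
exact: tps_mapE.
Qed.

Lemma slice_Dsym (R : comNzRingType) N (r : seq R) (Q : nat -> diffop R) m a :
  (m <= N)%N -> slice m (Dsym N r Q a) =
  (if (m == 0%N) && (a == 0) then indicial r else 0) + symb (Q m) a.
Proof.
move=> le; rewrite /Dsym sliceD slice_sum; congr (_ + _).
  apply/polyP => i; rewrite coef_slice; case: (a == 0); last first.
    by rewrite andbF !coef0 tps_coef0.
  rewrite andbT coef_map /= tps_coefC; case: (m == 0%N) => //.
  by rewrite coef0.
have lt : (m < N.+1)%N by [].
rewrite (bigD1 (Ordinal lt)) //= [X in _ + X]big1 ?addr0 => [|k nk].
  apply/polyP => i; rewrite coef_slice coefZ coef_map /= tps_coefXnM //.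
  by rewrite leqnn subnn tps_coefC.
apply/polyP => i; rewrite coef_slice coefZ coef_map /= tps_coefXnM // coef0.
case: ifP => // km; rewrite tps_coefC subn_eq0 ifF //.
apply/negP => mk; case/eqP: nk; apply/val_inj => /=.
by apply/eqP; rewrite eqn_leq km.
Qed.

Section LocalOperator.
Variables (K : fieldType) (charK : [pchar K] =i pred0).
Variables (R : comNzRingType) (iota : {rmorphism R -> K}) (s : K).
Variables (r : seq R) (Q : nat -> diffop R) (Q0 : Q 0%N = [fsfun]).

Definition indK (a : int) : {poly K} := \prod_(z <- r) ('X + (s + a%:~R - iota z)%:P).
Definition ffK e (a : int) : {poly K} := map_poly iota (ffactX R e) \Po Xs s a.

Lemma indKE a : indK a = map_poly iota (indicial r) \Po Xs s a.
Proof.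
rewrite /indicial rmorph_prod rmorph_prod /=; apply: eq_bigr => z _.
rewrite [in RHS]rmorphB /= map_polyX map_polyC /= comp_polyB comp_polyX comp_polyC.
by rewrite /Xs polyCB addrA.
Qed.

Lemma ffKE e a : ffK e a = \prod_(i < e) Xs s (a - i%:Z).
Proof.
rewrite /ffK /ffactX rmorph_prod rmorph_prod /=; apply: eq_bigr => i _.
rewrite rmorphB /= map_polyX map_polyC /= comp_polyB comp_polyX comp_polyC.
by rewrite /Xs rmorph_nat rmorphB /= addrA polyCB addrA.
Qed.

Lemma hat_diffop q h a b : hat (ls_diffop iota s q h) a b =
  \sum_(e <- finsupp q) iota (q e) *
    sact (ffK e.2 (a - (e.1 - e.2%:Z))) (hat h (a - (e.1 - e.2%:Z))) b.
Proof.
rewrite /hat /ls_diffop mulr_sumr; apply: eq_bigr => e _.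
rewrite mulrCA; congr (_ * _); rewrite -[LHS]/(hat _ (a - e.1) b) hat_iter_dx.
have -> : a - e.1 + e.2%:Z = a - (e.1 - e.2%:Z) by lia.
by rewrite ffKE.
Qed.

Definition op_hat n (phi : nat -> int -> nat -> K) a b :=
  sact (indK a) (phi n a) b + \sum_(m < n.+1) \sum_(e <- finsupp (Q m))
    iota (Q m e) * sact (ffK e.2 (a - (e.1 - e.2%:Z)))
                       (phi (n - m)%N (a - (e.1 - e.2%:Z))) b.

Lemma op_hat_sol n f a b : op_hat n (fun n => hat (f n)) a b =
  b`!%:R * (ls_P iota s r (f n) a b +
            \sum_(m < n.+1) ls_diffop iota s (Q m) (f (n - m)%N) a b).
Proof.
rewrite mulrDr -[X in X + _ = _]hat_ls_P mulr_sumr; congr (_ + _).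
by apply: eq_bigr => m _; rewrite -hat_diffop.
Qed.

Lemma op_hat_eq n phi psi a b : (forall m a b, (m <= n)%N -> phi m a b = psi m a b) ->
  op_hat n phi a b = op_hat n psi a b.
Proof.
move=> e; congr (_ + _); first by apply: sact_eq => b'; exact: e.
apply: eq_bigr => m _; apply: eq_bigr => u _; congr (_ * _).
by apply: sact_eq => b'; rewrite e // leq_subr.
Qed.

Lemma is_sol_hat f : is_sol iota s r Q f <->
  forall n a b, op_hat n (fun n => hat (f n)) a b = 0.
Proof.
split=> H n a b; first by rewrite op_hat_sol H mulr0.
by apply/eqP; have /eqP := H n a b; rewrite op_hat_sol mulf_eq0 (negPf (fact_neq0 charK _)).
Qed.

Variables (N bd m0 : nat).
Hypothesis bandQ : forall m e, (m <= N)%N -> e \in finsupp (Q m) ->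
  (`|e.1 - e.2%:Z| <= bd)%N.
Hypothesis m0P : forall a : int, (m0 < `|a|)%N -> (indK a)`_0 != 0.

(** Away from the integers |a| <= m0 the indicial part acts injectively, so a nonzero row must be
    fed by a lower order in t from distance at most [bd]. The support therefore spreads by at most
    [bd] for each power of t. The set [I] is where the equation is known; outside it the sequence is
    zero. *)
Lemma decay (I : int -> Prop) (phi : nat -> int -> nat -> K) :
  (forall n a, (n <= N)%N -> exists B, forall b, (B <= b)%N -> phi n a b = 0) ->
  (forall n a b, (n <= N)%N -> ~ I a -> phi n a b = 0) ->
  (forall n a b, (n <= N)%N -> I a -> op_hat n phi a b = 0) ->
  forall n a b, (n <= N)%N -> (m0 + bd * n < `|a|)%N -> phi n a b = 0.
Proof.
move=> fin out eq n a b; have [k] := ubnP n.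
elim: k n a b => // k IH n a b lek len lt.
case: (pselect (I a)) => [Ia|nIa]; last exact: out.
have [B phiB] := fin n a len.
apply: (sact_inj (p := indK a)) phiB _ b; first by apply: m0P; lia.
move=> b; rewrite -(eq n a b len Ia) /op_hat big1 ?addr0 // => m _.
rewrite big1_seq // => e /andP[_ em].
have m_gt0 : (0 < m)%N.
  case: (nat_of_ord m) em => //; rewrite Q0 mem_finsupp fsfunE eqxx //.
have mn : (m <= n)%N by rewrite -ltnS.
have be := bandQ (leq_trans mn len) em.
rewrite sact_eq0 ?mulr0 // => b'; apply: IH; [lia|lia|].
have : (bd * (n - m) + bd <= bd * n)%N.
  by rewrite -mulnSr leq_mul2l; apply/orP; right; lia.
move: be lt; move: (bd * (n - m))%N (bd * n)%N => u v; lia.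
Qed.

Variables (A nw : nat).
Hypothesis A_big : (m0 + bd * N.+1 <= A)%N.
Hypothesis nw_big : (A + (m0 + bd * N.+1) < nw)%N.
Local Notation T := (tps N K).

Definition pos (i : nat) : int := i%:Z - A%:Z.

(** The window on x^(s-A), ..., x^(s-A+nw-1), with ['X] playing d/d(log x) through the substitution
    c = s + X. *)
Definition DK : 'M[{poly T}]_nw := \matrix_(i, j)
  (map_poly (@tps_map N _ _ iota) (Dent N r Q (pos i) (pos j)) \Po ('X + (tpsC N s)%:P)).

Lemma slice_DK m i j : (m <= N)%N -> slice m (DK i j) =
  (if (m == 0%N) && (i == j) then indK (pos j) else 0) +
  \sum_(e <- finsupp (Q m) | e.1 - e.2%:Z == pos i - pos j)
    iota (Q m e) *: ffK e.2 (pos j).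
Proof.
move=> le; rewrite mxE slice_comp slice_map /Dent /Xplus.
have -> : (pos j)%:~R = tpsC N (pos j)%:~R :> tps N R by rewrite rmorph_int.
rewrite slice_comp slice_Dsym // map_comp_poly -comp_polyA.
have -> : map_poly iota ('X + ((pos j)%:~R)%:P) \Po ('X + s%:P) = Xs s (pos j).
  rewrite rmorphD /= map_polyX map_polyC /= rmorph_int comp_polyD comp_polyX comp_polyC.
  by rewrite /Xs polyCD addrA.
rewrite rmorphD comp_polyD; congr (_ + _).
  have -> : (pos i - pos j == 0) = (i == j).
    by rewrite /pos; apply/eqP/eqP => [e|->]; [apply/val_inj => /=; lia | lia].
  by case: ifP => _; rewrite ?indKE // rmorph0 comp_poly0.
rewrite /symb rmorph_sum rmorph_sum /=; apply: eq_bigr => e _.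
by rewrite -mul_polyC rmorphM /= map_polyC /= comp_polyM comp_polyC mul_polyC.
Qed.

(** Extension of a vector by zero outside the window. *)
Definition vec_phi (y : nat -> 'cV[T]_nw) (n : nat) (a : int) (b : nat) : K :=
  \sum_(j < nw | pos j == a) (y b j 0 : T) n.

Lemma vec_phi_pos y n (j : 'I_nw) b : vec_phi y n (pos j) b = (y b j 0 : T) n.
Proof.
rewrite /vec_phi (big_pred1 j) // => i /=.
by apply/eqP/eqP => [e|-> //]; apply/val_inj; move: e; rewrite /pos /=; lia.
Qed.

Lemma vec_phi_out y n a b : (forall j : 'I_nw, pos j != a) -> vec_phi y n a b = 0.
Proof. by move=> na; rewrite /vec_phi big1 // => j /eqP e; case/eqP: (na j). Qed.

Lemma seq_act_DK y b i n : (n <= N)%N ->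
  (seq_act DK y b i 0 : T) n = op_hat n (vec_phi y) (pos i) b.
Proof.
move=> le; rewrite /seq_act summxE tps_coef_sum.
transitivity (\sum_(k < msize DK) \sum_(m < n.+1) \sum_(j < nw)
    (slice m (DK i j))`_k * vec_phi y (n - m)%N (pos j) (b + k)%N).
  apply: eq_bigr => k _; rewrite mxE tps_coef_sum exchange_big /=.
  apply: eq_bigr => j _; rewrite tps_coefM //; apply: eq_bigr => m _.
  by rewrite vec_phi_pos coef_slice [cmx DK k i j]mxE.
rewrite exchange_big /=.
transitivity (\sum_(m < n.+1) \sum_(j < nw)
    sact (slice m (DK i j)) (vec_phi y (n - m)%N (pos j)) b).
  apply: eq_bigr => m _; rewrite exchange_big; apply: eq_bigr => j _.
  rewrite (@sact_widen _ (msize DK)) // (leq_trans (size_slice _ _)) //.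
  exact: (leq_bigmax (i, j)).
have lem (m : 'I_n.+1) : (m <= N)%N by rewrite (leq_trans _ le) // -ltnS.
under eq_bigr => m _ do under eq_bigr => j _ do rewrite slice_DK ?lem // sactD.
under eq_bigr do rewrite big_split /=.
rewrite big_split /=; congr (_ + _).
  rewrite big_ord_recl [X in _ + X]big1 ?addr0 => [|m _]; last first.
    by rewrite big1 // => j _; rewrite sact0.
  rewrite (bigD1 i) //= eqxx big1 ?addr0 => [|j ji]; first by rewrite subn0.
  by rewrite eq_sym (negPf ji) sact0.
apply: eq_bigr => m _.
under eq_bigr do rewrite sact_sum.
rewrite (exchange_big_dep xpredT) //=; apply: eq_big_seq => e em.
have [[j jE]|nj] := pselect (exists j : 'I_nw, pos j = pos i - (e.1 - e.2%:Z)).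
  rewrite (big_pred1 j) => [|j' /=]; first by rewrite sactZ jE.
  apply/eqP/eqP => [e'|->]; last by rewrite jE subKr.
  by apply/val_inj; move: jE; rewrite e' subKr /pos /=; lia.
rewrite big1 => [|j /eqP e']; last by case: nj; exists j; rewrite e' subKr.
rewrite sact_eq0 ?mulr0 // => b'; apply: vec_phi_out => j.
by apply/eqP => e'; apply: nj; exists j.
Qed.

Lemma pos_window (a : int) : (`|a| <= m0 + bd * N.+1)%N -> exists j : 'I_nw, pos j = a.
Proof.
move=> le; have lt : (`|(a + A%:Z)%R| < nw)%N by lia.
by exists (Ordinal lt); rewrite /pos /=; lia.
Qed.

Definition tvec (f : tlogser K) b : 'cV[T]_nw :=
  \col_i tps_of N (FPS (fun n => hat (f n) (pos i) b)).

Lemma M_decay f n a b : in_M iota s r Q f -> (n <= N)%N ->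
  (m0 + bd * N < `|a|)%N -> hat (f n) a b = 0.
Proof.
move=> [fl fs] le lt.
apply: (@decay (fun=> True) (fun n => hat (f n))) => //.
- move=> k a' _; have [_ [d hd]] := fl k; exists d => b' /hd; rewrite /hat => ->.
  by rewrite mulr0.
- by move=> k a' b' _ _; apply: (proj1 (is_sol_hat f)).
- by apply: leq_ltn_trans lt; rewrite leq_add2l leq_mul2l le orbT.
Qed.

Lemma vec_phi_tvec f n a b : in_M iota s r Q f -> (n <= N)%N ->
  vec_phi (tvec f) n a b = hat (f n) a b.
Proof.
move=> fM le; case: (leqP `|a| (m0 + bd * N)) => [lea|lt].
  have [|j <-] := @pos_window a; first by rewrite mulnSr; lia.
  by rewrite vec_phi_pos mxE tps_ofE // coef_FPS.
rewrite (M_decay _ fM le lt) /vec_phi big1 // => j /eqP ja.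
by rewrite mxE tps_ofE // coef_FPS ja (M_decay _ fM le lt).
Qed.

Lemma tvec_sol f b : in_M iota s r Q f -> seq_act DK (tvec f) b = 0.
Proof.
move=> fM; apply/colP => i; apply: tpsP => n le; rewrite seq_act_DK // mxE tps_coef0.
rewrite (@op_hat_eq n _ (fun n => hat (f n))); last first.
  by move=> m a b' lem; rewrite vec_phi_tvec // (leq_trans lem).
by case: fM => _ fs; apply: (proj1 (is_sol_hat f)).
Qed.

(** By [decay], a solution on the window is supported away from its ends, so its extension by zero
    solves the full equation up to t^N; [lift_solution] then supplies the higher orders. *)
Lemma vec_lift (y : nat -> 'cV[T]_nw) :
  (exists B, forall b, (B <= b)%N -> y b = 0) -> (forall b, seq_act DK y b = 0) ->
  exists f, in_M iota s r Q f /\ forall b, y b = tvec f b.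
Proof.
move=> [B yB] ys.
pose phi := vec_phi y.
have phiB n a b : (B <= b)%N -> phi n a b = 0.
  by move=> le; rewrite /phi /vec_phi big1 // => j _; rewrite yB // mxE tps_coef0.
pose I (a : int) := exists j : 'I_nw, pos j = a.
have out n a b : ~ I a -> phi n a b = 0.
  by move=> nI; apply: vec_phi_out => j; apply/eqP => e; apply: nI; exists j.
have eqI n a b : (n <= N)%N -> I a -> op_hat n phi a b = 0.
  by move=> le [j <-]; rewrite -seq_act_DK // ys mxE tps_coef0.
have dec : forall n a b, (n <= N)%N -> (m0 + bd * n < `|a|)%N -> phi n a b = 0.
  by apply: (@decay I) => //; [move=> n a _; exists B; exact: phiB | move=> n a b _; exact: out].
(* At a position outside the window all rows within distance [bd] already vanish. *)
have eqA n a b : (n <= N)%N -> op_hat n phi a b = 0.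
  move=> le; case: (pselect (I a)) => [Ia|nI]; first exact: eqI.
  have ga : (m0 + bd * N.+1 < `|a|)%N.
    by rewrite ltnNge; apply/negP => /pos_window.
  rewrite /op_hat sact_eq0 ?add0r => [|b']; last exact: out.
  rewrite big1 // => m _; rewrite big1_seq // => e /andP[_ em].
  have lem : (m <= N)%N by rewrite (leq_trans _ le) // -ltnS.
  have be := bandQ lem em.
  rewrite sact_eq0 ?mulr0 // => b'; apply: dec; first by lia.
  have : (bd * (n - m) <= bd * N)%N by rewrite leq_mul2l; apply/orP; right; lia.
  by rewrite mulnSr in ga; lia.
pose f0 : tlogser K := fun n a b => phi n a b / b`!%:R.
have hf0 n a b : hat (f0 n) a b = phi n a b.
  by rewrite /hat /f0 mulrC divfK ?fact_neq0.
have [|n a b le|f [fM ff0]] := @lift_solution K charK s R iota r Q Q0 N f0.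
- move=> n le; split.
    exists (- (m0 + bd * N.+1)%N%:Z) => a b lt; rewrite /f0 dec ?mul0r //.
    have : (bd * n <= bd * N.+1)%N by rewrite leq_mul2l; apply/orP; right; lia.
    by move: (bd * n)%N (bd * N.+1)%N lt => u v; lia.
  by exists B => a b le'; rewrite /f0 phiB ?mul0r.
- apply/eqP; have /eqP := eqA n a b le.
  rewrite (@op_hat_eq n _ (fun n => hat (f0 n))) => [|m a' b' _]; last by rewrite hf0.
  by rewrite op_hat_sol mulf_eq0 (negPf (fact_neq0 charK _)).
exists f; split=> // b; apply/colP => i; apply: tpsP => n le.
by rewrite mxE tps_ofE // coef_FPS ff0 // hf0 /phi vec_phi_pos.
Qed.

End LocalOperator.

(** * Exponents as eigenvalues of d/d(log x) *)

Lemma fps_integral (F : idomainType) (x y : fps F) : x * y = 0 -> x = 0 \/ y = 0.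
Proof.
move=> xy; case: (pselect (x = 0)) => [|x0]; [by left | right].
have ex : exists n, x n != 0.
  apply: contra_notP x0 => nx; apply: fpsP => n.
  by apply/eqP/negPn/negP => xn; apply: nx; exists n.
pose n := ex_minn ex.
have [xn xmin] : x n != 0 /\ forall m, (m < n)%N -> x m = 0.
  rewrite /n; case: ex_minnP => m xm mmin; split=> // k lt.
  by apply/eqP/negPn/negP => /mmin; rewrite leqNgt lt.
apply: fpsP => m; have [k] := ubnP m; elim: k m => // k IH m lem.
have := congr1 (fun z : fps F => z (n + m)%N) xy.
have lt : (n < (n + m).+1)%N by rewrite ltnS leq_addr.
rewrite fps_coefM (bigD1 (Ordinal lt)) //= addKn big1 ?addr0.
  by move/eqP; rewrite mulf_eq0 (negPf xn) => /eqP.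
move=> i ni; case: (ltngtP i n) => [lt'|gt|e].
- by rewrite xmin // mul0r.
- rewrite IH ?fps_coef0 ?mulr0 //; have := ltn_ord i; lia.
- by case/eqP: ni; apply/val_inj.
Qed.

Section Ramify.
Variables (K S : fieldType) (j : {rmorphism K -> S}) (e : nat).
Hypothesis e_gt0 : (0 < e)%N.

Lemma ramifyE f n : fps_ramify j e f n =
  if (e %| n)%N then j (f (n %/ e)%N) else 0.
Proof. by []. Qed.

Fact fps_ramify_is_zmod_morphism : zmod_morphism (fps_ramify j e).
Proof.
move=> x y; apply: fpsP => n; rewrite fps_coefD fps_coefN !ramifyE.
by case: ifP => _; rewrite ?subr0 // rmorphB.
Qed.
Fact fps_ramify_is_monoid_morphism : monoid_morphism (fps_ramify j e).
Proof.
split=> [|x y]; apply: fpsP => n; rewrite ?fps_coef1 !ramifyE.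
  case: ifP => [/dvdnP[k ->]|nd].
    by rewrite mulnK // fps_coef1 rmorph_nat muln_eq0 (gtn_eqF e_gt0) orbF.
  by case: n nd => //; rewrite dvdn0.
rewrite fps_coefM; case: ifP => [/dvdnP[k ->]|nd]; last first.
  rewrite big1 // => i _; rewrite !ramifyE; case: ifP => di; rewrite ?mul0r //.
  case: ifP => di'; rewrite ?mulr0 //.
  have : (e %| i + (n - i))%N by rewrite dvdn_add.
  by rewrite subnKC ?nd // leq_ord.
rewrite mulnK // fps_coefM rmorph_sum /=.
pose F i := fps_ramify j e x i * fps_ramify j e y (k * e - i)%N.
rewrite -(big_mkord xpredT F) (bigID (dvdn e)) /= [X in _ + X]big1 ?addr0; last first.
  by move=> i nd; rewrite /F ramifyE (negPf nd) mul0r.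
rewrite big_mkord.
rewrite (reindex_onto (fun i : 'I_k.+1 => inord (i * e) : 'I_(k * e).+1)
  (fun i : 'I_(k * e).+1 => inord (i %/ e) : 'I_k.+1)) /=; last first.
  move=> i di; apply/val_inj => /=; have := ltn_ord i; rewrite ltnS => lei.
  by rewrite !inordK ?divnK // ltnS ?divnK // leq_divLR.
have lei (i : 'I_k.+1) : (i * e < (k * e).+1)%N by rewrite ltnS leq_mul2r -ltnS ltn_ord orbT.
rewrite [RHS](eq_bigl xpredT) => [|i]; last first.
  rewrite inordK // dvdn_mull //=; apply/eqP/val_inj => /=.
  by rewrite mulnK // inord_val.
apply: eq_bigr => i _; rewrite inordK // /F !ramifyE dvdn_mull // mulnK //.
by rewrite -mulnBl dvdn_mull // mulnK // rmorphM.
Qed.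
HB.instance Definition _ := GRing.isZmodMorphism.Build (fps K) (fps S)
  (fps_ramify j e) fps_ramify_is_zmod_morphism.
Definition ramifyM : {rmorphism fps K -> fps S} :=
  HB.pack (fps_ramify j e)
    (GRing.isZmodMorphism.Build _ _ (fps_ramify j e) fps_ramify_is_zmod_morphism)
    (GRing.isMonoidMorphism.Build _ _ (fps_ramify j e) fps_ramify_is_monoid_morphism).

Lemma ramify_inj : injective (fps_ramify j e).
Proof.
move=> x y xy; apply: fpsP => n; apply: (fmorph_inj j).
have := congr1 (fun f : fps S => f (n * e)%N) xy.
by rewrite !ramifyE dvdn_mull // mulnK.
Qed.

Lemma ramify0 x : fps_ramify j e x 0%N = j (x 0%N).
Proof. by rewrite ramifyE dvdn0 div0n. Qed.
End Ramify.

Section ExpTwist.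
Variables (S : comNzRingType) (lam : S).

(** Multiplication by x^lam in the coordinates [hat]: the binomial formula for exp(lam log x) times
    a polynomial in log x. *)
Definition xtwist (G : nat -> S) b : S :=
  \sum_(m < b.+1) ('C(b, m))%:R * lam ^+ m * G (b - m)%N.

(** Conjugation by x^lam turns d/d(log x) - lam into d/d(log x). *)
Lemma xtwist_shift G b :
  xtwist G b.+1 - lam * xtwist G b = xtwist (fun b => G b.+1) b.
Proof.
apply/eqP; rewrite subr_eq addrC; apply/eqP; rewrite /xtwist big_ord_recl /=.
rewrite big_ord_recr [X in _ = _ + X]big_ord_recl /= !bin0 !subn0 mulr_sumr.
rewrite big_ord_recr /= !binn !subnn.
under eq_bigr => i _ do rewrite /bump /= add1n binS natrD mulrDl mulrDl.
rewrite big_split /= [RHS]addrCA addrA [X in _ = X]addrC.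
have -> : \sum_(i < b) 'C(b, i.+1)%:R * lam ^+ i.+1 * G (b.+1 - i.+1)%N =
    \sum_(i < b) 'C(b, bump 0 i)%:R * lam ^+ bump 0 i * G (b - bump 0 i).+1.
  apply: eq_bigr => i _; rewrite /bump /= add1n; congr (_ * G _).
  by have := ltn_ord i; lia.
have -> : \sum_(i < b) 'C(b, i)%:R * lam ^+ i.+1 * G (b.+1 - i.+1)%N =
    \sum_(i < b) lam * ('C(b, i)%:R * lam ^+ i * G (b - i)%N).
  by apply: eq_bigr => i _; rewrite subSS exprS; ring.
rewrite /bump /= exprS; ring.
Qed.
End ExpTwist.

Lemma char_poly_generalized_eigenbasis_idomain (D : idomainType) n
    (Lam C : 'M[D]_n) (lam : 'I_n -> D) :
  \det C != 0 -> (forall i, row i C *m (Lam - (lam i)%:M) ^+ n = 0) ->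
  char_poly Lam = \prod_i ('X - (lam i)%:P).
Proof.
move=> detC rowC; pose tof : {rmorphism D -> {fraction D}} := @FracField.tofrac D.
have tof_inj : injective tof by move=> x y /eqP; rewrite tofrac_eq => /eqP.
apply: (map_inj_poly tof_inj); first exact: rmorph0.
rewrite map_char_poly rmorph_prod /=.
rewrite (@char_poly_generalized_eigenbasis _ _ _ (map_mx tof C) (fun i => tof (lam i))).
- by apply: eq_bigr => i _; rewrite rmorphB /= map_polyX map_polyC.
- by rewrite unitmxE det_map_mx unitfE tofrac_eq0.
- move=> i; rewrite -map_row -map_scalar_mx -map_mxB.
  have e k (B : 'M[D]_n) : map_mx tof B ^+ k = map_mx tof (B ^+ k).
    elim: k => [|k IH]; first by rewrite !expr0 map_mx1.
    by rewrite [LHS]exprS [in RHS]exprS IH -[LHS]/(_ *m _) -map_mxM.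
  by rewrite e -map_mxM rowC map_mx0.
Qed.

Section LocalBasis.
Variables (K : fieldType) (charK : [pchar K] =i pred0).
Variables (R : comNzRingType) (iota : {rmorphism R -> K}) (s : K).
Variables (r : seq R) (Q : nat -> diffop R) (Q0 : Q 0%N = [fsfun]).
Local Notation inM := (in_M iota s r Q).
Local Notation oph := (op_hat iota s r Q).

Lemma op_hat_sum d (kap : 'I_d -> K) (phi : 'I_d -> nat -> int -> nat -> K) n a b :
  oph n (fun n a b => \sum_l kap l * phi l n a b) a b =
  \sum_l kap l * oph n (phi l) a b.
Proof.
have sact_lsum p (psi : 'I_d -> nat -> K) b' :
    sact p (fun b => \sum_l kap l * psi l b) b' = \sum_l kap l * sact p (psi l) b'.
  rewrite /sact; under eq_bigr do rewrite mulr_sumr.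
  rewrite exchange_big; apply: eq_bigr => l _; rewrite mulr_sumr.
  by apply: eq_bigr => i _; rewrite mulrCA.
rewrite /op_hat sact_lsum; under [RHS]eq_bigr do rewrite mulrDr.
rewrite big_split /=; congr (_ + _).
under eq_bigr do under eq_bigr do rewrite sact_lsum mulr_sumr.
under eq_bigr do rewrite exchange_big /=.
rewrite exchange_big; apply: eq_bigr => l _; rewrite mulr_sumr.
apply: eq_bigr => m _; rewrite mulr_sumr; apply: eq_bigr => e _.
by rewrite mulrCA.
Qed.

Lemma in_M_sum d (kap : 'I_d -> K) (f : 'I_d -> tlogser K) :
  (forall l, inM (f l)) -> inM (fun n a b => \sum_l kap l * f l n a b).
Proof.
move=> fM; split.
  move=> n; apply: in_logser_sum => l; apply: in_logserZ; exact: (proj1 (fM l)).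
apply/(is_sol_hat charK) => n a b.
rewrite (@op_hat_eq _ _ _ _ _ _ _ _ (fun n a b => \sum_l kap l * hat (f l n) a b)).
  rewrite op_hat_sum big1 // => l _.
  by case: (fM l) => _ /(is_sol_hat charK) ->; rewrite mulr0.
move=> m a' b' _; rewrite /hat mulr_sumr; apply: eq_bigr => l _; by rewrite mulrCA.
Qed.

Definition dlog (f : tlogser K) : tlogser K := fun n a b => b.+1%:R * f n a b.+1.

Lemma hat_dlog f n a b : hat (dlog f n) a b = hat (f n) a b.+1.
Proof. by rewrite /hat /dlog factS natrM; ring. Qed.

Lemma in_M_dlog f : inM f -> inM (dlog f).
Proof.
case=> fl fs; split.
  move=> n; have [[m fm] [d fd]] := fl n; split.
    by exists m => a b /fm e; rewrite /dlog e mulr0.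
  by exists d => a b db; rewrite /dlog fd ?mulr0 // (leq_trans db).
apply/(is_sol_hat charK) => n a b.
rewrite (@op_hat_eq _ _ _ _ _ _ _ _ (fun n a b => hat (f n) a b.+1)); last first.
  by move=> m a' b' _; rewrite hat_dlog.
rewrite /op_hat sact_shift; under eq_bigr do under eq_bigr do rewrite sact_shift.
exact: (proj1 (is_sol_hat charK _ _ _ _ _) fs).
Qed.

Lemma in_M_shift f : inM f -> (forall a b, f 0%N a b = 0) -> inM (fun n => f n.+1).
Proof.
case=> fl fs f0; split=> [n|]; first exact: fl.
move=> n a b; rewrite -[RHS](fs n.+1 a b) [in RHS]big_ord_recr /= subnn.
have -> : f 0%N = (fun _ _ => 0) by apply/funext => a'; apply/funext => b'; exact: f0.
have -> : ls_diffop iota s (Q n.+1) (fun _ _ => 0) a b = 0.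
  rewrite /ls_diffop big1 // => e _; rewrite /ls_mulx.
  suff -> : iter e.2 (ls_dx s) (fun _ _ : _ => 0 : K) = (fun _ _ => 0) by rewrite mulr0.
  elim: e.2 => //= k ->; apply/funext => a'; apply/funext => b'.
  by rewrite /ls_dx !mulr0 addr0.
rewrite addr0; congr (_ + _); apply: eq_bigr => m _.
by rewrite subSn // -ltnS.
Qed.

Variables (N bd m0 : nat).
Hypothesis bandQ : forall m e, (m <= N)%N -> e \in finsupp (Q m) ->
  (`|e.1 - e.2%:Z| <= bd)%N.
Hypothesis m0P : forall a : int, (m0 < `|a|)%N -> (indK iota s r a)`_0 != 0.
Variables (A nw : nat).
Hypothesis A_big : (m0 + bd * N.+1 <= A)%N.
Hypothesis nw_big : (A + (m0 + bd * N.+1) < nw)%N.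
Local Notation T := (tps N K).
Local Notation DK := (DK iota s r Q N A nw).
Local Notation tvec := (tvec N A nw).

Variables (d : nat) (e : 'I_d -> tlogser K).
Hypothesis e_basis : is_basis_M iota s r Q e.

Let eM l : inM (e l). Proof. by case: e_basis. Qed.

Lemma dlog_matrix : exists Lam : 'M[fps K]_d, forall l n a b,
  dlog (e l) n a b = \sum_k tls_scale (Lam k l) (e k) n a b.
Proof.
case: e_basis => _ sp _.
have /choice[c cP] l := sp _ (in_M_dlog (eM l)).
exists (\matrix_(k, l) c l k) => l n a b; rewrite cP.
by apply: eq_bigr => k _; rewrite mxE.
Qed.

Lemma log_bound : exists B, forall l n a b, (n <= N)%N -> (B <= b)%N -> e l n a b = 0.
Proof.
have /choice[dg dgP] : forall ln : 'I_d * 'I_N.+1,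
    exists B, forall a b, (B <= b)%N -> e ln.1 ln.2 a b = 0.
  by move=> [l n]; case: (proj1 (eM l) n).
exists (\max_ln dg ln) => l n a b le Bb.
apply: (dgP (l, Ordinal (le : (n < N.+1)%N))); apply: leq_trans Bb.
exact: (leq_bigmax (l, _)).
Qed.

(** A combination vanishing at t = 0 is t times an element of M; expanding that element in the basis
    gives a relation whose constant terms are [kap]. *)
Lemma basis_mod_t (kap : 'I_d -> K) :
  (forall a b, \sum_l kap l * e l 0%N a b = 0) -> forall l, kap l = 0.
Proof.
move=> k0; case: e_basis => _ sp fr.
have [c cP] := sp _ (in_M_shift (in_M_sum kap eM) k0).
suff H : forall l, fpsC (kap l) - fpsXn K 1 * c l = 0.
  move=> l; have := congr1 (fun f : fps K => f 0%N) (H l).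
  by rewrite /= fps_coefD fps_coefN fps_coefXnM fps_coef0 /= subr0.
apply: fr => n a b.
have scB x y f : tls_scale (x - y) f n a b = tls_scale x f n a b - tls_scale y f n a b.
  rewrite /tls_scale -sumrB; apply: eq_bigr => m _.
  by rewrite fps_coefD fps_coefN mulrDl mulNr.
under eq_bigr do rewrite scB; rewrite sumrB; apply/eqP; rewrite subr_eq0; apply/eqP.
have scC x f : tls_scale (fpsC x) f n a b = x * f n a b.
  by rewrite /tls_scale big_ord_recl /= subn0 big1 ?addr0 // => i _; rewrite coef_FPS mul0r.
under eq_bigr do rewrite scC.
case: n {scB scC} => [|n].
  rewrite k0 big1 // => l _; rewrite /tls_scale big_ord1 fps_coefXnM /= mul0r //.
rewrite cP; apply: eq_bigr => l _; rewrite /tls_scale [in RHS]big_ord_recl fps_coefXnM /= mul0r add0r.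
by apply: eq_bigr => m _; rewrite fps_coefXnM /= subn1 /bump /= add1n subSS.
Qed.

(** Decay bounds the powers of x and [log_bound] the powers of log x, so finitely many coefficients
    determine a combination of the basis at t = 0; their matrix is row free and has a right
    inverse. *)
Lemma eval_left_inverse : exists B (ev : 'I_nw -> 'I_B -> 'I_d -> K),
  forall l k : 'I_d, \sum_(i < nw) \sum_(b < B) hat (e l 0%N) (pos A i) b * ev i b k = (l == k)%:R.
Proof.
have [B BP] := log_bound.
pose X : finType := ('I_nw * 'I_B)%type.
pose F : 'M[K]_(d, #|{: X}|) :=
  \matrix_(l, x) let y : 'I_nw * 'I_B := @enum_val X _ x in hat (e l 0%N) (pos A y.1) y.2.
have : row_free F.
  apply: inj_row_free => v vF; apply/rowP => l; rewrite [RHS]mxE.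
  pose f : tlogser K := fun n a b => \sum_l v 0 l * e l n a b.
  have fM : inM f := in_M_sum (v 0) eM.
  apply: (@basis_mod_t (v 0)) => a b; rewrite -/(f 0%N a b).
  apply: (hat_eq0 charK); case: (leqP B b) => [le|lt].
    by rewrite /hat /f big1 ?mulr0 // => k _; rewrite BP ?mulr0.
  case: (leqP `|a| (m0 + bd * N.+1)) => [lea|gta]; last first.
    apply: (M_decay charK Q0 bandQ m0P _ fM (leq0n N)).
    by apply: leq_ltn_trans gta; rewrite leq_add2l leq_mul2l leqnSn orbT.
  have [i <-] := pos_window A_big nw_big lea.
  have /rowP/(_ (enum_rank ((i, Ordinal lt) : X))) := vF.
  rewrite !mxE => <-; rewrite /hat /f mulr_sumr; apply: eq_bigr => k _.
  by rewrite !mxE enum_rankK /hat /= mulrCA.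
case/row_freeP => G FG; exists B, (fun i b k => G (enum_rank ((i, b) : X)) k) => l k.
rewrite pair_big /=; have /matrixP/(_ l k) := FG; rewrite !mxE => <-.
rewrite [RHS](reindex (@enum_rank X)) /=; last by apply: onW_bij; exact: enum_rank_bij.
by apply: eq_bigr => -[i b] _; rewrite !mxE enum_rankK.
Qed.

(* Vectors over a power series ring are determined by the coordinates of the
   combination of the basis: modulo t the coordinates are left invertible. *)
Lemma eval_injective (S : fieldType) (j : {rmorphism K -> S}) (E : 'I_d -> int -> nat -> fps S)
    (v : 'I_d -> fps S) :
  (forall l a b, E l a b 0%N = j (hat (e l 0%N) a b)) ->
  (forall a b, \sum_l v l * E l a b = 0) -> forall l, v l = 0.
Proof.
move=> E0 vE; have [B [ev evP]] := eval_left_inverse.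
pose U : 'M[fps S]_d := \matrix_(l, k)
  \sum_(i < nw) \sum_(b < B) E l (pos A i) b * fpsC (j (ev i b k)).
have vU : (\row_l v l) *m U = 0.
  apply/rowP => k; rewrite !mxE.
  under eq_bigr do rewrite !mxE mulr_sumr.
  rewrite exchange_big big1 // => i _.
  under eq_bigr do rewrite mulr_sumr; rewrite exchange_big big1 // => b _.
  by under eq_bigr do rewrite mulrA; rewrite -mulr_suml vE mul0r.
have detU : \det U 0%N = 1.
  rewrite -[LHS]/(fps_const (\det U)) -det_map_mx;
  rewrite [map_mx _ _](_ : _ = 1%:M) ?det1 //.
  apply/matrixP => l k; rewrite !mxE /= /fps_const fps_coef_sum.
  have -> : (l == k)%:R = j (l == k)%:R by rewrite rmorph_nat.
  rewrite -evP rmorph_sum; apply: eq_bigr => i _; rewrite fps_coef_sum rmorph_sum.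
  by apply: eq_bigr => b _; rewrite fps_coefM big_ord1 subnn coef_FPS E0 rmorphM.
have vd : \det U *: (\row_l v l) = 0.
  by rewrite -[LHS]mul_mx_scalar -mul_mx_adj mulmxA vU mul0mx.
move=> l; have /rowP/(_ l) := vd; rewrite !mxE => /fps_integral[] // dU.
by move: detU; rewrite dU fps_coef0 => /esym/eqP; rewrite oner_eq0.
Qed.

Variable Lam : 'M[fps K]_d.
Hypothesis LamP : forall l n a b,
  dlog (e l) n a b = \sum_k tls_scale (Lam k l) (e k) n a b.

Definition ehat l a b : fps K := FPS (fun n => hat (e l n) a b).

Lemma fps_scale_hat (c : fps K) (f : tlogser K) a b : FPS (fun n => hat (tls_scale c f n) a b) =
  c * FPS (fun n => hat (f n) a b).
Proof.
apply: fpsP => n; rewrite coef_FPS fps_coefM /hat mulr_sumr.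
by apply: eq_bigr => m _; rewrite coef_FPS mulrCA.
Qed.

Lemma fps_sum_hat q (c : 'I_q -> fps K) (g : 'I_q -> tlogser K) (f : tlogser K) a b :
  (forall n, f n a b = \sum_l tls_scale (c l) (g l) n a b) ->
  FPS (fun n => hat (f n) a b) = \sum_l c l * FPS (fun n => hat (g l n) a b).
Proof.
move=> fE; apply: fpsP => n; rewrite coef_FPS fps_coef_sum /hat fE mulr_sumr.
by apply: eq_bigr => l _; rewrite -fps_scale_hat.
Qed.

Lemma ehat_shift l a b : ehat l a b.+1 = \sum_k Lam k l * ehat k a b.
Proof.
rewrite -(fps_sum_hat (f := dlog (e l))) //.
by apply: fpsP => n; rewrite !coef_FPS hat_dlog.
Qed.

Let LamT : 'M[T]_d := map_mx (@tps_of N K) Lam.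
Let Xb b : 'M[T]_(nw, d) := \matrix_(i, l) tps_of N (ehat l (pos A i) b).

Let Xb_pow b : Xb b = Xb 0 *m LamT ^+ b.
Proof.
elim: b => [|b IH]; first by rewrite expr0 mulmx1.
rewrite exprSr -[LamT ^+ b * _]/(_ *m _) mulmxA -IH; apply/matrixP => i l.
rewrite !mxE ehat_shift rmorph_sum; apply: eq_bigr => k _.
by rewrite !mxE rmorphM mulrC.
Qed.

(** Instance of [det_sol_module]: since [LamT] is the matrix of d/d(log x) on the basis, its
    coefficient vectors at log degree b are [Xb 0 *m LamT ^+ b], and by [vec_lift] they span the
    finitely supported solutions of the window. *)
Lemma det_local dd (u : {poly K}) :
  map_poly (@tps_const N K) (\det DK) = 'X^dd * u -> u`_0 != 0 ->
  exists q, \det DK = char_poly LamT * q.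
Proof.
move=> cd u0; have [B BP] := log_bound.
have [m [theta [rest E]]] := tps_poly_inv cd u0 B.+1.
apply: (@det_sol_module T nw d DK (Xb 0) LamT _ _ _ B _ m theta rest E).
- apply/matrixP => i l; rewrite [RHS]mxE.
  have := tvec_sol charK Q0 bandQ m0P A_big nw_big 0 (eM l).
  move=> /colP/(_ i); rewrite [RHS]mxE => <-; rewrite /seq_act !summxE.
  apply: eq_bigr => k _; rewrite -Xb_pow !mxE; apply: eq_bigr => i' _.
  by rewrite !mxE.
- move=> y y0 ys.
  have [f [fM yf]] := vec_lift charK Q0 bandQ m0P A_big nw_big y0 ys.
  case: e_basis => _ sp _; have [c cP] := sp _ fM.
  exists (\col_l tps_of N (c l)) => b; rewrite mulmxA -Xb_pow yf.
  apply/colP => i; rewrite !mxE (fps_sum_hat (g := e) (c := c)) //.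
  by rewrite rmorph_sum; apply: eq_bigr => l _; rewrite !mxE rmorphM mulrC.
- move=> c c0; apply/colP => l; rewrite [RHS]mxE.
  have [B' [ev evP]] := eval_left_inverse.
  pose U : 'M[T]_d := \matrix_(k, l) \sum_(i < nw) \sum_(b < B') tpsC N (ev i b k) * Xb b i l.
  have Uc : U *m c = 0.
    apply/colP => k; rewrite !mxE; under eq_bigr do rewrite !mxE mulr_suml.
    rewrite exchange_big big1 // => i _.
    under eq_bigr do rewrite mulr_suml; rewrite exchange_big big1 // => b _.
    under eq_bigr do rewrite -mulrA; rewrite -mulr_sumr.
    have /colP/(_ i) := c0 b; rewrite mulmxA -Xb_pow [LHS]mxE => ->.
    by rewrite mxE mulr0.
  (* [U] is the identity modulo t, so the equation U c = 0 makes c divisible by every power of t. *)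
  have [V VE] : exists V, U = 1%:M + tpsX N K *: V.
    have /choice[V VP] : forall kl : 'I_d * 'I_d, exists v,
        U kl.1 kl.2 - (1%:M : 'M[T]_d) kl.1 kl.2 = tpsX N K * v.
      move=> [k l'] /=; apply: tps_const_div; rewrite rmorphB !mxE /= rmorph_nat.
      apply/eqP; rewrite subr_eq0; apply/eqP; rewrite rmorph_sum eq_sym.
      rewrite -evP; apply: eq_bigr => i _; rewrite rmorph_sum; apply: eq_bigr => b _.
      rewrite /= /tps_const tps_coefCM mulrC mxE tps_ofE //.
    exists (\matrix_(k, l) V (k, l)); apply/matrixP => k l'.
    by rewrite !mxE -(VP (k, l')) /= !mxE addrC subrK.
  have cE : c = - (tpsX N K *: (V *m c)).
    have := Uc; rewrite VE mulmxDl mul1mx -scalemxAl => /eqP.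
    by rewrite addr_eq0 => /eqP.
  have cn k : exists c', c = tpsX N K ^+ k *: c'.
    elim: k => [|k [c' c'E]]; first by exists c; rewrite scale1r.
    exists (- (V *m c')); rewrite {1}cE c'E -scalemxAr scalerA -exprS.
    exact: esym (scalerN _ _).
  by have [c' ->] := cn N.+1; rewrite tpsX_nilp // scale0r mxE.
- move=> b Bb; rewrite -Xb_pow; apply/matrixP => i l; rewrite !mxE.
  apply: tpsP => n le; rewrite tps_ofE // coef_FPS tps_coef0 /hat BP ?mulr0 //.
Qed.

Section Exponents.
Variables (S : fieldType) (j : {rmorphism K -> S}) (L : nat) (L_gt0 : (0 < L)%N).
Variables (lam : 'I_d -> fps S) (g : 'I_d -> tlogser S) (M : nat) (C : 'M[fps S]_d).
Hypothesis charS : [pchar S] =i pred0.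
Hypothesis g_deg : forall i n a b, (d <= b)%N -> g i n a b = 0.
Hypothesis detC : \det C != 0.
Hypothesis gE : forall i n a b,
  tls_scale (FPS (fun m => (m == M)%:R)) (tls_xpow (lam i) (g i)) n a b =
  \sum_l tls_scale (C i l) (tls_ramify j L (e l)) n a b.

Let jr := ramifyM j L_gt0.
Let ghat i a b : fps S := FPS (fun n => hat (g i n) a b).

Let xpow_hat i a b : FPS (fun n => hat (tls_xpow (lam i) (g i) n) a b) =
  xtwist (lam i) (ghat i a) b.
Proof.
apply: fpsP => n; rewrite coef_FPS /hat /tls_xpow /xtwist mulr_sumr fps_coef_sum.
apply: eq_bigr => m _; rewrite -[in RHS]mulrA [in RHS]mulr_natl.
have lem : (m <= b)%N by rewrite -ltnS.
have -> : lam i ^+ m * ghat i a (b - m) = FPS (fun n => hat (tls_scale (lam i ^+ m) (g i) n) a (b - m)%N).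
  apply: fpsP => k; rewrite fps_coefM coef_FPS /hat mulr_sumr.
  by apply: eq_bigr => q _; rewrite coef_FPS mulrCA.
have nE k (f : fps S) : (f *+ k) n = f n *+ k.
  by elim: k => [|k IH]; rewrite ?mulr0n ?fps_coef0 // !mulrS fps_coefD IH.
rewrite nE coef_FPS /hat -[RHS]mulr_natl !mulrA; congr (_ * _).
rewrite -(bin_fact lem) !natrM mulrA; field.
exact: (fact_neq0 charS).
Qed.

Let rhat l a b : fps S := jr (ehat l a b).

Let FE i a b : fpsXn S M * xtwist (lam i) (ghat i a) b = \sum_l C i l * rhat l a b.
Proof.
rewrite -xpow_hat; apply: fpsP => n; rewrite fps_coef_sum.
transitivity (b`!%:R * tls_scale (FPS (fun m => (m == M)%:R)) (tls_xpow (lam i) (g i)) n a b).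
  rewrite fps_coefM /tls_scale mulr_sumr; apply: eq_bigr => m _.
  by rewrite !coef_FPS /hat mulrCA.
rewrite gE mulr_sumr; apply: eq_bigr => l _; rewrite fps_coefM /tls_scale mulr_sumr.
apply: eq_bigr => m _; rewrite mulrCA; congr (_ * _).
rewrite /rhat /= ramifyE /tls_ramify; case: ifP => _; last by rewrite mulr0.
by rewrite coef_FPS /hat rmorphM rmorph_nat.
Qed.

Let LamR : 'M[fps S]_d := (map_mx jr Lam)^T.

Let rhat_shift (v : 'rV[fps S]_d) a b :
  \sum_l v 0 l * rhat l a b.+1 = \sum_l (v *m LamR) 0 l * rhat l a b.
Proof.
under [RHS]eq_bigr do rewrite mxE mulr_suml.
rewrite exchange_big; apply: eq_bigr => l _.
rewrite /rhat ehat_shift rmorph_sum mulr_sumr; apply: eq_bigr => k _.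
by rewrite !mxE rmorphM mulrA.
Qed.

Let twist_iter i a k b :
  fpsXn S M * xtwist (lam i) (fun b => ghat i a (b + k)%N) b =
  \sum_l (row i C *m (LamR - (lam i)%:M) ^+ k) 0 l * rhat l a b.
Proof.
elim: k b => [|k IH] b.
  rewrite expr0 mulmx1; under [RHS]eq_bigr do rewrite mxE.
  rewrite -FE; congr (_ * _); apply: eq_bigr => m _; by rewrite addn0.
have -> : xtwist (lam i) (fun b => ghat i a (b + k.+1)%N) b =
    xtwist (lam i) (fun b => ghat i a (b.+1 + k)%N) b.
  by apply: eq_bigr => m _; rewrite addnS addSn.
rewrite -(xtwist_shift _ (fun b => ghat i a (b + k)%N)) mulrBr mulrCA !IH.
rewrite rhat_shift mulr_sumr -sumrB exprSr -[_ * (LamR - _)]/(_ *m _) mulmxA mulmxBr.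
apply: eq_bigr => l _; rewrite mul_mx_scalar [in RHS]mxE [X in _ = (_ + X) * _]mxE.
rewrite [X in _ = (_ + - X) * _]mxE; ring.
Qed.

(** Applying D_log - lam_i to x^(s+lam_i) g_i differentiates g_i in log x, whose degree is less than
    d. Hence the d-th power kills it, and the rows of [C] are generalized eigenvectors for the
    lam_i. *)
Lemma char_poly_exponents :
  map_poly jr (char_poly Lam) = \prod_i ('X - (lam i)%:P).
Proof.
have row0 i : row i C *m (LamR - (lam i)%:M) ^+ d = 0.
  apply/rowP => l; rewrite [RHS]mxE.
  move: l; apply: (@eval_injective S j rhat) => [l a b|a b].
    by rewrite /rhat /= ramify0 coef_FPS.
  rewrite -twist_iter /xtwist big1 ?mulr0 // => m _.
  rewrite [ghat _ _ _](_ : _ = 0) ?mulr0 //.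
  apply: fpsP => n; rewrite coef_FPS fps_coef0 /hat g_deg ?mulr0 //.
  by rewrite leq_addl.
have -> : map_poly jr (char_poly Lam) = char_poly LamR.
  rewrite map_char_poly /LamR /char_poly -[RHS]det_tr; congr determinant.
  by rewrite /char_poly_mx linearB /= tr_scalar_mx -map_trmx trmxK.
exact: (@char_poly_generalized_eigenbasis_idomain
  (idomain_of (@fps_integral S)) d LamR C lam).
Qed.

End Exponents.
End LocalBasis.

(** Euclidean division by a monic polynomial commutes with [f]: the image of the remainder is a
    multiple of the monic divisor of smaller size, so the remainder is zero. *)
Lemma monic_divide (T S : comNzRingType) (f : {rmorphism T -> S}) (p w : {poly T})
    (q : {poly S}) : injective f -> w \is monic ->
  map_poly f p = map_poly f w * q -> exists q', p = w * q'.
Proof.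
move=> f_inj wm pq.
have pE := Pdiv.RingMonic.rdivp_eq wm p.
set u := Pdiv.Ring.rdivp p w in pE; set v := Pdiv.Ring.rmodp p w in pE.
have fw : map_poly f w \is monic by rewrite monic_map.
have sv : (size v < size w)%N by apply: Pdiv.Ring.ltn_rmodpN0; exact: monic_neq0.
have smap x : size (map_poly f x) = size x.
  by apply: size_map_inj_poly; rewrite ?rmorph0.
have fv : map_poly f v = map_poly f w * (q - map_poly f u).
  by rewrite mulrBr -pq pE rmorphD rmorphM /= addrAC mulrC subrr add0r.
have v0 : v = 0.
  apply: (map_inj_poly f_inj (rmorph0 f)); rewrite rmorph0 fv.
  move: fv; set x := q - map_poly f u => fv.
  case: (eqVneq x 0) => [->|x0]; first by rewrite mulr0.
  have := size_monicM fw x0; rewrite -fv !smap => e.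
  have : (0 < size x)%N by rewrite size_poly_gt0.
  by move: e sv; case: (size x) => // k; rewrite addnS /= => ->; rewrite ltnNge leq_addr.
by exists u; rewrite pE v0 addr0 mulrC.
Qed.

(** * Divisibility of the window determinant by w_i *)

Section LocalFactor.
Variables (K : fieldType) (charK : [pchar K] =i pred0).
Variables (S : fieldType) (incl : {rmorphism K -> S}).
Variables (R : comNzRingType) (iota : {rmorphism R -> K}) (iota_inj : injective iota).
Variables (r : seq R) (Q : nat -> diffop R) (Q0 : Q 0%N = [fsfun]).
Variables (N bd : nat).
Hypothesis bandQ : forall m e, (m <= N)%N -> e \in finsupp (Q m) ->
  (`|e.1 - e.2%:Z| <= bd)%N.
Variables (s : R) (L : nat) (L_gt0 : (0 < L)%N).
Local Notation d := (class_mult r s).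
Variable lam : 'I_d -> fps S.
Hypothesis lam_exp : is_exponents incl iota (iota s) r Q L lam.
Variable w : {poly (fps K)}.
Hypothesis w_def : map_poly (fps_ramify incl L) w = \prod_(i < d) ('X - (lam i)%:P).
Variable wR : {poly (fps R)}.
Hypothesis wR_lift : forall a m, (m <= N)%N -> iota (wR`_a m) = w`_a m.
Local Notation T := (tps N R).

Definition wT : {poly T} := map_poly (@tps_of N R) wR.

Let charS : [pchar S] =i pred0.
Proof. by move=> p; rewrite (fmorph_pchar incl). Qed.

Lemma class_bound : exists m0 : nat, forall z (n : int), z \in r ->
  z - s = n%:~R -> (`|n| <= m0)%N.
Proof.
elim: r => [|y r' [m0 IH]]; first by exists 0%N.
case: (pselect (exists n : int, y - s = n%:~R)) => [[n yn]|ny]; last first.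
  exists m0 => z n; rewrite in_cons => /orP[/eqP -> yn|]; last exact: IH.
  by case: ny; exists n.
exists (maxn m0 `|n|) => z k; rewrite in_cons => /orP[/eqP ->|zr zk]; last first.
  by rewrite leq_max (IH z).
rewrite yn => /(congr1 iota) /eqP; rewrite !rmorph_int -subr_eq0 -rmorphB.
by rewrite (intr_eq0_char0 charK) subr_eq0 => /eqP <-; rewrite leq_maxr.
Qed.

Let inj_ramify := @ramify_inj K S incl L L_gt0.

Let wK_const : map_poly (@fps_const K) w = 'X^d.
Proof.
have [lam0 _] := lam_exp.
have := congr1 (map_poly (@fps_const S)) w_def.
rewrite rmorph_prod /= (eq_bigr (fun=> 'X)) => [|i _]; last first.
  by rewrite rmorphB /= map_polyX map_polyC /= /fps_const lam0 subr0.
rewrite prodr_const card_ord => e; apply: (map_inj_poly (fmorph_inj incl) (rmorph0 incl)).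
rewrite map_polyXn -e; apply/polyP => i; rewrite !coef_map /=.
by rewrite /fps_const ramify0.
Qed.

Let wT_K : map_poly (@tps_map N _ _ iota) wT = map_poly (@tps_of N K) w.
Proof.
apply/polyP => a; rewrite !coef_map /=; apply: tpsP => m le.
by rewrite tps_mapE !tps_ofE // wR_lift.
Qed.

Let tps_map_iota_inj : injective (@tps_map N _ _ iota).
Proof. exact: tps_map_inj. Qed.

Section Bounded.
Variable m0 : nat.
Hypothesis m0_bound : forall z (n : int), z \in r -> z - s = n%:~R -> (`|n| <= m0)%N.

Let m0P (a : int) : (m0 < `|a|)%N -> (indK iota (iota s) r a)`_0 != 0.
Proof.
move=> lt; rewrite -horner_coef0 horner_prod prodf_seq_neq0; apply/allP => z zr.
rewrite implyTb hornerD hornerX hornerC add0r subr_eq0; apply/eqP => e.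
have : z - s = a%:~R.
  by apply: iota_inj; rewrite rmorphB rmorph_int -e addrC addKr.
by move/(m0_bound zr); rewrite leqNgt lt.
Qed.

Let A0 := (m0 + bd * N.+1)%N.
Let nw0 := (A0 + A0).+1.

Let exp_data : exists (e : 'I_d -> tlogser K) (Lam : 'M[fps K]_d),
  is_basis_M iota (iota s) r Q e /\ char_poly Lam = w /\
  (forall l n a b, dlog (e l) n a b = \sum_k tls_scale (Lam k l) (e k) n a b).
Proof.
have [_ [e [g [M [C [eb _ gdeg detC gE]]]]]] := lam_exp.
have [Lam LamP] := dlog_matrix charK eb.
exists e, Lam; split=> //; split=> //.
have cp := char_poly_exponents charK Q0 bandQ m0P (leqnn A0) (leqnn nw0) eb LamP
  L_gt0 charS gdeg detC gE.
apply: (map_inj_poly inj_ramify (rmorph0 (ramifyM incl L_gt0))).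
by rewrite w_def -cp.
Qed.

Let wT_char : exists Lam : 'M[tps N K]_d,
  char_poly Lam = map_poly (@tps_map N _ _ iota) wT.
Proof.
have [e [Lam [_ [cw _]]]] := exp_data.
by exists (map_mx (@tps_of N K) Lam); rewrite wT_K -cw map_char_poly.
Qed.

Lemma wT_monic : wT \is monic.
Proof.
have [Lam cw] := wT_char; have := char_poly_monic Lam; rewrite cw.
rewrite !monicE lead_coef_map_inj ?rmorph0 // => /eqP e.
by apply/eqP/tps_map_iota_inj; rewrite e rmorph1.
Qed.

Lemma wT_const : map_poly (@tps_const N R) wT = 'X^d.
Proof.
apply: (map_inj_poly iota_inj (rmorph0 iota)); rewrite map_polyXn -wK_const.
apply/polyP => i; rewrite /wT !coef_map /=.
by rewrite /tps_const tps_ofE // wR_lift.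
Qed.

Variables (A nw : nat).
Hypothesis A_big : (m0 + bd * N.+1 <= A)%N.
Hypothesis nw_big : (A + (m0 + bd * N.+1) < nw)%N.
Local Notation DK := (DK iota (iota s) r Q N A nw).

Let map_const (F : comNzRingType) (p : {poly tps N F}) :
  map_poly (@tps_const N F) p = slice 0 p.
Proof. by apply/polyP => i; rewrite [LHS]coef_map coef_slice. Qed.

Let det_DK_const : map_poly (@tps_const N K) (\det DK) =
  \prod_(z <- r) \prod_(j < nw) ('X + (iota s + (pos A j)%:~R - iota z)%:P).
Proof.
rewrite -det_map_mx exchange_big det_trig /=.
  apply: eq_bigr => j _; rewrite mxE map_const (slice_DK iota (iota s) r Q A_big nw_big) // !eqxx /=.
  by rewrite [X in _ + X]big1_seq ?addr0 // => e; rewrite Q0 mem_finsupp fsfunE eqxx andbF.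
apply/is_trig_mxP => i j lt; rewrite mxE map_const (slice_DK iota (iota s) r Q A_big nw_big) //=.
rewrite ifF; last by apply/eqP => e; rewrite e ltnn in lt.
by rewrite big1_seq ?addr0 // => e; rewrite Q0 mem_finsupp fsfunE eqxx andbF.
Qed.

(** A root z of P in the class of s contributes exactly one factor vanishing at X = 0, since the
    window contains the integer z - s; a root in another class contributes none. *)
Let det_DK_order : exists u : {poly K},
  map_poly (@tps_const N K) (\det DK) = 'X^d * u /\ u`_0 != 0.
Proof.
rewrite det_DK_const /class_mult.
have : {subset r <= r} by [].
elim: (X in {subset X <= _} -> exists u, \prod_(z <- X) _ = 'X^(count _ X) * _ /\ _) => [|z r' IH] sub.
  by exists 1; rewrite big_nil mulr1 coef1 oner_eq0.
have [y yr|u [uE u0]] := IH; first by apply: sub; rewrite in_cons yr orbT.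
rewrite big_cons uE /=.
pose fac (j : 'I_nw) := iota s + (pos A j)%:~R - iota z.
have prod_neq0 (P : pred 'I_nw) : (forall j, P j -> fac j != 0) ->
    (\prod_(j < nw | P j) ('X + (fac j)%:P))`_0 != 0.
  move=> nz; rewrite -horner_coef0 horner_prod; apply/prodf_neq0 => j Pj.
  by rewrite hornerD hornerX hornerC add0r nz.
have fac0 j : fac j = 0 -> z - s = (pos A j)%:~R.
  move/eqP; rewrite subr_eq0 => /eqP e; apply: iota_inj.
  by rewrite rmorphB rmorph_int -e addrC addKr.
case: (pselect (int_diff z s)) => [[n zn]|nz].
  have [|j0 jn] := pos_window A_big nw_big (a := n).
    apply: leq_trans (leq_addr _ _); apply: (m0_bound _ zn); exact: sub (mem_head _ _).
  have f0 : fac j0 = 0.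
    by rewrite /fac jn -(rmorph_int iota) -zn rmorphB; ring.
  exists (\prod_(j < nw | j != j0) ('X + (fac j)%:P) * u); split.
    rewrite asboolT; last by exists n.
    rewrite (bigD1 j0) //= -/(fac j0) f0 addr0 exprD expr1 mulrACA; congr (_ * _).
  rewrite coef0M mulf_neq0 // prod_neq0 // => j; apply: contraNneq => /fac0.
  rewrite zn => /(congr1 iota)/eqP; rewrite !rmorph_int -subr_eq0 -rmorphB.
  rewrite (intr_eq0_char0 charK) subr_eq0 -jn /pos => /eqP e; apply/eqP/val_inj => /=; lia.
exists (\prod_(j < nw) ('X + (fac j)%:P) * u); split.
  by rewrite asboolF // add0n mulrCA.
rewrite coef0M mulf_neq0 // prod_neq0 // => j _; apply/eqP => /fac0 e.
by apply: nz; exists (pos A j).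
Qed.

Let det_DK_Theta : \det DK = map_poly (@tps_map N _ _ iota)
  ((Theta N r Q nw \Po Xplus _ (- A%:Z)) \Po ('X + (tpsC N s)%:P)).
Proof.
rewrite map_comp_poly rmorphD /= map_polyX map_polyC /= tps_mapC -Theta_shift.
rewrite -[RHS]/(comp_poly _ _) -det_map_mx -det_map_mx; congr determinant.
by apply/matrixP => i j; rewrite !mxE.
Qed.

(** Over K the divisibility is [det_local] with the characteristic polynomial of d/d(log x), which
    is w; monic division brings it down to [R]. Modulo t both the determinant and w have order
    exactly d at X = 0, which leaves a quotient with nonzero constant term. *)
Lemma local_factor : exists q,
  (Theta N r Q nw \Po Xplus _ (- A%:Z)) \Po ('X + (tpsC N s)%:P) = wT * q /\
  (map_poly (@tps_const N R) q)`_0 != 0.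
Proof.
have [e [Lam [eb [cw LamP]]]] := exp_data.
have [u [uE u0]] := det_DK_order.
have [q' q'E] := det_local charK Q0 bandQ m0P A_big nw_big eb LamP uE u0.
have [q qE] : exists q, (Theta N r Q nw \Po Xplus _ (- A%:Z)) \Po ('X + (tpsC N s)%:P) = wT * q.
  apply: (monic_divide (q := q') tps_map_iota_inj wT_monic).
  by rewrite -det_DK_Theta q'E wT_K -cw map_char_poly.
exists q; split=> //; apply: contraNneq u0 => q0.
have := uE; rewrite det_DK_Theta qE.
have cm p : map_poly (@tps_const N K) (map_poly (@tps_map N _ _ iota) p) =
    map_poly iota (map_poly (@tps_const N R) p).
  by apply/polyP => i; rewrite !coef_map /=; exact: tps_mapE.
rewrite cm rmorphM rmorphM /= wT_const map_polyXn => /(mulfI _) <-.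
  by rewrite coef_map /= q0 rmorph0.
by rewrite -size_poly_eq0 size_polyXn.
Qed.
End Bounded.
End LocalFactor.

(** * Rational functions with poles in the classes *)

Lemma frac_elt (D : idomainType) (x : {fraction D}) :
  exists n d, d != 0 /\ x = FracField.tofrac n / FracField.tofrac d.
Proof.
elim/quotW: x => x; exists (frac x).1, (frac x).2.
have d0 : (frac x).2 != 0 by case: x.
split=> //; apply: (canRL (mulfK _)); first by rewrite tofrac_eq0.
unlock FracField.tofrac; rewrite -[LHS]FracField.pi_mul; apply/eqmodP => /=.
rewrite FracField.equivfE /FracField.mulf /= !numden_Ratio ?mulf_neq0 ?oner_eq0 ?mulr1 //.
by rewrite mulrC.
Qed.

Lemma frac_lift (D : idomainType) (G : fieldType) (f : {rmorphism D -> G}) :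
  injective f -> exists g : {rmorphism {fraction D} -> G},
  forall x, g (FracField.tofrac x) = f x.
Proof.
move=> f_inj; have f0 d : d != 0 -> f d != 0.
  by apply: contraNneq => e; apply/eqP/f_inj; rewrite e rmorph0.
have /choice[g gP] : forall x : {fraction D}, exists y, forall n d, d != 0 ->
    x = FracField.tofrac n / FracField.tofrac d -> y = f n / f d.
  move=> x; have [n [d [d0 xE]]] := frac_elt x.
  exists (f n / f d) => n' d' d'0; rewrite xE => /eqP.
  rewrite eqr_div ?tofrac_eq0 // -!rmorphM tofrac_eq => /eqP e.
  by apply/eqP; rewrite eqr_div ?f0 // -!rmorphM e.
have gE n d : d != 0 -> g (FracField.tofrac n / FracField.tofrac d) = f n / f d by move=> d0; exact: (gP _ n d).
have gz : zmod_morphism g.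
  move=> x y; have [n [d [d0 ->]]] := frac_elt x; have [n' [d' [d'0 ->]]] := frac_elt y.
  rewrite !gE // -!mulNr -rmorphN addf_div ?tofrac_eq0 // -!rmorphM -rmorphD.
  rewrite gE ?mulf_neq0 // -rmorphN addf_div ?f0 //.
  by rewrite rmorphD !rmorphM.
have gm : monoid_morphism g.
  split; first by rewrite -[1]divr1 -(rmorph1 (@FracField.tofrac D)) gE ?oner_eq0 // rmorph1 divr1.
  move=> x y; have [n [d [d0 ->]]] := frac_elt x; have [n' [d' [d'0 ->]]] := frac_elt y.
  rewrite !gE // [in LHS]mulf_div -!tofracM gE ?mulf_neq0 //.
  by rewrite !rmorphM mulf_div.
pose gM : {rmorphism {fraction D} -> G} := HB.pack g
  (GRing.isZmodMorphism.Build _ _ g gz) (GRing.isMonoidMorphism.Build _ _ g gm).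
exists gM => x; by rewrite -[LHS]/(g (FracField.tofrac x)) -[X in g X]divr1 -(rmorph1 (@FracField.tofrac D)) gE ?oner_eq0 // rmorph1 divr1.
Qed.

Section Localization.
Variables (D : idomainType) (den : D -> Prop).
Hypotheses (den1 : den 1) (denM : forall x y, den x -> den y -> den (x * y)).
Hypothesis den_neq0 : forall x, den x -> x != 0.
Local Notation F := {fraction D}.
Local Notation io := (@FracField.tofrac D).

Definition loc (x : F) : Prop := exists n d, den d /\ x = io n / io d.

Lemma loc_io n : loc (io n).
Proof. by exists n, 1; rewrite rmorph1 divr1. Qed.
Lemma loc_inv d : den d -> loc (io d)^-1.
Proof. by move=> dd; exists 1, d; rewrite rmorph1 mul1r. Qed.
Let io_neq0 d : den d -> io d != 0.
Proof. by move=> dd; rewrite tofrac_eq0 den_neq0. Qed.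
Lemma locD x y : loc x -> loc y -> loc (x + y).
Proof.
move=> [n [d [dd ->]]] [n' [d' [dd' ->]]].
exists (n * d' + n' * d), (d * d'); split; first exact: denM.
by rewrite addf_div ?io_neq0 // -!rmorphM -rmorphD.
Qed.
Lemma locM x y : loc x -> loc y -> loc (x * y).
Proof.
move=> [n [d [dd ->]]] [n' [d' [dd' ->]]].
by exists (n * n'), (d * d'); split; [exact: denM | rewrite mulf_div -!rmorphM].
Qed.
Lemma loc0 : loc 0. Proof. by rewrite -(rmorph0 io); exact: loc_io. Qed.
Lemma loc1 : loc 1. Proof. by rewrite -(rmorph1 io); exact: loc_io. Qed.
Lemma locN x : loc x -> loc (- x).
Proof. by rewrite -mulN1r -(rmorph1 io) -rmorphN => xl; apply: locM => //; exact: loc_io. Qed.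
Lemma locB x y : loc x -> loc y -> loc (x - y).
Proof. by move=> xl yl; apply: locD => //; exact: locN. Qed.
Lemma loc_sum (I : Type) (s : seq I) (P : pred I) (f : I -> F) :
  (forall i, P i -> loc (f i)) -> loc (\sum_(i <- s | P i) f i).
Proof. by move=> fl; elim/big_ind: _ => //; [exact: loc0 | exact: locD]. Qed.

Variable N : nat.
Definition tloc (x : tps N F) : Prop := forall m, loc (x m).

Lemma tlocM x y : tloc x -> tloc y -> tloc (x * y).
Proof.
move=> xl yl m; case: (leqP m N) => [le|lt]; last by rewrite tps_big //; exact: loc0.
by rewrite tps_coefM //; apply: loc_sum => i _; apply: locM.
Qed.
Lemma tlocD x y : tloc x -> tloc y -> tloc (x + y).
Proof. by move=> xl yl m; rewrite tps_coefD; apply: locD. Qed.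
Lemma tlocC c : loc c -> tloc (tpsC N c).
Proof. by move=> cl m; rewrite tps_coefC; case: ifP => // _; exact: loc0. Qed.
Lemma tlocX : tloc (tpsX N F).
Proof.
move=> m; case: (leqP m N) => [le|lt]; last by rewrite tps_big //; exact: loc0.
by rewrite tps_ofE // coef_FPS; case: (m == 1%N); [exact: loc1 | exact: loc0].
Qed.
Lemma tloc1 : tloc 1.
Proof. by move=> m; rewrite tps_coef1; case: (m == 0%N); [exact: loc1 | exact: loc0]. Qed.
Lemma tlocXn x k : tloc x -> tloc (x ^+ k).
Proof.
move=> xl; elim: k => [|k IH]; first by rewrite expr0; exact: tloc1.
by rewrite exprS; exact: tlocM.
Qed.
Lemma tloc_prod (I : Type) (s : seq I) (P : pred I) (f : I -> tps N F) :
  (forall i, P i -> tloc (f i)) -> tloc (\prod_(i <- s | P i) f i).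
Proof. by move=> fl; elim/big_ind: _ => //; [exact: tloc1 | exact: tlocM]. Qed.
Lemma tloc_map (x : tps N D) : tloc (tps_map io x).
Proof. by move=> m; rewrite tps_mapE; exact: loc_io. Qed.

Lemma tloc_div x y : tloc (x * y) -> tloc y -> loc (y 0%N)^-1 -> y 0%N != 0 -> tloc x.
Proof.
move=> xyl yl y0l y0 m; have [k] := ubnP m; elim: k m => // k IH m lem.
case: (leqP m N) => [le|lt]; last by rewrite tps_big //; exact: loc0.
have -> : x m = ((x * y) m - \sum_(i < m) x i * y (m - i)%N) * (y 0%N)^-1.
  by rewrite tps_coefM // big_ord_recr /= subnn [X in X - _]addrC addrK mulfK.
apply: locM => //; apply: locB => //; apply: loc_sum => i _; apply: locM => //.
by apply: IH; have := ltn_ord i; lia.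
Qed.
End Localization.

Lemma tps_unit (F : fieldType) N (x : tps N F) : x 0%N != 0 -> exists y, x * y = 1.
Proof.
move=> x0; pose e := tpsC N (x 0%N) - x.
have [e' eE] : exists e', e = tpsX N F * e'.
  by apply: tps_const_div; rewrite /tps_const tps_coefB tps_coefC subrr.
have eN : e ^+ N.+1 = 0 by rewrite eE exprMn tpsX_nilp // mul0r.
exists ((\sum_(i < N.+1) tpsC N (x 0%N) ^+ (N.+1.-1 - i) * e ^+ i) * tpsC N (x 0%N ^- N.+1)).
have xE : x = tpsC N (x 0%N) - e by rewrite opprB addrC subrK.
rewrite mulrA {1}xE -(subrXX_comm _ (mulrC _ e)) eN subr0 -rmorphXn -rmorphM /=.
by rewrite divff ?rmorph1 // expf_neq0.
Qed.

Lemma tps_mulI (F : fieldType) N (x y z : tps N F) :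
  x 0%N != 0 -> x * y = x * z -> y = z.
Proof.
move=> /tps_unit[u xu] e; rewrite -[y]mul1r -[z]mul1r -xu.
by rewrite [x * u]mulrC -!mulrA e.
Qed.

Section Shift.
Variable R : idomainType.
Local Notation F := {fraction {poly R}}.
Local Notation io := (@FracField.tofrac {poly R}).

Lemma Xplus_comp (a b : int) : Xplus R a \Po Xplus R b = Xplus R (a + b).
Proof.
rewrite /Xplus comp_polyD comp_polyX comp_polyC rmorphD /= polyCD.
by rewrite addrAC addrA.
Qed.
Lemma Xplus0 : Xplus R 0 = 'X.
Proof. by rewrite /Xplus mulr0z addr0. Qed.
Lemma comp_Xplus_inj (a : int) : injective (comp_poly (Xplus R a)).
Proof.
move=> p q /= e; rewrite -[p]comp_polyXr -[q]comp_polyXr -Xplus0 -(subrr (- a)) opprK.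
by rewrite [- a + a]addrC -Xplus_comp !comp_polyA e.
Qed.

Lemma shift_frac_exists (a : int) : exists g : {rmorphism F -> F},
  forall p, g (io p) = io (p \Po Xplus R a).
Proof.
pose f : {rmorphism {poly R} -> F} := io \o comp_poly (Xplus R a).
have [|g gP] := @frac_lift _ _ f.
  by move=> p q /eqP; rewrite /= tofrac_eq => /eqP; exact: comp_Xplus_inj.
by exists g.
Qed.
Definition sh (a : int) : {rmorphism F -> F} := projT1 (cid (shift_frac_exists a)).
Lemma sh_io a p : sh a (io p) = io (p \Po Xplus R a).
Proof. by rewrite /sh; case: (cid _). Qed.
Lemma sh_frac a n d : sh a (io n / io d) = io (n \Po Xplus R a) / io (d \Po Xplus R a).
Proof. by rewrite rmorphM fmorphV !sh_io. Qed.
Lemma shD a b x : sh a (sh b x) = sh (a + b) x.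
Proof.
have [n [d [_ ->]]] := frac_elt x.
by rewrite !sh_frac -!comp_polyA Xplus_comp [b + a]addrC.
Qed.
Lemma sh0 x : sh 0 x = x.
Proof. by have [n [d [_ ->]]] := frac_elt x; rewrite sh_frac Xplus0 !comp_polyXr. Qed.
End Shift.

Section Classes.
Variable R : idomainType.
Hypothesis charR : [pchar R] =i pred0.
Variables (l : nat) (s : 'I_l -> R).
Hypothesis s_inj : forall i i', i != i' -> ~ int_diff (s i) (s i').
Local Notation F := {fraction {poly R}}.
Local Notation io := (@FracField.tofrac {poly R}).

Let intr0 (z : int) : (z%:~R == 0 :> R) = (z == 0).
Proof.
have natr0 n : (n%:R == 0 :> R) = (n == 0%N) by move/pcharf0P: charR => ->.
case: z => n; first exact: natr0.
by rewrite NegzE mulrNz !oppr_eq0; exact: natr0.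
Qed.

Definition pole (ia : 'I_l * int) : R := s ia.1 + ia.2%:~R.
Definition linprod (L : seq ('I_l * int)) : {poly R} := \prod_(ia <- L) ('X - (pole ia)%:P).

Definition denV (d : {poly R}) := exists k L, k != 0 /\ d = k *: linprod L.
Definition denC (d : {poly R}) := exists k : R, k != 0 /\ d = k%:P.
Definition denI i (d : {poly R}) := exists k e, k != 0 /\ d = k *: ('X - (s i)%:P) ^+ e.
Definition denR i (d : {poly R}) := d.[s i] != 0.

Lemma scalep_neq0 (k : R) (p : {poly R}) : k != 0 -> p != 0 -> k *: p != 0.
Proof. by move=> k0 p0; rewrite -mul_polyC mulf_neq0 // polyC_eq0. Qed.

Lemma linprod_neq0 L : linprod L != 0.
Proof. by apply: monic_neq0; apply: monic_prod => ia _; exact: monicXsubC. Qed.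
Lemma denV1 : denV 1.
Proof. by exists 1, [::]; rewrite oner_eq0 /linprod big_nil scale1r. Qed.
Lemma denVM d d' : denV d -> denV d' -> denV (d * d').
Proof.
move=> [k [L [k0 ->]]] [k' [L' [k'0 ->]]]; exists (k * k'), (L ++ L').
by rewrite mulf_neq0 // /linprod big_cat -scalerAl -scalerAr scalerA.
Qed.
Lemma denV_neq0 d : denV d -> d != 0.
Proof. by move=> [k [L [k0 ->]]]; rewrite scalep_neq0 // linprod_neq0. Qed.
Lemma denC1 : denC 1. Proof. by exists 1; rewrite oner_eq0. Qed.
Lemma denCM d d' : denC d -> denC d' -> denC (d * d').
Proof. by move=> [k [k0 ->]] [k' [k'0 ->]]; exists (k * k'); rewrite mulf_neq0 // polyCM. Qed.
Lemma denC_neq0 d : denC d -> d != 0.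
Proof. by move=> [k [k0 ->]]; rewrite polyC_eq0. Qed.
Lemma denI1 i : denI i 1. Proof. by exists 1, 0%N; rewrite oner_eq0 scale1r. Qed.
Lemma denIM i d d' : denI i d -> denI i d' -> denI i (d * d').
Proof.
move=> [k [e [k0 ->]]] [k' [e' [k'0 ->]]]; exists (k * k'), (e + e')%N.
by rewrite mulf_neq0 // -scalerAl -scalerAr scalerA exprD.
Qed.
Lemma denI_neq0 i d : denI i d -> d != 0.
Proof.
move=> [k [e [k0 ->]]]; rewrite scalep_neq0 //.
by rewrite expf_neq0 // polyXsubC_eq0.
Qed.
Lemma denR1 i : denR i 1. Proof. by rewrite /denR hornerC oner_eq0. Qed.
Lemma denRM i d d' : denR i d -> denR i d' -> denR i (d * d').
Proof. by rewrite /denR hornerM => *; exact: mulf_neq0. Qed.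
Lemma denR_neq0 i d : denR i d -> d != 0.
Proof. by apply: contraNneq => ->; rewrite horner0. Qed.

Local Notation V := (loc denV).
Local Notation Reg i := (loc (denR i)).
Local Notation VI i := (loc (denI i)).
Local Notation VC := (loc denC).

Lemma loc_sub (D : idomainType) (d1 d2 : D -> Prop) x :
  (forall d, d1 d -> d2 d) -> loc d1 x -> loc d2 x.
Proof. by move=> sub [n [d [/sub dd ->]]]; exists n, d. Qed.

Lemma denC_I i d : denC d -> denI i d.
Proof. by move=> [k [k0 ->]]; exists k, 0%N; rewrite alg_polyC. Qed.
Lemma denC_V d : denC d -> denV d.
Proof. by move=> [k [k0 ->]]; exists k, [::]; rewrite /linprod big_nil alg_polyC. Qed.
Lemma denC_R i d : denC d -> denR i d.
Proof. by move=> [k [k0 ->]]; rewrite /denR hornerC. Qed.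

Lemma linprod_shift a L :
  linprod L \Po Xplus R a = linprod [seq (ia.1, ia.2 - a) | ia <- L].
Proof.
rewrite /linprod rmorph_prod big_map; apply: eq_bigr => -[i b] _ /=.
rewrite comp_polyB comp_polyX comp_polyC /Xplus /pole /=.
by rewrite intrB !polyCD polyCN; ring.
Qed.
Lemma denV_shift a d : denV d -> denV (d \Po Xplus R a).
Proof.
move=> [k [L [k0 ->]]]; rewrite comp_polyZ linprod_shift.
by exists k; eexists; split; first by [].
Qed.
Lemma V_shift a x : V x -> V (sh R a x).
Proof.
move=> [n [d [dd ->]]]; rewrite sh_frac; do 2!eexists; split; last by [].
exact: denV_shift.
Qed.

Lemma pole_neq i j (a : int) : (i, 0) != (j, a) -> s i - s j - a%:~R != 0.
Proof.
move=> ne; case: (eqVneq i j) => [ij|nij].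
  rewrite ij subrr sub0r oppr_eq0 intr0; apply: contraNneq ne => ->.
  by rewrite ij.
apply/eqP => e; apply: (s_inj nij); exists a; apply/eqP.
by rewrite -subr_eq0 e.
Qed.

(* Far shifts move all the poles away from [s i]. *)
Lemma V_shift_reg x : V x -> exists B : nat, forall i (a : int), (B < `|a|)%N ->
  Reg i (sh R a x).
Proof.
move=> [n [d [[k [L [k0 ->]]] ->]]].
exists (\max_(ia <- L) `|ia.2|%N) => i a lt; rewrite sh_frac.
do 2!eexists; split; last by [].
rewrite /denR comp_polyZ linprod_shift hornerZ mulf_neq0 //.
rewrite /linprod horner_prod prodf_seq_neq0; apply/allP => ib /mapP[[j c] jc ->].
rewrite /= /pole hornerXsubC /= opprD addrA.
apply: (@pole_neq i j (c - a)); apply: contraTneq lt => -[_ e].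
rewrite -leqNgt (big_rem _ jc) /=; have -> : a = c by lia.
exact: leq_maxl.
Qed.

Lemma V_shift_reg_seq n (x : 'I_n -> F) : (forall k, V (x k)) -> exists B : nat,
  forall i k (a : int), (B < `|a|)%N -> Reg i (sh R a (x k)).
Proof.
move=> xV; have /choice[B BP] k := V_shift_reg (xV k).
exists (\max_k B k) => i k a lt; apply: BP; apply: leq_ltn_trans lt.
exact: leq_bigmax.
Qed.

Definition coboundary x := exists H, V H /\ x = sh R 1 H - H.

Lemma cobD x y : coboundary x -> coboundary y -> coboundary (x + y).
Proof.
move=> [H [HV ->]] [H' [HV' ->]]; exists (H + H'); split.
  exact: (locD denVM denV_neq0).
by rewrite rmorphD; ring.
Qed.
Lemma cobN x : coboundary x -> coboundary (- x).
Proof.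
move=> [H [HV ->]]; exists (- H); split; first exact: (locN denV1 denVM).
by rewrite rmorphN; ring.
Qed.

Lemma cob_shift_nat x (n : nat) : V x -> coboundary (sh R n%:Z x - x).
Proof.
move=> xV; elim: n => [|n IH].
  by exists 0; split; [exact: (loc0 denV1) | rewrite sh0 rmorph0 subrr subr0].
have -> : sh R n.+1%:Z x - x = (sh R n.+1%:Z x - sh R n%:Z x) + (sh R n%:Z x - x) by ring.
apply: cobD => //; exists (sh R n%:Z x); split; first exact: V_shift.
by rewrite shD intS.
Qed.
Lemma cob_shift x (a : int) : V x -> coboundary (sh R a x - x).
Proof.
case: a => n xV; first exact: cob_shift_nat.
have := cobN (cob_shift_nat n.+1 (V_shift (Negz n) xV)).
rewrite shD NegzE subrr sh0 opprB //.
Qed.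

(** The difference operator sends X^(h+1) to a polynomial with leading term (h+1) X^h, so in
    characteristic zero every polynomial is reached by induction on the degree, up to a constant
    denominator. *)
Lemma cob_poly x : VC x -> coboundary x.
Proof.
move=> [n [d [[k [k0 ->]] ->]]].
suff [m [k' [k'0 e]]] : exists m k', k' != 0 /\ k' *: n = (m \Po Xplus R 1) - m.
  exists (io m / io (k * k')%:P); split.
    by exists m, (k * k')%:P; split=> //; apply: denC_V; exists (k * k'); rewrite mulf_neq0.
  rewrite sh_frac comp_polyC -mulrBl -rmorphB -e -mul_polyC polyCM.
  by rewrite [k'%:P * n]mulrC !rmorphM invfM mulrA mulrAC -!mulrA mulVKf ?tofrac_eq0 ?polyC_eq0 // mulrC.
have [j] := ubnP (size n); elim: j n => // j IH n; rewrite ltnS => sn.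
case: (eqVneq n 0) => [->|n0].
  by exists 0, 1; rewrite oner_eq0 scaler0 comp_poly0 subrr.
pose h := (size n).-1; pose c := lead_coef n.
have snh : size n = h.+1 by rewrite /h prednK // size_poly_gt0.
pose dl (p : {poly R}) := p \Po Xplus R 1 - p.
have binX m : 'X^m \Po Xplus R 1 = \poly_(i < m.+1) ('C(m, i))%:R.
  rewrite comp_Xn_poly /Xplus mulr1z addrC exprDn poly_def; apply: eq_bigr => i _.
  by rewrite polyC1 expr1n mul1r scaler_nat.
have dlZ a p : dl (a *: p) = a *: dl p by rewrite /dl comp_polyZ scalerBr.
have dlD p q : dl (p + q) = dl p + dl q by rewrite /dl comp_polyD opprD addrACA.
(* Cross multiplication by h+1 and the leading coefficient removes the top term without division. *)
pose n1 := h.+1%:R *: n - c *: dl 'X^(h.+1).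
have sn1 : (size n1 <= h)%N.
  apply/leq_sizeP => i hi; rewrite coefB !coefZ /dl binX coefB coef_poly coefXn.
  move: hi; rewrite leq_eqVlt => /orP[/eqP <-|hi].
    have -> : 'C(h.+1, h) = h.+1 by rewrite -[h in 'C(_, h)]/(h.+1.-1) -subn1 bin_sub // bin1.
    by rewrite ltnW // ltn_eqF // subr0 /c lead_coefE -/h mulrC subrr.
  rewrite nth_default ?snh // mulr0 sub0r.
  move: hi; rewrite leq_eqVlt => /orP[/eqP <-|hi].
    by rewrite ltnSn binn eqxx subrr mulr0 oppr0.
  by rewrite [(i < _)%N]ltnNge hi /= gtn_eqF // subrr mulr0 oppr0.
have [|m [k' [k'0 e]]] := IH n1; first by apply: leq_ltn_trans sn1 _; rewrite -snh.
exists (m + (k' * c) *: 'X^(h.+1)), (k' * h.+1%:R); split.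
  by rewrite mulf_neq0 // -[h.+1%:R]/(h.+1%:~R) intr0.
rewrite -/(dl _) dlD dlZ -[dl m]e /n1 scalerBr !scalerA subrK //.
Qed.

Definition decomposable x := exists y z (w : 'I_l -> F),
  [/\ coboundary y, VC z, forall i, VI i (w i) & x = y + z + \sum_i w i].

Lemma decompD x x' : decomposable x -> decomposable x' -> decomposable (x + x').
Proof.
move=> [y [z [w [yc zc wI ->]]]] [y' [z' [w' [yc' zc' wI' ->]]]].
exists (y + y'), (z + z'), (fun i => w i + w' i); split.
- exact: cobD.
- exact: (locD denCM denC_neq0).
- by move=> i; apply: (locD (@denIM i) (@denI_neq0 i)).
- by rewrite big_split /=; ring.
Qed.

Lemma split_frac (G : fieldType) (n k a b u : G) :
  k != 0 -> b - a != 0 -> a != 0 -> b != 0 -> u != 0 ->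
  n / (k * (a * (b * u))) = n / (k * (b - a) * (a * u)) + - n / (k * (b - a) * (b * u)).
Proof. by move=> k0 ab a0 b0 u0; field; rewrite ?k0 ?ab ?a0 ?b0 ?u0. Qed.

(** Two distinct poles are separated by 1/(ab) = (1/a - 1/b)/(b - a), which shortens the
    denominator. A single multiple pole s_i + a is translated to s_i, at the cost of a
    coboundary. *)
Lemma partial_fractions x : V x -> decomposable x.
Proof.
move=> [n [d [[k [L [k0 ->]]] ->]]].
have [m] := ubnP (size L); elim: m L k n k0 => // m IH L k n k0 szL.
have cob0 : coboundary 0.
  by exists 0; split; [exact: (loc0 denV1) | rewrite rmorph0 subrr].
case: (pselect (exists ia jb L', perm_eq L [:: ia, jb & L'] /\ pole ia != pole jb)).
  move=> [ia [jb [L' [pe ne]]]].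
  have ab0 : pole ia - pole jb != 0 by rewrite subr_eq0.
  have linE u : linprod (u :: L') = ('X - (pole u)%:P) * linprod L' by rewrite /linprod big_cons.
  have -> : linprod L = ('X - (pole ia)%:P) * (('X - (pole jb)%:P) * linprod L').
    by rewrite /linprod (perm_big _ pe) !big_cons.
  have kk : k * (pole ia - pole jb) != 0 by rewrite mulf_neq0.
  have sz2 : (size (ia :: L') < m)%N by have := perm_size pe; rewrite /= in szL *; lia.
  have -> : io n / io (k *: (('X - (pole ia)%:P) * (('X - (pole jb)%:P) * linprod L'))) =
      io n / io ((k * (pole ia - pole jb)) *: linprod (ia :: L')) +
      io (- n) / io ((k * (pole ia - pole jb)) *: linprod (jb :: L')).
    have xi0 u : io ('X - (pole u)%:P) != 0 by rewrite tofrac_eq0 polyXsubC_eq0.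
    have l0 : io (linprod L') != 0 by rewrite tofrac_eq0 linprod_neq0.
    have c0 (c : R) : c != 0 -> io c%:P != 0 by rewrite tofrac_eq0 polyC_eq0.
    rewrite !linE -!mul_polyC !rmorphM rmorphN /=.
    have e : io (pole ia - pole jb)%:P = io ('X - (pole jb)%:P) - io ('X - (pole ia)%:P).
      by rewrite -rmorphB; congr io; rewrite polyCB; ring.
    rewrite e.
    have ba0 : io ('X - (pole jb)%:P) - io ('X - (pole ia)%:P) != 0.
      by rewrite -e; exact: c0.
    have := split_frac (io n) (c0 _ k0) ba0 (xi0 ia) (xi0 jb) l0.
    exact.
  by apply: decompD; apply: IH.
move=> same; case: L szL same => [|[i a] L] szL same.
  exists 0, (io n / io (k *: linprod [::])), (fun=> 0); split=> //.
  - by exists n, (k *: linprod [::]); split=> //; exists k; rewrite /linprod big_nil alg_polyC.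
  - by move=> i; exact: (loc0 (@denI1 i)).
  - by rewrite big1 // add0r addr0.
have sameP u : u \in L -> pole u = pole (i, a).
  move=> uL; apply/eqP/negPn/negP => ne; apply: same; exists (i, a), u, (rem u L).
  by rewrite perm_cons perm_to_rem // eq_sym.
have LE : linprod ((i, a) :: L) = ('X - (pole (i, a))%:P) ^+ (size L).+1.
  rewrite /linprod big_cons exprS; congr (_ * _).
  rewrite (eq_big_seq (fun=> 'X - (pole (i, a))%:P)) => [|u /sameP-> //].
  by rewrite big_const_seq count_predT iter_mulr_1.
set u := (X in decomposable X).
have uV : V u by exists n, (k *: linprod ((i, a) :: L)); split=> //; exists k, ((i, a) :: L).
exists (u - sh R a u), 0, (fun j => if j == i then sh R a u else 0); split.
- by rewrite -opprB; apply: cobN; exact: cob_shift.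
- exact: (loc0 denC1).
- move=> j; case: eqP => [->|_]; last exact: (loc0 (@denI1 j)).
  rewrite /u sh_frac LE comp_polyZ rmorphXn /=; do 2!eexists; split; last by [].
  exists k, (size L).+1; split=> //; congr (_ *: _ ^+ _).
  by rewrite comp_polyB comp_polyX comp_polyC /Xplus /pole /= polyCD; ring.
- by rewrite -big_mkcond big_pred1_eq addr0 subrK.
Qed.

Lemma VI_Reg_VC i x : VI i x -> Reg i x -> VC x.
Proof.
move=> [n [d [[k [e [k0 ->]]] ->]]] [n' [d' [dr]]].
have d'0 := denR_neq0 dr.
have Xs0 : 'X - (s i)%:P != 0 by rewrite polyXsubC_eq0.
elim: e n => [|e IH] n E.
  by exists n, k%:P; split; [exists k | rewrite expr0 alg_polyC].
have cross : n * d' = n' * (k *: ('X - (s i)%:P) ^+ e.+1).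
  apply/eqP; rewrite -tofrac_eq !rmorphM /= -eqr_div ?E //.
    by rewrite tofrac_eq0 scalep_neq0 // expf_neq0.
  by rewrite tofrac_eq0.
have /factor_theorem[m mE] : root n (s i).
  have := congr1 (fun p => p.[s i]) cross; rewrite !hornerM hornerZ exprS hornerM hornerXsubC subrr.
  by rewrite mul0r !mulr0 => /eqP; rewrite mulf_eq0 (negPf dr) orbF.
have mE' : io n / io (k *: ('X - (s i)%:P) ^+ e.+1) = io m / io (k *: ('X - (s i)%:P) ^+ e).
  apply/eqP; rewrite eqr_div ?tofrac_eq0 ?scalep_neq0 ?expf_neq0 // -!rmorphM mE exprS; apply/eqP; congr io.
  by rewrite -!mul_polyC; ring.
by rewrite mE'; apply: IH; rewrite -mE'.
Qed.

Lemma sum_sh_coboundary H (A : nat) :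
  \sum_(k < (2 * A).+1) sh R (k%:Z - A%:Z) (sh R 1 H - H) = sh R A.+1%:Z H - sh R (- A%:Z) H.
Proof.
rewrite -(big_mkord predT (fun k : nat => sh R (k%:Z - A%:Z) (sh R 1 H - H))).
rewrite (eq_big_nat _ _ (F2 := fun k => sh R (k.+1%:Z - A%:Z) H - sh R (k%:Z - A%:Z) H)).
  rewrite telescope_sumr //; congr (sh _ _ _ - sh _ _ _); lia.
by move=> k _; rewrite rmorphB shD; congr (sh _ _ _ - _); lia.
Qed.

(** In a long symmetric sum of translates the coboundary part telescopes to terms with poles far
    from s_i, while the polar part at s_i stays there only in the untranslated term. Regularity of
    the sum therefore makes every polar part polynomial, and polynomials are coboundaries. *)
Lemma coboundary_of_regular x : V x ->
  (forall i, exists A0, forall A, (A0 <= A)%N ->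
     Reg i (\sum_(k < (2 * A).+1) sh R (k%:Z - A%:Z) x)) -> coboundary x.
Proof.
move=> xV reg; have [y [z [w [yc zc wI xE]]]] := partial_fractions xV.
have RD i u v : Reg i u -> Reg i v -> Reg i (u + v) by exact: (locD (@denRM i) (@denR_neq0 i)).
have RN i u : Reg i u -> Reg i (- u) by exact: (locN (@denR1 i) (@denRM i)).
have Rsum i (J : finType) (P : pred J) (f : J -> F) : (forall j, P j -> Reg i (f j)) -> Reg i (\sum_(j | P j) f j).
  by move=> fP; apply: big_ind => //; [exact: (loc0 (@denR1 i)) | exact: (RD)].
have VCR i u : VC u -> Reg i u by apply: loc_sub => d; exact: denC_R.
have VCsh a u : VC u -> VC (sh R a u).
  move=> [n [d [[k [k0 ->]] ->]]]; rewrite sh_frac comp_polyC.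
  by do 2!eexists; split; last by []; exists k.
have wC i : VC (w i).
  apply: (@VI_Reg_VC i) => //; have [A0 A0P] := reg i.
  have [H [HV yE]] := yc.
  have [B BP] := V_shift_reg HV.
  have shw j (a : int) : (j, a) != (i, 0) -> Reg i (sh R a (w j)).
    move=> ne; have [n [d [[k [e [k0 ->]]] ->]]] := wI j.
    rewrite sh_frac; do 2!eexists; split; last by [].
    rewrite /denR comp_polyZ rmorphXn /= hornerZ horner_exp mulf_neq0 // expf_neq0 //.
    rewrite comp_polyB comp_polyX comp_polyC /Xplus !hornerE.
    have := @pole_neq i j (- a); rewrite mulrNz opprK addrAC; apply.
    by apply: contraNneq ne => -[<- e0]; rewrite xpair_eqE eqxx -oppr_eq0 -e0.
  pose A := (A0 + B.+1)%N.
  have := A0P A (leq_addr _ _); set S := (\sum_(_ < _) _) => SR.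
  have SE : S = (sh R A.+1%:Z H - sh R (- A%:Z) H) + \sum_(k < (2 * A).+1) sh R (k%:Z - A%:Z) z
     + \sum_j \sum_(k < (2 * A).+1) sh R (k%:Z - A%:Z) (w j).
    rewrite -sum_sh_coboundary -yE exchange_big /= -!big_split /=; apply: eq_bigr => k _.
    by rewrite xE !rmorphD rmorph_sum.
  have A_lt : (A < (2 * A).+1)%N by lia.
  (* The index k = A is the zero translation; every term moved to the other side is regular at
     s_i. *)
  have wE : w i = S - ((sh R A.+1%:Z H - sh R (- A%:Z) H) + \sum_(k < (2 * A).+1) sh R (k%:Z - A%:Z) z
     + \sum_(j | j != i) \sum_(k < (2 * A).+1) sh R (k%:Z - A%:Z) (w j)
     + \sum_(k < (2 * A).+1 | k != Ordinal A_lt) sh R (k%:Z - A%:Z) (w i)).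
    have -> : S = sh R A.+1%:Z H - sh R (- A%:Z) H + \sum_(k < (2 * A).+1) sh R (k%:Z - A%:Z) z
      + (w i + \sum_(k < (2 * A).+1 | k != Ordinal A_lt) sh R (k%:Z - A%:Z) (w i)
      + \sum_(j | j != i) \sum_(k < (2 * A).+1) sh R (k%:Z - A%:Z) (w j)).
      rewrite SE (bigD1 i) //=.
      by congr (_ + (_ + _)); rewrite (bigD1 (Ordinal A_lt)) //= subrr sh0.
    set a1 := \sum_(_ < _) _; set a2 := \sum_(_ < _ | _) _; set a3 := \sum_(_ | _) _.
    by ring.
  rewrite wE; apply: (RD) => //; apply: (RN); apply: (RD); first apply: (RD); first apply: (RD).
  - apply: (RD); first by apply: BP; rewrite /A; lia.
    by apply: (RN); apply: BP; rewrite /A; lia.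
  - by apply: (Rsum) => k _; apply: (VCR); apply: (VCsh).
  - by apply: (Rsum) => j ji; apply: (Rsum) => k _; apply: (shw); rewrite xpair_eqE (negPf ji).
  - apply: (Rsum) => k kA; apply: (shw); rewrite xpair_eqE eqxx /= subr_eq0.
    by apply: contraNneq kA => -[e]; apply/eqP/val_inj.
rewrite xE; apply: cobD; first apply: cobD => //; first exact: cob_poly.
apply: cob_poly; apply: big_ind => //; first exact: (loc0 denC1).
exact: (locD denCM denC_neq0).
Qed.
End Classes.

(** * Multiplicative coboundaries modulo a power of t *)

Section MultiplicativeCoboundary.
Variable R : idomainType.
Hypothesis charR : [pchar R] =i pred0.
Variables (l : nat) (s : 'I_l -> R).
Hypothesis s_inj : forall i i', i != i' -> ~ int_diff (s i) (s i').
Variable N : nat.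
Local Notation F := {fraction {poly R}}.
Local Notation io := (@FracField.tofrac {poly R}).
Definition tsh (a : int) := @tps_map N _ _ (sh R a).
HB.instance Definition _ a := GRing.RMorphism.on (tsh a).
Arguments tsh : simpl never.

Lemma tshE a x m : tsh a x m = sh R a (x m). Proof. exact: tps_mapE. Qed.
Lemma tshD a b x : tsh a (tsh b x) = tsh (a + b) x.
Proof. by apply: tpsP => m _; rewrite !tshE shD. Qed.
Lemma tsh0 x : tsh 0 x = x.
Proof. by apply: tpsP => m _; rewrite tshE sh0. Qed.
Lemma tsh_X a : tsh a (tpsX N F) = tpsX N F. Proof. exact: tps_mapX. Qed.

Lemma tsh_reg (x : tps N F) : tloc (denV s) x -> exists B : nat, forall i (a : int),
  (B < `|a|)%N -> tloc (denR s i) (tsh a x).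
Proof.
move=> xV; have [B BP] := @V_shift_reg_seq _ charR _ _ s_inj N.+1 (fun k => x k) (fun k => xV k).
exists B => i a lt m; rewrite tshE; case: (leqP m N) => [le|lt'].
  exact: (BP i (Ordinal (le : (m < N.+1)%N))).
by rewrite tps_big // rmorph0; exact: (loc0 (denR1 s i)).
Qed.

(** Successive approximation in t. If f g = g(c+1) + t^j y, the regularity of long products of f
    makes the constant term of y an additive coboundary H(c+1) - H(c), and g + t^j H satisfies the
    equation to one more order. *)
Lemma mult_coboundary (f : tps N F) : f 0%N = 1 -> tloc (denV s) f ->
  (forall i, exists A0, forall A, (A0 <= A)%N ->
     tloc (denR s i) (\prod_(k < (2 * A).+1) tsh (k%:Z - A%:Z) f)) ->
  exists g : tps N F, [/\ g 0%N = 1, tloc (denV s) g & f * g = tsh 1 g].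
Proof.
move=> f0 fV freg.
suff [g [g0 gV gE]] : exists g : tps N F, [/\ g 0%N = 1, tloc (denV s) g &
    forall m, (m < N.+1)%N -> (f * g) m = tsh 1 g m].
  by exists g; split=> //; apply: tpsP => m le; apply: gE.
have := leqnn N.+1; elim: {1 3}N.+1 => [|j IH] lej.
  by exists 1; rewrite tps_coef1 /=; split=> //; exact: (tloc1 (denV1 s)).
have [g [g0 gV gE]] := IH (ltnW lej).
case: j => [|j] in lej gE IH *.
  exists g; split=> // -[|//] _.
  by rewrite tps_coef0M f0 g0 tshE g0 rmorph1 mulr1.
set j' := j.+1 in lej gE *.
have [y yE] : exists y, f * g - tsh 1 g = tpsX N F ^+ j' * y.
  by apply: tps_divX => m lt; rewrite tps_coefB gE // subrr.
have {}yE : f * g = tsh 1 g + tpsX N F ^+ j' * y by rewrite -yE addrC subrK.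
have jN : (j' <= N)%N by [].
have Xj (z : tps N F) m : (m < j')%N -> (tpsX N F ^+ j' * z) m = 0.
  by move=> lt; rewrite tps_coefXnM ?ifN // -?ltnNge // (leq_trans (ltnW lt)).
have Xjj (z : tps N F) : (tpsX N F ^+ j' * z) j' = z 0%N.
  by rewrite tps_coefXnM // leqnn subnn.
have yV : loc (denV s) (y 0%N).
  rewrite -(Xjj y) -[_ * y](addrK (tsh 1 g)) [_ + tsh 1 g]addrC -yE tps_coefB tshE.
  apply: (locB (denV1 s) (@denVM _ _ s) (@denV_neq0 _ _ s)).
    exact: (tlocM (@denV1 _ _ s) (@denVM _ _ s) (@denV_neq0 _ _ s) fV gV).
  exact: V_shift.
(* Multiplying the approximate equation over consecutive translates, the leading errors add up. *)
have claim (lo : int) n : exists z,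
    \prod_(k < n) tsh (lo + k%:Z) f * tsh lo g = tsh (lo + n%:Z) g + tpsX N F ^+ j' * z
    /\ z 0%N = \sum_(k < n) sh R (lo + k%:Z) (y 0%N).
  elim: n => [|n [z [zE z0]]].
    by exists 0; rewrite !big_ord0 mul1r addr0 mulr0 addr0 tps_coef0.
  exists (tsh (lo + n%:Z) y + tsh (lo + n%:Z) f * z); split; last first.
    by rewrite tps_coefD tps_coef0M !tshE f0 rmorph1 mul1r z0 big_ord_recr /= addrC.
  rewrite big_ord_recr /= mulrAC zE mulrDl -[_ * tsh _ f]rmorphM /= [g * f]mulrC yE.
  rewrite rmorphD rmorphM rmorphXn /= tsh_X tshD -addrA [_ + 1]addrC addrA.
  have -> : lo + n.+1%:Z = 1 + (lo + n%:Z) by rewrite intS addrCA.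
  by rewrite [1 + _]addrC; ring.
have [H [HV xH]] : coboundary s (y 0%N).
  apply: coboundary_of_regular => // i.
  have [A0 A0P] := freg i; have [B BP] := tsh_reg gV.
  exists (A0 + B.+1)%N => A leA.
  have [z [zE z0]] := claim (- A%:Z) (2 * A).+1.
  have -> : \sum_(k < (2 * A).+1) sh R (k%:Z - A%:Z) (y 0%N) =
      \sum_(k < (2 * A).+1) sh R (- A%:Z + k%:Z) (y 0%N).
    by apply: eq_bigr => k _; rewrite addrC.
  rewrite -z0 -(Xjj z) -[_ * z](addKr (tsh (- A%:Z + (2 * A).+1%:Z) g)) -zE.
  rewrite tps_coefD tps_coefN addrC.
  apply: (locB (denR1 s i) (@denRM _ _ s i) (@denR_neq0 _ _ s i)).
    apply: (tlocM (@denR1 _ _ s i) (@denRM _ _ s i) (@denR_neq0 _ _ s i)); last first.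
      by apply: BP; lia.
    under eq_bigr => k _ do rewrite addrC.
    by apply: A0P; lia.
  by apply: BP; lia.
exists (g + tpsX N F ^+ j' * tpsC N H); split.
- by rewrite tps_coefD Xj // addr0.
- apply: (tlocD (@denVM _ _ s) (@denV_neq0 _ _ s)) => //.
  apply: (tlocM (@denV1 _ _ s) (@denVM _ _ s) (@denV_neq0 _ _ s)).
    apply: (tlocXn (@denV1 _ _ s) (@denVM _ _ s) (@denV_neq0 _ _ s)).
    exact: (tlocX (@denV1 _ _ s)).
  exact: (tlocC (@denV1 _ _ s)).
- move=> m; rewrite mulrDr mulrCA rmorphD rmorphM rmorphXn /= tsh_X.
  rewrite !tps_coefD ltnS leq_eqVlt => /orP[/eqP ->|lt]; last by rewrite gE // !Xj.
  rewrite !Xjj tps_coef0M f0 mul1r [in RHS]tshE [in RHS]tshE !tps_coefC /= yE tps_coefD Xjj xH tshE.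
  by rewrite -addrA subrK.
Qed.
End MultiplicativeCoboundary.

(** * The comparison identity in characteristic zero *)

Lemma horner_morph_comp (A B : comNzRingType) (f : {rmorphism A -> B}) (p q : {poly A}) x :
  (map_poly f (p \Po q)).[x] = (map_poly f p).[(map_poly f q).[x]].
Proof. by rewrite map_comp_poly horner_comp. Qed.

Section Swap.
Variables (N : nat) (R : comNzRingType).
Local Notation T := (tps N R).

(** Exchanges the two variables: polynomials in X over truncated series become truncated series over
    [{poly R}]. *)
Definition swap (p : {poly T}) : tps N {poly R} :=
  (map_poly (@tps_map N _ _ (@polyC R)) p).[tpsC N 'X].
Fact swap_is_zmod_morphism : zmod_morphism swap.
Proof. by move=> p q; rewrite /swap rmorphB hornerD hornerN. Qed.
Fact swap_is_monoid_morphism : monoid_morphism swap.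
Proof. by split=> [|p q]; rewrite /swap ?rmorph1 ?hornerC // rmorphM hornerM. Qed.
HB.instance Definition _ := GRing.isZmodMorphism.Build _ _ swap swap_is_zmod_morphism.
HB.instance Definition _ := GRing.isMonoidMorphism.Build _ _ swap swap_is_monoid_morphism.

Lemma swap_eval (B : comNzRingType) (f : {rmorphism {poly R} -> B}) (p : {poly T}) :
  tps_map f (swap p) = (map_poly (@tps_map N _ _ (f \o polyC)) p).[tpsC N (f 'X)].
Proof.
rewrite /swap -horner_map -map_poly_comp /= tps_mapC; congr _.[_].
by apply: eq_map_poly => x /=; apply: tpsP => m _; rewrite !tps_mapE.
Qed.

Lemma swap_comp p (c : R) :
  swap (p \Po ('X + (tpsC N c)%:P)) = tps_map (comp_poly ('X + c%:P)) (swap p).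
Proof.
rewrite swap_eval /swap horner_morph_comp rmorphD /= map_polyX map_polyC /= hornerD hornerX hornerC.
rewrite tps_mapC -rmorphD /= comp_polyX; congr (_.[_]).
by apply: eq_map_poly => x /=; apply: tpsP => m _; rewrite !tps_mapE /= comp_polyC.
Qed.

Lemma swap_Xplus p a : swap (p \Po Xplus T a) = tps_map (comp_poly (Xplus R a)) (swap p).
Proof. by rewrite [in RHS]/Xplus -swap_comp [tpsC _ _]rmorph_int. Qed.

Lemma swap_const p : swap p 0%N = map_poly (@tps_const N R) p.
Proof.
rewrite -[LHS]/(tps_const (swap p)) /swap -horner_map -map_poly_comp /=.
rewrite [tps_const _]tps_coefC /= -[RHS]comp_polyXr /comp_poly -map_poly_comp; congr _.[_].
Qed.
End Swap.

Lemma common_denominator (D : idomainType) N (den : D -> Prop) (g : tps N {fraction D}) :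
  (forall x, den x -> x != 0) -> tloc den g ->
  exists (e : D) (G : tps N D), e != 0 /\
    tpsC N (FracField.tofrac e) * g = tps_map (@FracField.tofrac D) G.
Proof.
move=> den0 gl; pose io := @FracField.tofrac D.
have /choice[n /choice[d nd]] : forall m, exists n d, den d /\ g m = io n / io d by exact: gl.
exists (\prod_(m < N.+1) d m), (tps_of N (FPS (fun m => n m * \prod_(k < N.+1 | k != m :> nat) d k))).
split; first by apply/prodf_neq0 => m _; apply: den0; case: (nd m).
apply: tpsP => m le; rewrite tps_coefCM tps_mapE tps_ofE // coef_FPS.
have [dm ->] := nd m.
rewrite (bigD1 (Ordinal (le : (m < N.+1)%N))) //= !rmorphM /= mulrC mulrA divfK //.
by rewrite tofrac_eq0 den0.
Qed.

Section CharZero.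
Variables (K : fieldType) (charK : [pchar K] =i pred0).
Variables (S : fieldType) (incl : {rmorphism K -> S}).
Variables (R : idomainType) (iota : {rmorphism R -> K}) (iota_inj : injective iota).
Variables (r : seq R) (Q : nat -> diffop R) (Q0 : Q 0%N = [fsfun]).
Variables (l : nat) (s : 'I_l -> R) (s_reps : smallest_reps r s).
Variables (L : 'I_l -> nat) (L_gt0 : forall i, (0 < L i)%N).
Variable lam : forall i : 'I_l, 'I_(class_mult r (s i)) -> fps S.
Hypothesis lam_exp : forall i,
  is_exponents incl iota (iota (s i)) r Q (L i) (@lam i).
Variable w : 'I_l -> {poly (fps K)}.
Hypothesis w_def : forall i, map_poly (fps_ramify incl (L i)) (w i) =
  \prod_(j < class_mult r (s i)) ('X - (@lam i j)%:P).
Variable N : nat.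
Variable wR : 'I_l -> {poly (fps R)}.
Hypothesis wR_lift : forall i a m, (m <= N)%N -> iota ((wR i)`_a m) = (w i)`_a m.
Local Notation T := (tps N R).
Local Notation F := {fraction {poly R}}.
Local Notation io := (@FracField.tofrac {poly R}).

Definition Wi (i : 'I_l) : {poly T} := wT N (wR i) \Po ('X + (tpsC N (- s i))%:P).
Definition Wprod : tps N {poly R} := \prod_i swap (Wi i).
Definition tsw (a : int) : tps N {poly R} -> tps N {poly R} :=
  tps_map (comp_poly (Xplus R a)).
HB.instance Definition _ a := GRing.RMorphism.on (tsw a).
Arguments tsw : simpl never.
Definition theta n := swap (Theta N r Q n).

Let charR : [pchar R] =i pred0.
Proof.
move=> q; rewrite -(charK q) !inE; congr (_ && _).
by rewrite -(rmorph_nat iota) -(rmorph0 iota) (inj_eq iota_inj).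
Qed.
Let s_inj : forall i i', i != i' -> ~ int_diff (s i) (s i').
Proof. by case: s_reps. Qed.

Local Notation tio := (@tps_map N _ _ io).
Lemma tsh_tio a x : tsh a (tio x) = tio (tsw a x).
Proof. by apply: tpsP => m _; rewrite tshE !tps_mapE sh_io. Qed.
Lemma tswD a b x : tsw a (tsw b x) = tsw (a + b) x.
Proof.
apply: (tps_map_inj (phi := io)); first by move=> u v /eqP; rewrite tofrac_eq => /eqP.
by rewrite -!tsh_tio tshD.
Qed.
Lemma tsw0 x : tsw 0 x = x.
Proof. by apply: tpsP => m _; rewrite tps_mapE /= Xplus0 comp_polyXr. Qed.
Lemma tsw_coef a x m : tsw a x m = x m \Po Xplus R a.
Proof. exact: tps_mapE. Qed.
Lemma theta_shift n a : tsw a (theta n) = swap (Theta N r Q n \Po Xplus T a).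
Proof. by rewrite swap_Xplus. Qed.
Lemma theta0 n : theta n 0%N = \prod_(j < n) (indicial r \Po Xplus R j).
Proof. by rewrite swap_const Theta_const. Qed.

Definition wi_const i : {poly R} := ('X - (s i)%:P) ^+ class_mult r (s i).

Let bandP := band_exists N Q.

Lemma swap_Wi_const i : swap (Wi i) 0%N = wi_const i.
Proof.
rewrite swap_comp tps_mapE swap_const.
rewrite (wT_const iota_inj (lam_exp i) (w_def i) (wR_lift i)).
by rewrite /= comp_Xn_poly polyCN.
Qed.

(** Moving a root s_i + n down to s_i is a multiplicative coboundary: with d the product of X - s_i
    - j for 1 <= j <= n, one has (X - s_i - n) d(X+1) = (X - s_i) d(X). *)
Lemma indicial_normalize : exists d, denV s d /\
  indicial r * (d \Po Xplus R 1) = (\prod_i wi_const i) * d.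
Proof.
rewrite /indicial /wi_const; have [_ _] := s_reps.
elim: r => [|z r' IH] rep.
  by exists 1; rewrite big_nil !mul1r big1 // mulr1 comp_polyC; split=> //; exact: denV1.
have [|d [dV dE]] := IH; first by move=> y yr; apply: rep; rewrite in_cons yr orbT.
have [i [n zE]] := rep z (mem_head _ _).
pose f m : {poly R} := \prod_(0 <= j < m) ('X - (s i + j.+1%:R)%:P).
exists (f n * d); split.
  apply: denVM => //; rewrite /f; elim: n {zE f} => [|n IHn]; first by rewrite big_nil; exact: denV1.
  rewrite big_nat_recr //=; apply: denVM => //.
  by exists 1, [:: (i, n.+1%:Z)]; rewrite oner_eq0 scale1r /linprod big_seq1 /pole.
have fE : ('X - z%:P) * (f n \Po Xplus R 1) = ('X - (s i)%:P) * f n.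
  rewrite zE /f rmorph_prod /=.
  have sE j : ('X - (s i + j.+1%:R)%:P) \Po Xplus R 1 = 'X - (s i + j%:R)%:P.
    rewrite comp_polyB comp_polyX comp_polyC /Xplus -[j.+1]addn1 natrD !polyCD; ring.
  rewrite (eq_bigr _ (fun j _ => sE j)).
  transitivity (\prod_(0 <= j < n.+1) ('X - (s i + j%:R)%:P)).
    by rewrite big_nat_recr //= mulrC.
  by rewrite big_nat_recl //= addr0.
have -> : \prod_j ('X - (s j)%:P) ^+ class_mult (z :: r') (s j) =
    ('X - (s i)%:P) * \prod_j ('X - (s j)%:P) ^+ class_mult r' (s j).
  have cE j : class_mult (z :: r') (s j) = ((j == i) + class_mult r' (s j))%N.
    rewrite /class_mult /=; congr (nat_of_bool _ + _)%N; apply/asboolP/eqP => [[m zm]|->]; last first.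
      by exists n; rewrite zE addrC addKr.
    apply/eqP/negPn/negP => /s_inj[]; exists (n%:Z - m).
    rewrite intrB -zm zE -[n%:~R]/(n%:R); ring.
  under eq_bigr => j _ do rewrite cE exprD.
  rewrite big_split /=; congr (_ * _).
  by rewrite (bigD1 i) //= eqxx expr1 big1 ?mulr1 // => j /negPf ->; rewrite expr0.
by rewrite big_cons comp_polyM mulrACA fE dE; ring.
Qed.

Lemma denV_unit_coef d : denV s d -> d != 0 /\ loc (denV s) (io d)^-1.
Proof. by move=> dV; split; [exact: (denV_neq0 dV) | exact: loc_inv]. Qed.

Lemma denV_prod (I : Type) (x : seq I) (f : I -> {poly R}) :
  (forall i, denV s (f i)) -> denV s (\prod_(i <- x) f i).
Proof. by move=> fV; apply: big_ind => //; [exact: denV1 | exact: denVM]. Qed.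

Lemma denV_Xs i : denV s ('X - (s i)%:P).
Proof.
by exists 1, [:: (i, 0)]; rewrite oner_eq0 scale1r /linprod big_seq1 /pole addr0.
Qed.

Lemma denV_wi : denV s (\prod_i wi_const i).
Proof.
apply: denV_prod => i; rewrite /wi_const; elim: (class_mult _ _) => [|e IH].
  exact: denV1.
by rewrite exprS; apply: denVM => //; exact: denV_Xs.
Qed.

Lemma denV_indicial : denV s (indicial r).
Proof.
rewrite /indicial; have [_ _] := s_reps; elim: r => [|z r' IH] rep.
  by rewrite big_nil; exact: denV1.
rewrite big_cons; apply: denVM; last first.
  by apply: IH => y yr; apply: rep; rewrite in_cons yr orbT.
have [i [n ->]] := rep z (mem_head _ _).
by exists 1, [:: (i, n%:Z)]; rewrite oner_eq0 scale1r /linprod big_seq1.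
Qed.

Lemma denV_theta0 n : denV s (theta n 0%N).
Proof. by rewrite theta0; apply: denV_prod => j; apply: denV_shift; exact: denV_indicial. Qed.

Lemma denV_shift_reg d : denV s d -> exists B : nat, forall i (a : int), (B < `|a|)%N ->
  denR s i (d \Po Xplus R a).
Proof.
move=> dV; have [_ dl] := denV_unit_coef dV.
have [B BP] := V_shift_reg charR s_inj dl; exists B => i a lt.
have [n [d' [dr]]] := BP i a lt.
rewrite fmorphV sh_io => /(congr1 (fun x => x * (io d' * io (d \Po Xplus R a)))).
rewrite [in RHS]mulrA divfK ?tofrac_eq0 ?(denR_neq0 dr) // mulrCA mulVf ?mulr1; last first.
  by rewrite tofrac_eq0; apply: (@denV_neq0 _ _ s); exact: denV_shift.
rewrite -rmorphM => /eqP; rewrite tofrac_eq => /eqP E.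
by move: dr; rewrite /denR E hornerM mulf_eq0 negb_or => /andP[].
Qed.

Lemma theta_exchange n m : (exists b, [/\ (0 < b)%N, (N * b <= n)%N, (n <= m)%N &
   forall m e, (m <= N)%N -> e \in finsupp (Q m) -> (`|e.1 - e.2%:Z| <= b)%N]) ->
  theta n.+1 * tsw 1 (theta m) = theta m.+1 * tsw 1 (theta n).
Proof.
move=> [b [b0 nb nm bandQ]]; rewrite !theta_shift -!rmorphM /=.
by rewrite (Theta_exchange r Q0 b0 bandQ nb nm).
Qed.

Local Notation tC := (tpsC N).

(** This is F(c)/W(c) = g(c+1)/g(c) after clearing denominators. Normalised by [indicial_normalize],
    the quotient F/W has constant term 1. Its product over consecutive translates is a window
    determinant divided by known factors, and [local_factor] cancels the zero at s_i, so
    [mult_coboundary] applies. *)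
Lemma char_zero_identity : exists b n (e : {poly R}) (G : tps N {poly R}),
  [/\ (0 < b)%N /\ (N * b <= n)%N,
   forall m e, (m <= N)%N -> e \in finsupp (Q m) -> (`|e.1 - e.2%:Z| <= b)%N,
   e != 0, G 0%N != 0 &
   theta n.+1 * G * tC (e \Po Xplus R 1) =
   Wprod * tsw 1 (theta n) * tsw 1 G * tC e].
Proof.
have [b [b0 bandQ]] := bandP; pose n := (N * b + b * N.+1)%N.
have exch m : (n <= m)%N -> theta n.+1 * tsw 1 (theta m) = theta m.+1 * tsw 1 (theta n).
  by move=> nm; apply: theta_exchange; exists b; split=> //; rewrite leq_addr.
have [d [dV dE]] := indicial_normalize.
have tswC a c : tsw a (tC c) = tC (c \Po Xplus R a) by exact: tps_mapC.
have tioC c : tio (tC c) = tC (io c) by exact: tps_mapC.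
have tioM x y : tio (x * y) = tio x * tio y by exact: rmorphM.
have tshM a x y : tsh a (x * y) = tsh a x * tsh a y by exact: rmorphM.
have tswM a x y : tsw a (x * y) = tsw a x * tsw a y by exact: rmorphM.
pose den := Wprod * tsw 1 (theta n) * tC d.
have W0 : Wprod 0%N = \prod_i wi_const i.
  by rewrite -[LHS]/(tps_const _) rmorph_prod; apply: eq_bigr => i _; exact: swap_Wi_const.
have den0V : denV s (den 0%N).
  rewrite !tps_coef0M W0 tps_coefC tsw_coef; apply: denVM => //; apply: denVM; first exact: denV_wi.
  by apply: denV_shift; exact: denV_theta0.
have [den0 den0i] := denV_unit_coef den0V.
(* num/den is F/W multiplied by d(c+1)/d(c), which makes the constant term equal to 1. *)
pose num := theta n.+1 * tC (d \Po Xplus R 1).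
have num0 : num 0%N = den 0%N.
  rewrite !tps_coef0M W0 !tps_coefC /= tsw_coef !theta0 big_ord_recl /= Xplus0 comp_polyXr.
  rewrite rmorph_prod /= mulrAC dE mulrAC; congr (_ * _ * _); apply: eq_bigr => j _.
  by rewrite -comp_polyA Xplus_comp; congr (_ \Po Xplus R _); rewrite /bump leq0n add1n intS addrC.
have tio0 x : tio x 0%N = io (x 0%N) by rewrite tps_mapE.
have [u denu] : exists u, tio den * u = 1 by apply: tps_unit; rewrite tio0 tofrac_eq0.
pose f := tio num * u.
have fE : f * tio den = tio num by rewrite /f -mulrA [u * _]mulrC denu mulr1.
have f0 : f 0%N = 1.
  apply: (mulIf (x := io (den 0%N))); first by rewrite tofrac_eq0.
  by rewrite mul1r -{2}num0 -!tio0 -fE tps_coef0M.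
have fV : tloc (denV s) f.
  apply: (tloc_div (@denV1 _ _ s) (@denVM _ _ s) (@denV_neq0 _ _ s) (y := tio den)).
  - by rewrite fE; apply: tloc_map; exact: denV1.
  - by apply: tloc_map; exact: denV1.
  - by rewrite tio0.
  - by rewrite tio0 tofrac_eq0.
(* By [Theta_exchange] the product of k translates telescopes into the window determinant of size n
   + k. *)
have claim k : \prod_(j < k) tsh j%:Z f * tio (\prod_(j < k) tsw j%:Z Wprod * tsw k%:Z (theta n) * tC d)
    = tio (theta (n + k)%N * tC (d \Po Xplus R k%:Z)).
  elim: k => [|k IH].
    by rewrite !big_ord0 !mul1r tsw0 addn0 Xplus0 comp_polyXr.
  pose c := tsw 1 (theta n) * tC (d \Po Xplus R 1).
  have c0 : tio c 0%N != 0.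
    rewrite tio0 tofrac_eq0 tps_coef0M tps_coefC /= tsw_coef mulf_neq0 //.
      by apply: (@denV_neq0 _ _ s); apply: denV_shift; exact: denV_theta0.
    by apply: (@denV_neq0 _ _ s); apply: denV_shift.
  have shP : \prod_(j < k.+1) tsh j%:Z f = f * tsh 1 (\prod_(j < k) tsh j%:Z f).
    rewrite big_ord_recl tsh0 rmorph_prod; congr (_ * _).
    by apply: eq_bigr => j _; rewrite /= tshD -intS.
  have swP : \prod_(j < k.+1) tsw j%:Z Wprod = Wprod * tsw 1 (\prod_(j < k) tsw j%:Z Wprod).
    rewrite big_ord_recl tsw0 rmorph_prod; congr (_ * _).
    by apply: eq_bigr => j _; rewrite /= tswD -intS.
  have := congr1 (tsh 1) IH; rewrite tshM !tsh_tio !tswM !tswC.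
  rewrite tswD -!comp_polyA !Xplus_comp -intS [k%:Z + 1]addrC -intS shP swP.
  move: (\prod_(j < k) _) (\prod_(j < k) _) => Pf PW IH1.
  apply: (tps_mulI c0).
  transitivity (tio num * tio (tsw 1 (theta (n + k)%N) * tC (d \Po Xplus R k.+1%:Z))).
    rewrite -IH1 -fE /den /c !tioM; ring.
  rewrite -!tioM; congr tio; rewrite /num /c addnS.
  have := exch (n + k)%N (leq_addr _ _); move: (theta _) (tsw _ _) (theta _) (tsw _ _) => a1 a2 a3 a4 E.
  rewrite mulrACA E; ring.
have freg i : exists A0, forall A, (A0 <= A)%N ->
     tloc (denR s i) (\prod_(k < (2 * A).+1) tsh (k%:Z - A%:Z) f).
  have [m0 m0P] := class_bound charK iota r (s i).
  have [B1 B1P] := denV_shift_reg (denV_theta0 n).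
  have [B2 B2P] := denV_shift_reg dV.
  exists (m0 + b * N.+1 + B1.+1 + B2.+1)%N => A leA; pose k := (2 * A).+1.
  have [|| q [qE _]] := local_factor charK iota_inj Q0 bandQ (L_gt0 i) (lam_exp i) (w_def i)
      (wR_lift i) m0P (A := A) (nw := (n + k)%N).
  - lia.
  - rewrite /k /n; lia.
  have {}qE : tsw (- A%:Z) (theta (n + k)%N) = swap (Wi i) * swap (q \Po ('X + (tpsC N (- s i))%:P)).
    rewrite theta_shift -rmorphM /Wi -comp_polyM -qE -comp_polyA; congr swap.
    rewrite comp_polyD comp_polyX comp_polyC -addrA -polyCD -rmorphD addNr.
    by rewrite rmorph0 addr0 comp_polyXr.
  have := congr1 (tsh (- A%:Z)) (claim k).
  rewrite tshM !tsh_tio !tswM !tswC qE (rmorph_prod (tsh _)) (rmorph_prod (tsw _)).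
  rewrite tswD -!comp_polyA !Xplus_comp.
  have -> : \prod_(j < k) tsh (- A%:Z) (tsh j%:Z f) = \prod_(k < (2 * A).+1) tsh (k%:Z - A%:Z) f.
    by apply: eq_bigr => j _; rewrite tshD addrC.
  set P := \prod_(_ < _) tsh _ f.
  have Ak : (A < k)%N by rewrite /k; lia.
  rewrite (bigD1 (Ordinal Ak)) //= tswD addNr tsw0 {1}/Wprod (bigD1 i) //=.
  set W1 := \prod_(_ | _) swap _; set W2 := \prod_(_ < _ | _) _.
  set q' := swap (q \Po _); set th := tsw _ (theta n); set d1 := tC _; set d2 := tC _.
  move=> E.
  have Wi0 : tio (swap (Wi i)) 0%N != 0.
    by rewrite tio0 tofrac_eq0 swap_Wi_const expf_neq0 // polyXsubC_eq0.
  (* The untranslated w_i(c - s_i) is cancelled; the constant terms of the factors left on the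
     denominator side do not vanish at s_i. *)
  have {}E : P * tio (W1 * W2 * th * d1) = tio (q' * d2).
    apply: (tps_mulI Wi0); rewrite -[RHS]tioM [X in _ = tio X]mulrA -E !tioM; ring.
  have regV x y : denR s i x -> x = y -> denR s i y by move=> ? <-.
  have dR : denR s i ((W1 * W2 * th * d1) 0%N).
    rewrite !tps_coef0M tps_coefC tsw_coef; apply: denRM; first apply: denRM; first apply: denRM.
    - have -> : W1 0%N = \prod_(j | j != i) wi_const j.
        by rewrite -[LHS]/(tps_const W1) rmorph_prod; apply: eq_bigr => j _; exact: swap_Wi_const.
      rewrite /denR horner_prod; apply/prodf_neq0 => j ji.
      rewrite horner_exp expf_neq0 // hornerXsubC -(subr0 (_ - _)).
      by apply: (@pole_neq _ charR _ _ s_inj i j 0); rewrite xpair_eqE eqxx andbT eq_sym.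
    - have -> : W2 0%N = \prod_(j < k | j != Ordinal Ak) \prod_h (wi_const h \Po Xplus R (- A%:Z + j%:Z)).
        rewrite -[LHS]/(tps_const W2) rmorph_prod; apply: eq_bigr => j _.
        rewrite [LHS]tsw_coef tsw_coef W0 -comp_polyA Xplus_comp addrC rmorph_prod.
        by rewrite addrC.
      rewrite /denR horner_prod; apply/prodf_neq0 => j jA; rewrite horner_prod.
      apply/prodf_neq0 => h _; rewrite /wi_const rmorphXn horner_exp expf_neq0 //=.
      rewrite comp_polyB comp_polyX comp_polyC /Xplus !hornerE.
      have := @pole_neq _ charR _ _ s_inj i h (A%:Z - j%:Z).
      rewrite -opprB rmorphN opprK addrAC -[- A%:Z + _]addrC; apply; rewrite xpair_eqE.
      by apply: contraNN jA => /andP[_ /eqP e]; apply/eqP/val_inj => /=; lia.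
    - by apply: B1P; lia.
    - by apply: B2P; lia.
  apply: (tloc_div (@denR1 _ _ s i) (@denRM _ _ s i) (@denR_neq0 _ _ s i) (y := tio (W1 * W2 * th * d1))).
  - by rewrite E; apply: tloc_map; exact: denR1.
  - by apply: tloc_map; exact: denR1.
  - by rewrite tio0; exact: loc_inv.
  - by rewrite tio0 tofrac_eq0; exact: (denR_neq0 dR).
have [g [g0 gV gE]] := mult_coboundary charR s_inj f0 fV freg.
have [e [G [e0 eG]]] := common_denominator (@denV_neq0 _ _ s) gV.
exists b, n, (d * e), G; split=> //.
- by rewrite leq_addr.
- by rewrite mulf_neq0 // (denV_neq0 dV).
- by rewrite -tofrac_eq0 -tio0 -eG tps_coefCM g0 mulr1 tofrac_eq0.
apply: (tps_map_inj (phi := io)); first by move=> x y /eqP; rewrite tofrac_eq => /eqP.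
have e0' : tC (io (e \Po Xplus R 1)) 0%N != 0.
  rewrite tps_coefC tofrac_eq0 /=; apply: contraNneq e0 => e1.
  by apply/eqP/(@comp_Xplus_inj R 1); rewrite e1 rmorph0.
have eG1 : tC (io (e \Po Xplus R 1)) * tsh 1 g = tio (tsw 1 G).
  by rewrite -tsh_tio -eG tshM -[tC (io e)]tioC tsh_tio tswC tioC.
have := congr1 ( *%R (tC (io (e \Po Xplus R 1)) * tC (io e))) (congr1 ( *%R (tio den)) gE).
rewrite [tio den * (f * g)]mulrA [tio den * f]mulrC fE => E.
rewrite !comp_polyM !rmorphM /= !tioC.
transitivity (tC (io (e \Po Xplus R 1)) * tC (io e) * (tio num * g)).
  rewrite /num tioM tioC -eG; ring.
by rewrite E -eG1 /den !tioM tioC; ring.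
Qed.
End CharZero.

(** * The p-dimensional representation and an eigenbasis of x d/dx *)

Lemma graded_pow (A : nzRingType) n (a : 'I_n.+1 -> nat) (M : 'M[A]_n.+1) k i j :
  (forall i j, a i != (a j).+1 -> M i j = 0) ->
  a i != (a j + k)%N -> (M ^+ k) i j = 0.
Proof.
move=> M0; elim: k i j => [|k IH] i j ne.
  by rewrite expr0 mxE (_ : (i == j) = false) //; apply: contraNF ne => /eqP ->; rewrite addn0.
rewrite exprS -[_ * _]/(_ *m _) mxE big1 // => h _.
case: (eqVneq (a i) (a h).+1) => [e|ne']; last by rewrite M0 ?mul0r.
by rewrite IH ?mulr0 //; apply: contraNneq ne => e'; rewrite e e' addnS.
Qed.

Lemma frobenius_comm (M : nzRingType) p (x y : M) : prime p -> p%:R = 0 :> M ->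
  GRing.comm x y -> (x + y) ^+ p = x ^+ p + y ^+ p.
Proof.
move=> p_pr charM cxy; have ch : p \in [pchar M] by rewrite inE p_pr charM eqxx.
exact: (pFrobenius_autD_comm ch cxy).
Qed.

Section Model.
Variables (A : comNzRingType) (p' : nat).
Local Notation p := p'.+1.
Variables xi xi' eta c : A.

Definition mx_shift : 'M[A]_p := \matrix_(i, j) (i == j.+1 :> nat)%:R.
Definition mx_deriv : 'M[A]_p := \matrix_(i, j) (j%:R *+ (j == i.+1 :> nat)).
Definition gx : 'M[A]_p := mx_shift + xi%:M.
Definition gd : 'M[A]_p := mx_deriv + eta%:M.
(** The p-th power of [gx] is the scalar xi^p, so this inverts [gx]; being polynomial in xi and xi',
    it is defined over any commutative ring and compatible with ring morphisms. *)
Definition gx_inv : 'M[A]_p := xi' ^+ p *: gx ^+ p'.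
Definition gxpow (a : int) : 'M[A]_p :=
  match a with Posz n => gx ^+ n | Negz n => gx_inv ^+ n.+1 end.
Definition gth := gx * gd.

Hypothesis p_pr : prime p.
Hypothesis charA : p%:R = 0 :> A.
Hypothesis xx : xi * xi' = 1.

Let charM : p%:R = 0 :> 'M[A]_p.
Proof. by rewrite -(rmorph_nat (@scalar_mx A p)) charA rmorph0. Qed.
Let comm_scalar a (M : 'M[A]_p) : GRing.comm M a%:M.
Proof. exact: comm_mx_scalar. Qed.

Lemma gx_p : gx ^+ p = (xi ^+ p)%:M.
Proof.
rewrite (frobenius_comm p_pr charM (comm_scalar _ _)) -rmorphXn /= [_ ^+ _](_ : _ = 0) ?add0r //.
apply/matrixP => i j; rewrite [RHS]mxE; apply: (graded_pow (a := @nat_of_ord _)).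
  by move=> i' j' /negPf ne; rewrite mxE ne.
by rewrite neq_ltn (leq_trans (ltn_ord i)) // leq_addl.
Qed.

Lemma gd_p : gd ^+ p = (eta ^+ p)%:M.
Proof.
rewrite (frobenius_comm p_pr charM (comm_scalar _ _)) -rmorphXn /= [_ ^+ _](_ : _ = 0) ?add0r //.
apply/matrixP => i j; rewrite [RHS]mxE; apply: (graded_pow (a := fun i : 'I_p => p' - i)%N).
  move=> i' j' ne; rewrite mxE; case: eqP => // e.
  by case/eqP: ne; have := ltn_ord j'; lia.
by rewrite neq_ltn; apply/orP; left; lia.
Qed.

Lemma gx_gx_inv : gx * gx_inv = 1.
Proof.
rewrite /gx_inv -scalerAr -exprS gx_p scale_scalar_mx -exprMn [xi' * _]mulrC xx.
by rewrite expr1n.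
Qed.
Lemma gx_inv_gx : gx_inv * gx = 1.
Proof.
rewrite /gx_inv -scalerAl -exprSr gx_p scale_scalar_mx -exprMn [xi' * _]mulrC xx.
by rewrite expr1n.
Qed.

Lemma gxpowS (a : int) : gxpow (a + 1) = gxpow a * gx.
Proof.
case: a => [n|[|n]]; first by rewrite -PoszD addn1 /= exprSr.
  by rewrite [Negz 0 + 1]subrr /= expr0 expr1 gx_inv_gx.
have -> : Negz n.+1 + 1 = Negz n by rewrite !NegzE; lia.
by rewrite /= [gx_inv ^+ n.+2]exprSr -mulrA gx_inv_gx mulr1.
Qed.
Lemma gxpowDn (a : int) n : gxpow (a + n%:Z) = gxpow a * gx ^+ n.
Proof.
elim: n => [|n IH]; first by rewrite addr0 expr0 mulr1.
by rewrite intS [1 + _]addrC addrA gxpowS IH -mulrA -exprSr.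
Qed.

Lemma gd_gx : gd * gx = gx * gd + 1.
Proof.
have DJ : mx_deriv * mx_shift = mx_shift * mx_deriv + 1.
  apply/matrixP => i j; rewrite -![_ * _]/(_ *m _) !mxE.
  have -> : \sum_k mx_deriv i k * mx_shift k j =
      (if (i.+1 < p)%N then i.+1%:R else 0) *+ (i == j).
    case: ltnP => lt.
      rewrite (bigD1 (Ordinal lt)) //= big1 ?addr0 => [|k ki]; rewrite !mxE.
        by rewrite /= eqxx eqSS mulr1n -val_eqE mulr_natr.
      by rewrite (_ : (_ == _) = false) ?mul0r //; apply/negP => /eqP e; case/eqP: ki; apply/val_inj.
    rewrite mul0rn big1 // => k _; rewrite !mxE (_ : (_ == _) = false) ?mul0r //.
    by apply/negP => /eqP e; have := ltn_ord k; lia.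
  have -> : \sum_k mx_shift i k * mx_deriv k j = i%:R *+ (i == j).
    case: (posnP i) => [i0|i0].
      by rewrite i0 mul0rn big1 // => k _; rewrite !mxE i0 mul0r.
    have lt : (i.-1 < p)%N by have := ltn_ord i; lia.
    rewrite (bigD1 (Ordinal lt)) //= big1 ?addr0 => [|k ki]; rewrite !mxE.
      by rewrite /= prednK // eqxx mul1r eq_sym val_eqE; case: eqP => // ->.
    by rewrite (_ : (_ == _) = false) ?mul0r //; apply/negP => /eqP e; case/eqP: ki; apply/val_inj => /=; lia.
  case: eqP => [_|_]; rewrite ?mulr0n ?addr0 // !mulr1n natr1.
  (* The corner entry lost by truncating at x^p would be p, which is zero. *)
  by case: ltnP => // le; have -> : i.+1 = p by have := ltn_ord i; lia.
have cS a (M : 'M[A]_p) : M * a%:M = a%:M * M by exact: comm_scalar.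
rewrite /gd /gx !mulrDl !mulrDr DJ (cS eta mx_shift) (cS xi mx_deriv) (cS xi eta%:M).
set u := _ * _; set v := _ * _; set w := _ * _; set z := _ * _.
by rewrite -!addrA; congr (_ + _); rewrite addrC -!addrA addrCA.
Qed.

Lemma gth_gx : gth * gx = gx * (gth + 1).
Proof. by rewrite /gth -mulrA gd_gx. Qed.
Lemma gd_gth : gd * gth = (gth + 1) * gd.
Proof. by rewrite /gth mulrA gd_gx. Qed.

Lemma gth_gxn n : gth * gx ^+ n = gx ^+ n * (gth + n%:R).
Proof.
elim: n => [|n IH]; first by rewrite expr0 mul1r mulr1 addr0.
by rewrite exprSr mulrA IH -mulrA mulrDl gth_gx mulr_natl -mulr_natr -mulrDr -addrA -natr1 [1 + _]addrC mulrA.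
Qed.
Lemma gth_gdn n : gth * gd ^+ n = gd ^+ n * (gth - n%:R).
Proof.
elim: n => [|n IH]; first by rewrite expr0 mul1r mulr1 subr0.
have e : gth * gd = gd * (gth - 1) by rewrite mulrBr gd_gth mulrDl mul1r mulr1 addrK.
rewrite exprSr mulrA IH -mulrA mulrBl e mulr_natl -mulr_natr -mulrBr -addrA -opprD.
by rewrite -natr1 [1 + _]addrC mulrA.
Qed.

Lemma gx_gd_pow b : gx ^+ b * gd ^+ b = horner_mx gth (ffactX A b).
Proof.
elim: b => [|b IH]; first by rewrite /ffactX big_ord0 !rmorph1 mulr1.
rewrite /ffactX big_ord_recr /= rmorphM /= -/(ffactX A b) -IH.
rewrite rmorphB /= horner_mx_X horner_mx_C rmorph_nat -mulrA -gth_gdn.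
by rewrite exprSr exprS -!mulrA [gx * (gd * _)]mulrA.
Qed.

Let charP : p%:R = 0 :> {poly A}.
Proof. by rewrite -(rmorph_nat (@polyC A)) charA rmorph0. Qed.

Lemma ffactX_p : ffactX A p = 'X^p - 'X.
Proof.
rewrite -(prod_shift p_pr charP) /ffactX !big_ord_recl subr0 addr0; congr (_ * _).
rewrite (reindex_inj rev_ord_inj); apply: eq_bigr => i _ /=; rewrite /bump !leq0n !add1n.
have -> : (p' - i.+1).+1 = (p - i.+1)%N by rewrite subSn.
have lt : (i.+1 <= p)%N by have := ltn_ord i; lia.
have -> : (p - i.+1)%:R = - i.+1%:R :> A.
  by apply/eqP; rewrite -addr_eq0 -natrD subnK // charA.
by rewrite polyCN opprK polyC_natr.
Qed.

Hypothesis c_eq : c ^+ p - c = (xi * eta) ^+ p.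

(** For k = p-1, applying theta - c once more gives theta^p - theta - (c^p - c), which is zero
    because theta^p - theta = x^p (d/dx)^p = (xi eta)^p. Thus [seed p'] is an eigenvector of theta
    for c. *)
Definition seed k : 'cV[A]_p :=
  horner_mx gth (\prod_(i < k) ('X - c%:P + i.+1%:R)) *m delta_mx ord_max 0.
Definition evec0 := seed p'.

Lemma gth_evec0 : gth *m evec0 = c *: evec0.
Proof.
apply/eqP; rewrite -subr_eq0 -mul_scalar_mx -mulmxBl; apply/eqP.
have -> : gth - c%:M = horner_mx gth ('X - c%:P).
  by rewrite rmorphB /= horner_mx_X horner_mx_C.
rewrite /evec0 /seed mulmxA -[_ *m horner_mx _ _]/(_ * _) -rmorphM /=.
have -> : ('X - c%:P) * (\prod_(i < p') ('X - c%:P + i.+1%:R)) = ('X^p - 'X) - (c ^+ p - c)%:P.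
  transitivity (\prod_(i < p) ('X - c%:P + i%:R)); first by rewrite big_ord_recl addr0.
  rewrite (prod_shift p_pr charP) (frobenius_comm p_pr charP (mulrC _ _)) polyCB polyC_exp.
  suff -> : (- c%:P) ^+ p = - c%:P ^+ p by ring.
  apply/eqP; rewrite -addr_eq0 addrC -(frobenius_comm p_pr charP (mulrC _ _)) subrr.
  by rewrite expr0n.
rewrite -ffactX_p rmorphB /= -gx_gd_pow gx_p gd_p horner_mx_C -rmorphM /= -exprMn c_eq.
by rewrite subrr mul0mx.
Qed.

Definition evec (a : int) : 'cV[A]_p := gxpow a *m evec0.

Lemma gth_evec (n : nat) : gth *m evec n = (c + n%:R) *: evec n.
Proof.
rewrite /evec mulmxA -[gth *m _]/(gth * _) /= gth_gxn -mulmxA mulmxDl gth_evec0.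
rewrite -(rmorph_nat (@scalar_mx A p)) mul_scalar_mx -scalerDl -scalemxAr //.
Qed.

Lemma horner_gth_evec q (n : nat) : horner_mx gth q *m evec n = q.[c + n%:R] *: evec n.
Proof.
elim/poly_ind: q => [|q x IH]; first by rewrite rmorph0 mul0mx horner0 scale0r.
rewrite rmorphD rmorphM /= horner_mx_X horner_mx_C mulmxDl -mulmxA gth_evec -scalemxAr IH.
by rewrite mul_scalar_mx scalerA -scalerDl hornerMXaddC mulrC.
Qed.

Lemma diffop_evec (e : int * nat) (n : nat) :
  gxpow e.1 *m gd ^+ e.2 *m evec n = (ffactX A e.2).[c + n%:R] *: evec (n%:Z + (e.1 - e.2%:Z)).
Proof.
have -> : gxpow e.1 = gxpow (e.1 - e.2%:Z) * gx ^+ e.2 by rewrite -gxpowDn subrK.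
rewrite -[_ * _ *m _]mulmxA -[gx ^+ _ *m gd ^+ _]/(gx ^+ _ * gd ^+ _) gx_gd_pow -mulmxA.
by rewrite horner_gth_evec -scalemxAr; congr (_ *: _); rewrite /evec mulmxA [n%:Z + _]addrC gxpowDn.
Qed.

Lemma evec_wrap (a : int) : evec (a + p%:Z) = xi ^+ p *: evec a.
Proof. by rewrite /evec gxpowDn gx_p -[_ * _]/(_ *m _) mul_mx_scalar scalemxAl. Qed.

Lemma mx_shift_pow k (i j : 'I_p) : (mx_shift ^+ k) i j = (i == j + k :> nat)%N%:R.
Proof.
case: (eqVneq (i : nat) (j + k)%N) => [|ne]; last first.
  apply: (graded_pow (a := @nat_of_ord _)) => // i' j' /negPf ne'.
  by rewrite mxE ne'.
elim: k i => [|k IH] i e.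
  by rewrite expr0 mxE (_ : i == j) //; apply/eqP/val_inj; rewrite /= e addn0.
have lt : (j + k < p)%N by have := ltn_ord i; lia.
rewrite exprS -[_ * _]/(_ *m _) mxE (bigD1 (Ordinal lt)) //= IH // mxE e addnS eqxx mul1r.
rewrite big1 ?addr0 // => h ne; rewrite mxE e (_ : (_ == _) = false) ?mul0r //.
by apply: contraNF ne => /eqP e'; apply/eqP/val_inj => /=; lia.
Qed.

Lemma gth_above (i j : 'I_p) : (i < j)%N -> gth i j = (xi * j%:R) *+ (j == i.+1 :> nat).
Proof.
move=> lt; rewrite /gth -[_ * _]/(_ *m _) mxE (bigD1 i) //= big1 => [|k ki]; rewrite !mxE.
  rewrite eqxx ltn_eqF // addr0 add0r !mulr1n -[i == j]val_eqE (ltn_eqF lt) addr0.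
  by rewrite mulrnAr.
rewrite (_ : (i == k) = false) ?mulr0n ?addr0; last by rewrite eq_sym (negPf ki).
case: (i =P k.+1 :> nat) => e; last by rewrite mul0r.
rewrite (_ : (j == k.+1 :> nat) = false); last by apply/eqP; lia.
by rewrite -[k == j]val_eqE (_ : (k == j :> nat) = false) ?addr0 ?mulr0 //; apply/eqP; lia.
Qed.

(** Above the diagonal theta has only the entries xi j in position (j-1, j), so each factor raises
    the support from the last coordinate by one place. At k = p-1 this yields the first coordinate
    of the eigenvector. *)
Lemma seed_coord k (i : 'I_p) : (i + k <= p')%N -> seed k i 0 =
  (\prod_(j < k) (xi * (p' - j)%:R)) *+ (i + k == p')%N.
Proof.
elim: k i => [|k IH] i le.
  rewrite /seed !big_ord0 rmorph1 mul1mx mxE eqxx andbT addn0; congr (_%:R); exact: val_eqE.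
have -> : seed k.+1 = gth *m seed k - (c - k.+1%:R) *: seed k.
  rewrite /seed big_ord_recr /= mulrC rmorphM /= -[_ * _]/(_ *m _) -mulmxA -mul_scalar_mx -mulmxBl.
  congr (_ *m _); rewrite rmorphD rmorphB /= horner_mx_X horner_mx_C rmorph_nat.
  by rewrite rmorphB rmorph_nat /= opprB addrAC addrA.
have lt : (i.+1 < p)%N by lia.
have -> : (gth *m seed k - (c - k.+1%:R) *: seed k) i 0 =
    \sum_j gth i j * seed k j 0 - (c - k.+1%:R) * seed k i 0.
  by move: gth (seed k) => G S; rewrite !mxE.
rewrite [seed k i 0]IH ?[(i + k)%N == p']ltn_eqF ?mulr0 ?subr0; try lia.
rewrite (bigD1 (Ordinal lt)) //= big1 => [|j ji]; last first.
  case: (leqP j i) => [ij|ij].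
    by rewrite IH ?ltn_eqF ?mulr0 //; lia.
  rewrite gth_above // (_ : (j == i.+1 :> nat) = false) ?mul0r //.
  by apply: contraNF ji => /eqP e; apply/eqP/val_inj.
rewrite addr0 gth_above //= eqxx IH /= ?big_ord_recr /=; last lia.
rewrite addSnnS; case: eqP => [e|_]; last by rewrite !mulr0n mulr0.
by rewrite !mulr1n mulrC; congr (_ * (_ * _%:R)); lia.
Qed.

Definition basis_mx : 'M[A]_p := \matrix_(i, j) evec (j : nat) i 0.

(** The eigenvector is a polynomial [M] in the nilpotent shift applied to the first unit vector, and
    [M] commutes with [gx]. So the matrix is [M] times a unitriangular one, and [M] is triangular
    with diagonal entries xi^(p-1) (p-1)!, equal to -xi^(p-1) by Wilson. *)
Lemma basis_mx_unit : exists u, \det basis_mx * u = 1.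
Proof.
pose v0 := evec0 0 0.
pose M := \sum_(k < p) evec0 k 0 *: mx_shift ^+ k.
pose U : 'M[A]_p := \matrix_(i, j) (gx ^+ j) i 0.
have commM (n : nat) : gx ^+ n * M = M * gx ^+ n.
  suff: GRing.comm M (gx ^+ n) by move=> /esym.
  apply: commrX; apply: commr_sym; apply: commr_sum => k _.
  rewrite /GRing.comm -scalerAl -scalerAr; congr (_ *: _).
  have: GRing.comm mx_shift gx by apply: commrD; [exact: commr_refl | apply: comm_scalar].
  by move=> /commr_sym/(commrX k).
have Me : M *m delta_mx 0 0 = evec0.
  apply/colP => i; rewrite -colE mxE summxE (bigD1 i) //= big1 ?addr0 => [|k ki].
    by rewrite mxE mx_shift_pow add0n eqxx mulr1.
  by rewrite mxE mx_shift_pow add0n val_eqE eq_sym (negPf ki) mulr0.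
have TE : basis_mx = M *m U.
  apply/matrixP => i j; rewrite mxE /evec /= -Me mulmxA -[_ *m M]/(_ * M) commM.
  by rewrite -mulmxA -colE !mxE; apply: eq_bigr => k _; rewrite !mxE.
have detM : \det M = v0 ^+ p.
  rewrite det_trig; last first.
    apply/is_trig_mxP => i j lt; rewrite summxE big1 // => k _.
    by rewrite mxE mx_shift_pow ltn_eqF ?mulr0 // ltn_addr.
  rewrite -[in RHS](card_ord p) -prodr_const; apply: eq_bigr => i _.
  rewrite summxE (bigD1 0) //= big1 ?addr0 => [|k k0]; rewrite mxE mx_shift_pow.
    by rewrite addn0 eqxx mulr1.
  rewrite ltn_eqF ?mulr0 // -[X in (X < _)%N]addn0 ltn_add2l lt0n.
  by apply: contraNneq k0 => e; apply/eqP/val_inj.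
have gx_e (n : nat) (i : 'I_p) : (n <= i)%N -> (gx ^+ n) i 0 = (i == n :> nat)%:R.
  elim: n i => [|n IH] i le; first by rewrite expr0 mxE; congr (_%:R); exact: val_eqE.
  have i0 : (0 < i)%N by exact: leq_trans le.
  have lt : (i.-1 < p)%N by have := ltn_ord i; lia.
  rewrite exprS -[_ * _]/(_ *m _) mulmxDl mxE mul_scalar_mx [X in _ + X]mxE.
  rewrite [X in _ * X]IH ?(gtn_eqF le) ?mulr0 ?addr0 1?ltnW // mxE.
  rewrite (bigD1 (Ordinal lt)) //= mxE /= prednK // eqxx mul1r IH /=; last lia.
  rewrite big1 ?addr0 => [|k ki]; last first.
    rewrite mxE (_ : (_ == _) = false) ?mul0r //.
    by apply: contraNF ki => /eqP e; apply/eqP/val_inj => /=; lia.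
  by congr (_%:R); apply/eqP/eqP; lia.
have detU : \det U = 1.
  rewrite -det_tr det_trig; last first.
    apply/is_trig_mxP => i j lt; rewrite !mxE gx_e 1?ltnW //.
    by rewrite gtn_eqF.
  by rewrite big1 // => i _; rewrite !mxE gx_e // eqxx.
have v0E : v0 = xi ^+ p' * (p'`!)%:R.
  rewrite /v0 /evec0 seed_coord //= eqxx mulr1n big_split prodr_const card_ord /=; congr (_ * _).
  rewrite -natr_prod; congr (_%:R); rewrite fact_prod big_add1 /= big_mkord.
  by rewrite (reindex_inj rev_ord_inj); apply: eq_bigr => i _ /=; have := ltn_ord i; lia.
have fE : (p'`!)%:R = -1 :> A.
  apply/eqP; rewrite -addr_eq0 natr1; have := p_pr; rewrite Wilson ?prime_gt1 // => /dvdnP[m ->].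
  by rewrite natrM charA mulr0.
exists ((xi' ^+ p' * - 1) ^+ p).
rewrite TE det_mulmx detM detU mulr1 v0E fE -exprMn mulrACA -exprMn xx expr1n mulrNN !mulr1.
by rewrite expr1n.
Qed.
End Model.

(** * The determinant in characteristic p as a product round the cycle *)

Lemma big_int_window (V : zmodType) (f : int -> V) (lo a : int) len :
  lo <= a -> a < lo + len%:Z -> \sum_(k < len | lo + k%:Z == a) f (lo + k%:Z) = f a.
Proof.
move=> la ah; have lt : (`|a - lo| < len)%N by lia.
have e : lo + `|a - lo|%:Z = a by lia.
rewrite (big_pred1 (Ordinal lt)) /= ?e // => k /=.
by apply/eqP/eqP => [ek|->//]; apply/val_inj => /=; lia.
Qed.

Section PSide.
Variables (R A : comNzRingType) (phi : {rmorphism R -> A}) (p' : nat).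
Local Notation p := p'.+1.
Variables xi xi' eta c : A.
Local Notation gx := (gx p' xi).
Local Notation gd := (gd p' eta).
Local Notation gxpow := (gxpow p' xi xi').
Local Notation gth := (gth p' xi eta).
Local Notation evec := (evec p' xi xi' eta c).

Definition gdiff (q : diffop R) : 'M[A]_p :=
  \sum_(e <- finsupp q) phi (q e) *: (gxpow e.1 *m gd ^+ e.2).
Definition gP (r : seq R) : 'M[A]_p := \prod_(z <- r) (gx *m gd - (phi z)%:M).
Variable N : nat.
Definition gD (r : seq R) (Q : nat -> diffop R) : 'M[tps N A]_p :=
  map_mx (@tpsC N A) (gP r) +
  \sum_(m < N.+1) tpsX N A ^+ m *: map_mx (@tpsC N A) (gdiff (Q m)).

Hypothesis p_pr : prime p.
Hypothesis charA : p%:R = 0 :> A.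
Hypothesis xx : xi * xi' = 1.
Hypothesis c_eq : c ^+ p - c = (xi * eta) ^+ p.

Lemma gP_evec r (n : nat) :
  gP r *m evec n = (map_poly phi (indicial r)).[c + n%:R] *: evec n.
Proof.
have -> : gP r = horner_mx gth (map_poly phi (indicial r)).
  rewrite /gP /indicial !rmorph_prod; apply: eq_bigr => z _ /=.
  by rewrite !rmorphB /= map_polyX map_polyC horner_mx_X horner_mx_C.
exact: horner_gth_evec.
Qed.

Definition symb_val q a (n : nat) := (map_poly phi (symb q a)).[c + n%:R].

Lemma symb_valE q a n : symb_val q a n =
  \sum_(e <- finsupp q | e.1 - e.2%:Z == a) phi (q e) * (ffactX A e.2).[c + n%:R].
Proof.
rewrite /symb_val /symb rmorph_sum /= horner_sum; apply: eq_bigr => e _.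
rewrite linearZ_LR /= hornerZ; congr (_ * _.[_]).
rewrite /ffactX rmorph_prod; apply: eq_bigr => i _ /=.
by rewrite rmorphB /= map_polyX map_polyC /= [phi _]rmorph_nat.
Qed.

Lemma gdiff_evec q (n : nat) (lo : int) len b :
  (forall e, e \in finsupp q -> (`|e.1 - e.2%:Z| <= b)%N) ->
  lo + b%:Z <= n%:Z -> n%:Z + b%:Z < lo + len%:Z ->
  gdiff q *m evec n = \sum_(k < len) symb_val q (lo + k%:Z - n%:Z) n *: evec (lo + k%:Z).
Proof.
move=> band lon nlen; rewrite /gdiff mulmx_suml.
under [RHS]eq_bigr => k _ do rewrite symb_valE scaler_suml big_mkcond.
rewrite exchange_big /=; apply: eq_big_seq => e eq.
rewrite -scalemxAl (diffop_evec p_pr charA xx c_eq) scalerA -big_mkcond /=.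
have := band e eq; move: (e.1 - e.2%:Z) => a ab.
rewrite -(@big_int_window _ (fun a => _ *: evec a) lo (n%:Z + a) len) ?scaler_sumr; try lia.
by apply: eq_bigl => k; apply/eqP/eqP; lia.
Qed.

Local Notation T := (tps N R).
Local Notation TA := (tps N A).
Local Notation C := (@tpsC N A).

Definition pt_eval (n : nat) : {poly T} -> TA :=
  horner_eval (C (c + n%:R)) \o map_poly (@tps_map N _ _ phi).
HB.instance Definition _ n := GRing.RMorphism.on (pt_eval n).

Lemma pt_evalE n q : pt_eval n q = (map_poly (@tps_map N _ _ phi) q).[C (c + n%:R)].
Proof. by []. Qed.
Lemma pt_eval_comp n q (j : nat) : pt_eval n (q \Po Xplus T j) = pt_eval (n + j) q.
Proof.
rewrite !pt_evalE map_comp_poly horner_comp; congr _.[_].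
rewrite /Xplus rmorphD /= map_polyX map_polyC /= hornerD hornerX hornerC.
by rewrite natrD addrA [RHS]rmorphD /= [X in _ + X = _]rmorph_int [X in _ = _ + X]rmorph_nat.
Qed.
Lemma pt_eval_Dent r Q n (a : int) (j : nat) :
  pt_eval n (Dent N r Q a j) = pt_eval (n + j) (Dsym N r Q (a - j%:Z)).
Proof. by rewrite /Dent pt_eval_comp. Qed.

Definition tevec (a : int) : 'cV[TA]_p := map_mx C (evec a).

Section MainIdentity.
Variables (r : seq R) (Q : nat -> diffop R).
Hypothesis Q0 : Q 0%N = [fsfun].
Variable b : nat.
Hypothesis b_gt0 : (0 < b)%N.
Hypothesis bandQ : forall m e, (m <= N)%N -> e \in finsupp (Q m) ->
  (`|e.1 - e.2%:Z| <= b)%N.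
Local Notation Dv a n := (pt_eval n (Dsym N r Q a)).

Lemma pt_eval_Dsym a n : Dv a n =
  (if a == 0 then C (map_poly phi (indicial r)).[c + n%:R] else 0) +
  \sum_(m < N.+1) tpsX N A ^+ m * C (symb_val (Q m) a n).
Proof.
have evC q : pt_eval n (poly_tpsC N q) = C (map_poly phi q).[c + n%:R].
  rewrite pt_evalE -horner_map -!map_poly_comp; congr _.[_].
  by apply: eq_map_poly => z /=; exact: tps_mapC.
rewrite /Dsym rmorphD rmorph_sum /=; congr (_ + _).
  by case: ifP => _; rewrite ?evC ?rmorph0.
apply: eq_bigr => m _; rewrite -mul_polyC rmorphM /= evC; congr (_ * _).
by rewrite pt_evalE map_polyC hornerC /= rmorphXn /= tps_mapX.
Qed.

Lemma gD_evec (n : nat) (lo : int) len :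
  lo + b%:Z <= n%:Z -> n%:Z + b%:Z < lo + len%:Z ->
  gD r Q *m tevec n = \sum_(k < len) Dv (lo + k%:Z - n%:Z) n *: tevec (lo + k%:Z).
Proof.
move=> lon nlen; under eq_bigr => k _ do rewrite pt_eval_Dsym scalerDl.
rewrite big_split /= /gD mulmxDl; congr (_ + _).
  rewrite -map_mxM gP_evec.
  rewrite (eq_bigr (fun k : 'I_len => if lo + k%:Z == n then C (map_poly phi (indicial r)).[c + n%:R] *: tevec (lo + k%:Z) else 0)); last first.
    by move=> k _; rewrite subr_eq0; case: ifP => _; rewrite ?scale0r.
  rewrite -big_mkcond (@big_int_window _ (fun a => _ *: tevec a)) ?map_mxZ //; lia.
under [RHS]eq_bigr => k _ do rewrite scaler_suml.
rewrite exchange_big mulmx_suml /=; apply: eq_bigr => m _.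
rewrite -scalemxAl -map_mxM (gdiff_evec (lo := lo) (len := len) (b := b)) //; last first.
  by move=> e; apply: bandQ; rewrite -ltnS.
rewrite map_mx_sum scaler_sumr; apply: eq_bigr => k _.
by rewrite map_mxZ scalerA.
Qed.

Variable n : nat.
Hypotheses (n_big : (N * b <= n)%N) (p_big : (n + b < p)%N).

Definition wvec (i : nat) : 'cV[TA]_p :=
  \sum_(j < n.+1) pt_eval i (wcol N r Q j) *: tevec (i%:Z + j%:Z).

(** On the eigenvectors D has the same coefficients as on x^(c+i), so the image is described by
    [wimg]; by [wimg_pos] only the indices from i-b to i remain. *)
Lemma gD_wvec i : gD r Q *m wvec i =
  \sum_(m < b.+1) pt_eval i (wimg N r Q n (m%:Z - b%:Z)) *: tevec (i%:Z + (m%:Z - b%:Z)).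
Proof.
rewrite /wvec mulmx_sumr.
pose F (m : nat) := pt_eval i (wimg N r Q n (m%:Z - b%:Z)) *: tevec (i%:Z + (m%:Z - b%:Z)).
transitivity (\sum_(m < n + 2 * b + 1) F m).
  rewrite (eq_bigr (fun j : 'I_n.+1 => \sum_(k < n + 2 * b + 1) pt_eval i (wcol N r Q j) *:
      (Dv (i%:Z - b%:Z + k%:Z - (i + j)%:Z) (i + j) *: tevec (i%:Z - b%:Z + k%:Z)))).
    2: by move=> j _; have lt := ltn_ord j; rewrite -scaler_sumr -gD_evec ?scalemxAr //; lia.
  rewrite exchange_big; apply: eq_bigr => k _ /=.
  rewrite /F /wimg rmorph_sum scaler_suml; apply: eq_bigr => j _.
  have -> : i%:Z - b%:Z + k%:Z = i%:Z + (k%:Z - b%:Z) by lia.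
  have -> : i%:Z + (k%:Z - b%:Z) - (i + j)%:Z = k%:Z - b%:Z - j%:Z by lia.
  by rewrite rmorphM /= pt_eval_Dent scalerA [pt_eval i _ * _]mulrC.
rewrite (big_ord_widen_cond _ predT F (_ : (b.+1 <= n + 2 * b + 1)%N)); last lia.
rewrite [RHS]big_mkcond /=; apply: eq_bigr => m _; case: ifP => // /negbT lt.
by rewrite /F (wimg_pos r Q0 b_gt0 bandQ n_big) ?rmorph0 ?scale0r //; lia.
Qed.

(** Coordinates of [evec a] in the basis of the first p of them; for -p <= a < 2p at most one wrap
    by x^p = xi^p is involved. *)
Definition coord (a : int) : 'cV[A]_p := \col_k
  (if a == k%:Z then 1 else if a == k%:Z + p%:Z then xi ^+ p else
   if a == k%:Z - p%:Z then xi' ^+ p else 0).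
Local Notation basis := (basis_mx p' xi xi' eta c).

Lemma evec_coord (a : int) : - p%:Z <= a -> a < p%:Z + p%:Z -> evec a = basis *m coord a.
Proof.
have col0 (m : nat) : (m < p)%N -> evec m = basis *m coord m.
  move=> lt; apply/colP => i; rewrite [RHS]mxE (bigD1 (Ordinal lt)) //= big1 ?addr0 => [|k km].
    by rewrite [basis _ _]mxE [coord _ _ _]mxE /= eqxx mulr1.
  have km' : k != m :> nat by apply: contraNneq km => e; apply/eqP/val_inj.
  have kp := ltn_ord k; rewrite [coord _ _ _]mxE ifF; last by apply/eqP; lia.
  by rewrite ifF ?ifF ?mulr0 //; apply/eqP; lia.
have wrapE (e : int) : 0 <= e -> e < p%:Z -> coord (e + p%:Z) = xi ^+ p *: coord e.
  move=> e0 ep; apply/colP => k; rewrite !mxE; have kp := ltn_ord k.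
  case: (e =P k%:Z) => [->|ne].
    by rewrite eqxx ifF ?mulr1 //; apply/eqP; lia.
  rewrite !ifF ?mulr0 //; apply/eqP; lia.
have wrapE' (e : int) : 0 <= e -> e < p%:Z -> coord (e - p%:Z) = xi' ^+ p *: coord e.
  move=> e0 ep; apply/colP => k; rewrite !mxE; have kp := ltn_ord k.
  case: (e =P k%:Z) => [->|ne].
    rewrite eqxx ifF; last by apply/eqP; lia.
    by rewrite ifF ?mulr1 //; apply/eqP; lia.
  rewrite !ifF ?mulr0 //; apply/eqP; lia.
move=> la ah; case: (boolP (a < 0)) => a0.
  have ea : evec a = xi' ^+ p *: evec (a + p%:Z).
    by rewrite (evec_wrap eta c p_pr charA xx) scalerA -exprMn [xi' * _]mulrC xx expr1n scale1r.
  have [m [lt mE]] : exists m : nat, (m < p)%N /\ a + p%:Z = m%:Z by exists `|(a + p%:Z)%R|%N; lia.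
  rewrite ea mE col0 // -(addrK p%:Z a) mE wrapE' ?scalemxAr //; lia.
case: (boolP (a < p%:Z)) => ap.
  have [m [lt ->]] : exists m : nat, (m < p)%N /\ a = m%:Z by exists `|a|%N; lia.
  exact: col0.
have [m [lt ->]] : exists m : nat, (m < p)%N /\ a = m%:Z + p%:Z by exists `|(a - p%:Z)%R|%N; lia.
by rewrite (evec_wrap eta c p_pr charA xx) wrapE // col0 // scalemxAr.
Qed.

(** The triangular factorisation closed up into a cycle: in matrices, [gD] times the basis times [V]
    is the basis times [W]. A nontrivial permutation winds round the cycle and costs more than N
    powers of t, so by [det_cyclic] the determinants of [V] and [W] are the products of their
    diagonals. The basis determinant is invertible and cancels. *)
Lemma cyclic_identity :
  \det (gD r Q) * \prod_(i < p) pt_eval i.+1 (Theta N r Q n) =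
  \prod_(i < p) pt_eval i (Theta N r Q n.+1).
Proof.
pose tb : 'M[TA]_p := map_mx C basis.
(* Columns of [V] and [W]: the coordinates of [wvec i] and of its image under D. *)
pose V : 'M[TA]_p := \matrix_(k, i) \sum_(j < n.+1)
  pt_eval i (wcol N r Q j) * C (coord (i%:Z + j%:Z) k 0).
pose W : 'M[TA]_p := \matrix_(k, i) \sum_(m < b.+1)
  pt_eval i (wimg N r Q n (m%:Z - b%:Z)) * C (coord (i%:Z + (m%:Z - b%:Z)) k 0).
have tevecE (a : int) : - p%:Z <= a -> a < p%:Z + p%:Z -> tevec a = tb *m map_mx C (coord a).
  by move=> la ah; rewrite /tevec evec_coord // map_mxM.
have VE : gD r Q *m tb *m V = tb *m W.
  apply/matrixP => k i; rewrite -mulmxA.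
  have -> : (tb *m W) k i = (gD r Q *m wvec i) k 0.
    rewrite gD_wvec (eq_bigr (fun m : 'I_b.+1 => tb *m (pt_eval i (wimg N r Q n (m%:Z - b%:Z)) *:
        map_mx C (coord (i%:Z + (m%:Z - b%:Z)))))).
      rewrite -mulmx_sumr !mxE; apply: eq_bigr => h _; congr (_ * _).
      by rewrite mxE summxE; apply: eq_bigr => m _; rewrite !mxE.
    move=> m _; rewrite tevecE ?scalemxAr //; have := ltn_ord m; have := ltn_ord i; lia.
  rewrite -[RHS]/((gD r Q *m _) k 0) [LHS]mxE [RHS]mxE; apply: eq_bigr => g _; congr (_ * _).
  rewrite /wvec (eq_bigr (fun j : 'I_n.+1 => tb *m (pt_eval i (wcol N r Q j) *:
      map_mx C (coord (i%:Z + j%:Z))))).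
    rewrite -mulmx_sumr !mxE; apply: eq_bigr => h _; congr (_ * _).
    by rewrite mxE summxE; apply: eq_bigr => m _; rewrite !mxE.
  move=> m _; rewrite tevecE ?scalemxAr //; have := ltn_ord m; have := ltn_ord i; lia.
have bp : (b < p)%N by lia.
have tN : forall k, (N < k)%N -> tpsX N A ^+ k = 0 by exact: tpsX_nilp.
have wtev i q e : wt (tpsX N R)%:P b q e -> wt (tpsX N A) b (pt_eval i q) e.
  have e' : pt_eval i (tpsX N R)%:P = tpsX N A by rewrite pt_evalE map_polyC hornerC /= tps_mapX.
  by move=> /(wt_map (pt_eval i)) wq; rewrite -e'.
have p_gt : (N * b < p)%N by lia.
have coordN (a : int) (k : 'I_p) : a <> k%:Z -> a <> k%:Z + p%:Z -> a <> k%:Z - p%:Z -> coord a k 0 = 0.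
  by move=> /eqP/negPf n1 /eqP/negPf n2 /eqP/negPf n3; rewrite mxE n1 n2 n3.
have coord1 (k : 'I_p) : coord k k 0 = 1 by rewrite mxE eqxx.
have detV : \det V = \prod_(i < p) pt_eval i.+1 (Theta N r Q n).
  rewrite (det_cyclic_tr tN b_gt0 p_gt) => [|k i]; last first.
    rewrite mxE; apply: wt_sum => [|j _]; first exact: wt_0.
    case: (pselect (coord (i%:Z + j%:Z) k 0 = 0)) => [->|nz]; first by rewrite rmorph0 mulr0; exact: wt_0.
    apply: wt_mulr; apply: wtev.
    have -> : ((k + p - i) %% p)%N = j.
      have := ltn_ord j; have := ltn_ord i; have := ltn_ord k => kp ip jn.
      case: (pselect (i%:Z + j%:Z = k%:Z)) => [e|n1].
        by rewrite (_ : (k + p - i)%N = (j + p)%N) ?modnDr ?modn_small //; lia.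
      case: (pselect (i%:Z + j%:Z = k%:Z + p%:Z)) => [e|n2].
        by rewrite (_ : (k + p - i)%N = j) ?modn_small //; lia.
      by case: nz; apply: coordN => //; lia.
    exact: (wt_wcol r Q0 b_gt0 bandQ).
  apply: eq_bigr => i _; rewrite mxE (bigD1 0) //= addr0 coord1 rmorph1 mulr1.
  rewrite big1 ?addr0 => [|j j0]; last first.
    have jn : j != 0%N :> nat by apply: contraNneq j0 => e; apply/eqP/val_inj.
    have := ltn_ord j => lt; rewrite coordN ?rmorph0 ?mulr0 //; lia.
  by rewrite wcol0 (pt_eval_comp i _ 1) addn1.
have detW : \det W = \prod_(i < p) pt_eval i (Theta N r Q n.+1).
  rewrite (det_cyclic tN b_gt0 p_gt) => [|k i]; last first.
    rewrite mxE; apply: wt_sum => [|j _]; first exact: wt_0.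
    case: (pselect (coord (i%:Z + (j%:Z - b%:Z)) k 0 = 0)) => [->|nz]; first by rewrite rmorph0 mulr0; exact: wt_0.
    apply: wt_mulr; apply: wtev.
    have -> : ((i + p - k) %% p)%N = `|j%:Z - b%:Z|%N.
      have := ltn_ord j; have := ltn_ord i; have := ltn_ord k => kp ip jn.
      case: (pselect (i%:Z + (j%:Z - b%:Z) = k%:Z)) => [e|n1].
        by rewrite (_ : (i + p - k)%N = (`|j%:Z - b%:Z| + p)%N) ?modnDr ?modn_small //; lia.
      case: (pselect (i%:Z + (j%:Z - b%:Z) = k%:Z - p%:Z)) => [e|n2].
        by rewrite (_ : (i + p - k)%N = `|j%:Z - b%:Z|%N) ?modn_small //; lia.
      by case: nz; apply: coordN => //; lia.
    exact: (wt_wimg r Q0 b_gt0 bandQ n_big).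
  apply: eq_bigr => i _; rewrite mxE (bigD1 ord_max) //= subrr addr0 coord1 rmorph1 mulr1.
  rewrite big1 ?addr0 => [|j j0]; last first.
    have jn : j != b :> nat by apply: contraNneq j0 => e; apply/eqP/val_inj.
    have := ltn_ord j => lt; have := ltn_ord i => ip; rewrite coordN ?rmorph0 ?mulr0 //; lia.
  by rewrite wimg0.
have [u bu] := basis_mx_unit eta c p_pr charA xx.
have := congr1 (fun M => \det M * C u) VE.
rewrite !det_mulmx detV detW /tb det_map_mx.
set d1 := \det (gD _ _); set d2 := \prod_(_ < p) _; set d3 := \prod_(_ < p) _ => E.
have Cu : C (\det basis) * C u = 1 by rewrite -rmorphM bu rmorph1.
transitivity (d1 * C (\det basis) * d2 * C u).
  by rewrite -[LHS]mulr1 -Cu; ring.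
by rewrite E mulrAC Cu mul1r.
Qed.
End MainIdentity.
End PSide.

(** * Cancellation and specialisation of the parameters *)

Lemma top_coefM (A : comNzRingType) (f g : {poly A}) a b :
  (size f <= a.+1)%N -> (size g <= b.+1)%N -> (f * g)`_(a + b) = f`_a * g`_b.
Proof.
move=> sf sg; have lt : (a < (a + b).+1)%N by rewrite ltnS leq_addr.
rewrite coefM (bigD1 (Ordinal lt)) //= addKn big1 ?addr0 // => i ia.
have [le|gt] := leqP i a; last by rewrite (nth_default _ (leq_trans sf gt)) mul0r.
have {le}lt' : (i < a)%N by rewrite ltn_neqAle le andbT.
by rewrite [g`_ _]nth_default ?mulr0 // (leq_trans sg) //; lia.
Qed.

Lemma top_coefX (A : comNzRingType) (g : {poly A}) k d :
  (size g <= k.+1)%N -> (g ^+ d)`_(d * k) = g`_k ^+ d.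
Proof.
move=> sg; elim: d => [|d IH]; first by rewrite !expr0 coef1.
rewrite !exprS mulSn top_coefM ?IH //; apply: leq_trans (size_poly_exp_leq _ _) _.
by rewrite ltnS mulnC leq_mul2l; apply/orP; right; lia.
Qed.

Lemma comp_top (A : comNzRingType) (q g : {poly A}) k : (0 < k)%N ->
  (size g <= k.+1)%N -> (q \Po g)`_((size q).-1 * k) = lead_coef q * g`_k ^+ (size q).-1.
Proof.
move=> k0 sg; have [->|q0] := eqVneq q 0; first by rewrite comp_poly0 lead_coef0 coef0 mul0r.
have sq : size q = (size q).-1.+1 by rewrite prednK // size_poly_gt0.
rewrite comp_polyE [in X in X = _]sq big_ord_recr /= coefD coef_sum coefZ top_coefX //.
rewrite big1 ?add0r // => i _; rewrite coefZ [(g ^+ _)`_ _]nth_default ?mulr0 //.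
apply: leq_trans (size_poly_exp_leq _ _) _.
have : ((size g).-1 * i <= k * i)%N by rewrite leq_mul2r; apply/orP; right; lia.
have := ltn_ord i; nia.
Qed.

Lemma size_comp_top (A : comNzRingType) (q g : {poly A}) k :
  (size g <= k.+1)%N -> (size (q \Po g) <= ((size q).-1 * k).+1)%N.
Proof.
move=> sg; apply: leq_trans (size_comp_poly_leq _ _) _; rewrite ltnS leq_mul2l.
by apply/orP; right; lia.
Qed.

Lemma tps_cancel (A : comNzRingType) N (u v : tps N A) :
  (forall m, u m * v 0%N = 0 -> u m = 0) -> u * v = 0 -> u = 0.
Proof.
move=> reg uv; apply: tpsP => m; rewrite tps_coef0.
have [k] := ubnP m; elim: k m => // k IH m lt le; apply: reg.
have : (u * v) m = 0 by rewrite uv tps_coef0.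
rewrite tps_coefM // big_ord_recr /= subnn big1 ?add0r // => i _.
by rewrite IH ?mul0r //; have := ltn_ord i; lia.
Qed.

Lemma tps_map_comp N (A B D : comNzRingType) (f : {rmorphism A -> B}) (g : {rmorphism B -> D})
  (x : tps N A) : tps_map g (tps_map f x) = tps_map (g \o f) x.
Proof. by apply: tpsP => m _; rewrite !tps_mapE. Qed.

Section Naturality.
Variables (R A A' : comNzRingType) (phi : {rmorphism R -> A}) (phi' : {rmorphism R -> A'}).
Variable g : {rmorphism A -> A'}.
Hypothesis phiE : forall x, phi' x = g (phi x).
Variables (p' N : nat) (xi xi' eta : A).

Lemma gx_map : gx p' (g xi) = map_mx g (gx p' xi).
Proof.
apply/matrixP => i j; rewrite !mxE rmorphD /= rmorph_nat; congr (_ + _).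
by rewrite rmorphMn.
Qed.
Lemma gd_map : gd p' (g eta) = map_mx g (gd p' eta).
Proof.
by apply/matrixP => i j; rewrite !mxE rmorphD !rmorphMn /= rmorph1.
Qed.
Lemma gxpow_map a : gxpow p' (g xi) (g xi') a = map_mx g (gxpow p' xi xi' a).
Proof.
case: a => n; first by rewrite /= gx_map rmorphXn.
by rewrite /gxpow rmorphXn; congr (_ ^+ _); rewrite /gx_inv -[RHS]/(map_mx g _) map_mxZ gx_map !rmorphXn.
Qed.
Lemma gdiff_map q : gdiff phi' p' (g xi) (g xi') (g eta) q =
  map_mx g (gdiff phi p' xi xi' eta q).
Proof.
rewrite /gdiff rmorph_sum; apply: eq_bigr => e _.
by rewrite gxpow_map gd_map phiE -[RHS]/(map_mx g _) map_mxZ map_mxM rmorphXn.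
Qed.
Lemma gP_map r : gP phi' p' (g xi) (g eta) r = map_mx g (gP phi p' xi eta r).
Proof.
rewrite /gP rmorph_prod; apply: eq_bigr => z _.
by rewrite -[RHS]/(map_mx g _) map_mxB map_mxM map_scalar_mx gx_map gd_map phiE.
Qed.
Lemma gD_map r Q : gD phi' p' (g xi) (g xi') (g eta) N r Q =
  map_mx (@tps_map N _ _ g) (gD phi p' xi xi' eta N r Q).
Proof.
have mapC (M : 'M[A]_p'.+1) : map_mx (@tpsC N A') (map_mx g M) = map_mx (@tps_map N _ _ g) (map_mx (@tpsC N A) M).
  by apply/matrixP => i j; rewrite !mxE tps_mapC.
rewrite /gD gP_map mapC -[RHS]/(map_mx _ _) map_mxD; congr (_ + _).
rewrite map_mx_sum; apply: eq_bigr => m _.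
by rewrite gdiff_map mapC map_mxZ rmorphXn /= tps_mapX.
Qed.

Definition target (l : nat) (s : 'I_l -> R) (w : 'I_l -> {poly (tps N R)}) k (A0 : comNzRingType)
    (f : {rmorphism R -> A0}) (x y : A0) : tps N A0 :=
  (-1) ^+ k * \prod_i (map_poly (@tps_map N _ _ f) (w i)).[
     tpsC N (- (x ^+ p'.+1 * y ^+ p'.+1) - f (s i) + f (s i) ^+ p'.+1)].

Lemma target_map l (s : 'I_l -> R) w k :
  target s w k phi' (g xi) (g eta) = tps_map g (target s w k phi xi eta).
Proof.
rewrite /target rmorphM rmorphXn rmorphN1 rmorph_prod; congr (_ * _); apply: eq_bigr => i _.
rewrite -[RHS]/(tps_map g _) -horner_map -map_poly_comp /= tps_mapC; congr _.[tpsC N _].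
  by apply: eq_map_poly => x /=; rewrite tps_map_comp; apply: tpsP => m _; rewrite !tps_mapE phiE.
by rewrite !rmorphD !rmorphN rmorphM !rmorphXn /= !phiE.
Qed.
End Naturality.

Section Param.
Variables (R : comNzRingType) (B : comUnitRingType) (phi : {rmorphism R -> B}).
Variables (p : nat) (xi eta : B).
Hypothesis par : is_param_ring p phi xi eta.

Definition psi1 : {rmorphism {poly R} -> B} := horner_eval xi \o map_poly phi.
Definition psi0 : {rmorphism {poly {poly R}} -> B} := horner_eval xi^-1 \o map_poly psi1.

Lemma psi1C a : psi1 a%:P = phi a.
Proof. by rewrite /psi1 /= map_polyC /horner_eval hornerC. Qed.
Lemma psi0C a : psi0 a%:P = psi1 a.
Proof. by rewrite {1}/psi0 /= map_polyC /horner_eval hornerC. Qed.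
Lemma psi1X : psi1 'X = xi.
Proof. by rewrite /psi1 /= map_polyX /horner_eval hornerX. Qed.
Lemma psi0X : psi0 'X = xi^-1.
Proof. by rewrite /psi0 /= map_polyX /horner_eval hornerX. Qed.

Lemma xi_unit : xi \is a GRing.unit. Proof. by case: par. Qed.

Lemma param_char : p%:R = 0 :> B.
Proof.
have [pz _ _ _] := par; rewrite -(rmorph_nat phi); apply/pz.
by exists 1.
Qed.

Lemma psi0_clear v : exists m q, xi ^+ m * psi0 v = psi1 q.
Proof.
elim/poly_ind: v => [|v a [m [q E]]].
  by exists 0%N, 0; rewrite !rmorph0 mulr0.
exists m.+1, (q + 'X^(m.+1) * a); rewrite !rmorphD !rmorphM -E psi0X psi0C rmorphXn psi1X /=.
by rewrite mulrDr; congr (_ + _); rewrite exprSr mulrACA divrr ?xi_unit ?mulr1.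
Qed.

(** A power of xi clears the negative exponents; algebraic independence of the parameters then
    reduces the claim to each coefficient in R/(p). *)
Lemma param_regular kappa :
  (forall x y, kappa * x = y *+ p -> exists z, x = z *+ p) ->
  forall v, phi kappa * psi0 v = 0 -> psi0 v = 0.
Proof.
move=> reg v kv; have [m [q E]] := psi0_clear v.
suff q0 : psi1 q = 0.
  by apply: (mulrI (unitrX m xi_unit)); rewrite E q0 mulr0.
have [pz _ _ indep] := par.
have : psi1 (kappa%:P * q) = 0 by rewrite rmorphM psi1C -E mulrCA kv mulr0.
rewrite /psi1 /= /horner_eval => kq.
have := indep (map_poly (@polyC R) (kappa%:P * q)).
have -> : map_poly (map_poly phi) (map_poly (@polyC R) (kappa%:P * q)) =
    map_poly (@polyC B) (map_poly phi (kappa%:P * q)).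
  by rewrite -!map_poly_comp; apply: eq_map_poly => x /=; rewrite map_polyC.
rewrite horner_map kq rmorph0 horner0 => /(_ erefl) z.
rewrite (_ : map_poly phi q = 0) ?horner0 //; apply/polyP => i; rewrite coef0 coef_map /=.
have /pz[y yE] : phi (kappa * q`_i) = 0.
  have := congr1 (fun f : {poly {poly B}} => f`_i`_0) z.
  by rewrite coef_map /= coefC eqxx coef_map /= mul_polyC coefZ !coef0.
by have [x ->] := reg _ _ yE; apply/pz; exists x.
Qed.
End Param.

Section Pointwise.
Variables (R : idomainType) (r : seq R) (Q : nat -> diffop R).
Hypothesis Q0 : Q 0%N = [fsfun].
Variables (l : nat) (s : 'I_l -> R) (N : nat) (wR : 'I_l -> {poly (fps R)}).
Variables (d : 'I_l -> nat) (k : nat).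
Hypothesis w_monic : forall i, wT N (wR i) \is monic.
Hypothesis w_const : forall i, map_poly (@tps_const N R) (wT N (wR i)) = 'X^(d i).
Hypothesis d_sum : (\sum_i d i)%N = k.
Variables (b n : nat) (e : {poly R}) (G : tps N {poly R}).
Hypotheses (b_gt0 : (0 < b)%N) (n_big : (N * b <= n)%N).
Hypothesis bandQ : forall m e, (m <= N)%N -> e \in finsupp (Q m) ->
  (`|e.1 - e.2%:Z| <= b)%N.
Hypotheses (e0 : e != 0) (G0 : G 0%N != 0).
Hypothesis char0_id : theta r Q N n.+1 * G * tpsC N (e \Po Xplus R 1) =
   Wprod s N wR * tsw 1 (theta r Q N n) * tsw 1 G * tpsC N e.
Variable p' : nat.
Local Notation p := p'.+1.
Hypothesis p_pr : prime p.
Hypothesis p_big : (n + b < p)%N.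
Hypothesis p_big_d : forall i, (d i * N.+1 <= p)%N.
Variables (B : comUnitRingType) (phi : {rmorphism R -> B}) (xi eta : B).
Hypothesis par : is_param_ring p phi xi eta.
Definition regular_at (kappa : R) := forall x y, kappa * x = y *+ p -> exists z, x = z *+ p.
Hypotheses (e_reg : regular_at (lead_coef e)) (G_reg : regular_at (lead_coef (G 0%N))).

Local Notation psi0 := (psi0 phi xi).
Definition in_image (u : {poly B}) := exists v, u = map_poly psi0 v.
(** [B] may have zero divisors, so cancellation is asked only against polynomials with coefficients
    in the image of [psi0], which is R/(p)[xi, xi^-1]. *)
Definition cancelable (f : {poly B}) :=
  in_image f /\ forall u, in_image u -> u * f = 0 -> u = 0.

Lemma cancelableM f g : cancelable f -> cancelable g -> cancelable (f * g).
Proof.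
move=> [[v vE] fr] [[w wE] gr]; split; first by exists (v * w); rewrite rmorphM /= -vE -wE.
move=> u [x xE] ufg; apply: fr; first by exists x.
apply: gr; last by rewrite -mulrA.
by exists (x * v); rewrite rmorphM /= -xE -vE.
Qed.
Lemma cancelable1 : cancelable 1.
Proof. by split=> [|u _]; [exists 1; rewrite rmorph1 | rewrite mulr1]. Qed.
Lemma cancelable_prod (I : Type) (x : seq I) (f : I -> {poly B}) :
  (forall i, cancelable (f i)) -> cancelable (\prod_(i <- x) f i).
Proof. by move=> fr; apply: big_ind => //; [exact: cancelable1 | exact: cancelableM]. Qed.

(** X^p + i is monic, so the leading coefficient of the composite is the image of that of q, which
    is regular on the image of [psi0]. *)
Lemma cancelable_comp q i : q != 0 -> regular_at (lead_coef q) ->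
  cancelable (map_poly phi q \Po ('X^p + i%:R)).
Proof.
move=> q0 qr; have reg := param_regular par qr.
have pk : phi (lead_coef q) != 0.
  apply/eqP => z; have := reg 1; rewrite rmorph1 z mulr1 => /(_ erefl)/eqP.
  by rewrite oner_eq0.
have sq : size (map_poly phi q) = size q by exact: size_poly_eq.
have lq : lead_coef (map_poly phi q) = phi (lead_coef q) by rewrite lead_coefE sq coef_map -lead_coefE.
have szm : (size ('X^p + i%:R : {poly B})%R <= p.+1)%N.
  rewrite -polyC_natr (leq_trans (size_polyD _ _)) // geq_max size_polyXn leqnn /=.
  by rewrite (leq_trans (size_polyC_leq1 _)).
have top : ('X^p + i%:R : {poly B})`_p = 1.
  by rewrite coefD coefXn eqxx -polyC_natr coefC addr0.
split.
  exists (map_poly (@polyC _ \o @polyC R) q \Po ('X^p + i%:R)).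
  rewrite map_comp_poly rmorphD rmorph_nat rmorphXn /= map_polyX -map_poly_comp; congr (_ \Po _).
  by apply: eq_map_poly => x; rewrite -[RHS]/(psi0 (x%:P)%:P) psi0C psi1C.
move=> u [v vE] uf; apply/eqP; rewrite -lead_coef_eq0; apply/eqP.
have := congr1 (fun f : {poly B} => f`_((size u).-1 + (size (map_poly phi q)).-1 * p)) uf.
rewrite coef0 top_coefM ?leqSpred ?size_comp_top // comp_top // top expr1n mulr1.
have uE j : u`_j = psi0 v`_j by rewrite vE coef_map.
by rewrite lq mulrC [lead_coef u]lead_coefE uE; exact: reg.
Qed.

Local Notation A := {poly B}.
Local Notation phiA := (@polyC B \o phi).
Local Notation xiA := (xi%:P : A).
Local Notation xiA' := (xi^-1%:P : A).
(** Put in place of eta, this makes c = X^p a solution of c^p - c = (xi h)^p, by Frobenius. *)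
Let h : A := xiA' * ('X^p - 'X).
Let c : A := 'X^p.

Let charB : p%:R = 0 :> B. Proof. exact: (param_char par). Qed.
Let charA : p%:R = 0 :> A.
Proof. by rewrite -(rmorph_nat (@polyC B)) charB rmorph0. Qed.
Let xxA : xiA * xiA' = 1.
Proof. by rewrite -polyCM divrr // (xi_unit par). Qed.

Let c_eq : c ^+ p - c = (xiA * h) ^+ p.
Proof.
rewrite /h mulrA xxA mul1r /c -{1}['X^p](subrK 'X).
by rewrite (frobenius_comm p_pr charA (mulrC _ _)) addrK.
Qed.

Definition at_shift (i : nat) : {rmorphism tps N {poly R} -> tps N A} :=
  @tps_map N _ _ (horner_eval (c + i%:R) \o map_poly phiA).
Local Notation E := at_shift.

Lemma at_shift_swap i q : E i (swap q) = pt_eval phiA c i q.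
Proof.
rewrite [LHS]swap_eval pt_evalE /= map_polyX /horner_eval hornerX; congr _.[_].
by apply: eq_map_poly => x; apply: tpsP => m _; rewrite !tps_mapE /= map_polyC /horner_eval hornerC.
Qed.

Lemma at_shift_next i x : E i (tsw 1 x) = E i.+1 x.
Proof.
apply: tpsP => m _; rewrite !tps_mapE /= map_comp_poly /horner_eval horner_comp; congr _.[_].
rewrite /Xplus rmorphD /= map_polyX map_polyC /= hornerD hornerX hornerC rmorph1 polyC1.
by rewrite -addrA natr1.
Qed.

Lemma prod_at_shift_next x : \prod_(i < p) E i.+1 x = \prod_(i < p) E i x.
Proof.
rewrite big_ord_recr big_ord_recl /= mulrC; congr (_ * _).
by apply: tpsP => m _; rewrite !tps_mapE /= /horner_eval charA addr0.
Qed.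

Lemma at_shift_const i x : E i x 0%N = map_poly phi (x 0%N) \Po ('X^p + i%:R).
Proof.
by rewrite tps_mapE /= /horner_eval /comp_poly -map_poly_comp.
Qed.

Local Notation wT i := (wT N (wR i)).

Local Notation C := (@tpsC N A).

(** [prod_monic_shift] with y = c - s_j, where y^p - y = (xi h)^p - s_j^p + s_j. *)
Lemma prod_at_shift_W : \prod_(i < p) E i (Wprod s N wR) =
  target p' s (fun i => wT i) k phiA xiA h.
Proof.
have charT : p%:R = 0 :> tps N A by rewrite -(rmorph_nat C) charA rmorph0.
have step j : \prod_(i < p) E i (swap (Wi s N wR j)) =
    (-1) ^+ d j * (map_poly (@tps_map N _ _ phiA) (wT j)).[
      C (- (xiA ^+ p * h ^+ p) - phiA (s j) + phiA (s j) ^+ p)].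
  have mon : map_poly (@tps_map N _ _ phiA) (wT j) \is monic by rewrite monic_map.
  rewrite (_ : C _ = - (C (c - phiA (s j)) ^+ p - C (c - phiA (s j)))); last first.
    have Cm y : C (- (y ^+ p - y)) = - (C y ^+ p - C y) by rewrite rmorphN rmorphB rmorphXn.
    rewrite -Cm; congr (tpsC N _).
    have e1 : (c - phiA (s j)) ^+ p = c ^+ p - phiA (s j) ^+ p.
      by rewrite -[c in RHS](subrK (phiA (s j))) [in RHS](frobenius_comm p_pr charA (mulrC _ _)) addrK.
    by rewrite e1 -exprMn -c_eq; ring.
  rewrite -(prod_monic_shift p_pr charA (C (c - phiA (s j))) mon (d := d j)) //; last first.
    transitivity (map_poly phiA (map_poly (@tps_const N R) (wT j))); last first.
      by rewrite w_const map_polyXn.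
    rewrite -(map_poly_comp (@tps_const N A)) -(map_poly_comp phiA).
    by apply: eq_map_poly => x; rewrite /= /tps_const tps_mapE.
  apply: eq_bigr => i _; rewrite at_shift_swap /Wi pt_evalE map_comp_poly horner_comp; congr _.[_].
  rewrite rmorphD /= map_polyX map_polyC /= hornerD hornerX hornerC tps_mapC /=.
  have CD x y : C (x + y) = C x + C y by exact: rmorphD.
  by rewrite -[in RHS](rmorph_nat C) -!CD rmorphN polyCN addrAC.
rewrite /Wprod (eq_bigr (fun i : 'I_p => \prod_j E i (swap (Wi s N wR j)))); last first.
  by move=> i _; rewrite rmorph_prod.
rewrite exchange_big (eq_bigr _ (fun j _ => step j)) big_split /=.
by rewrite prodrXr d_sum.
Qed.

Let PhiA := \prod_(i < p) E i.+1 (theta r Q N n) * \prod_(i < p) E i G *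
  \prod_(i < p) E i (tpsC N e).

(** [char_zero_identity] multiplied over c, ..., c+p-1, combined with [cyclic_identity]. As c + p =
    c, the product of the factors at c+i+1 equals that of the factors at c+i, so the extra factors
    are common to both sides. *)
Lemma det_target_cancel :
  (\det (gD phiA p' xiA xiA' h N r Q) - target p' s (fun i => wT i) k phiA xiA h) * PhiA = 0.
Proof.
have cyc := cyclic_identity phiA p_pr charA xxA c_eq r Q0 b_gt0 bandQ n_big p_big.
rewrite -!(eq_bigr _ (fun i _ => at_shift_swap _ _)) in cyc.
rewrite mulrBl -prod_at_shift_W /PhiA.
have EM i x y : E i (x * y) = E i x * E i y by exact: rmorphM.
have prodE : \prod_(i < p) E i (theta r Q N n.+1) * \prod_(i < p) E i G * \prod_(i < p) E i (tpsC N e) =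
  \prod_(i < p) E i (Wprod s N wR) * \prod_(i < p) E i.+1 (theta r Q N n) * \prod_(i < p) E i G *
     \prod_(i < p) E i (tpsC N e).
  rewrite -[in LHS](prod_at_shift_next (tpsC N e)) -[in RHS](prod_at_shift_next G) -!big_split.
  apply: eq_bigr => i _ /=; rewrite -!at_shift_next -!EM.
  have -> : tsw 1 (tpsC N e) = tpsC N (e \Po Xplus R 1) by exact: tps_mapC.
  by rewrite char0_id.
by rewrite !mulrA cyc prodE subrr.
Qed.

Let PhiA_cancelable : cancelable (PhiA 0%N).
Proof.
have c1 i (x : tps N {poly R}) : x 0%N != 0 -> regular_at (lead_coef (x 0%N)) -> cancelable (E i x 0%N).
  by move=> x0 xr; rewrite at_shift_const; exact: cancelable_comp.
have cp (x : nat -> tps N A) : (forall i, cancelable (x i 0%N)) -> cancelable ((\prod_(i < p) x i) 0%N).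
  move=> xc; rewrite -[X in cancelable X]/(tps_const _) rmorph_prod.
  by apply: cancelable_prod => i; exact: xc.
rewrite /PhiA !tps_coef0M; apply: cancelableM; first apply: cancelableM.
- apply: (cp (fun i => E i.+1 _)) => i.
  have th1 : theta r Q N n 0%N \is monic.
    rewrite theta0 //; apply: monic_prod => j _; rewrite /indicial rmorph_prod; apply: monic_prod => z _ /=.
    rewrite comp_polyB comp_polyX comp_polyC /Xplus -addrA -polyCB -opprB polyCN; exact: monicXsubC.
  apply: c1; first exact: monic_neq0.
  by rewrite (monicP th1) => x y; rewrite mul1r => ->; exists y.
- by apply: (cp (fun i => E i _)) => i; exact: c1.
- by apply: (cp (fun i => E i _)) => i; apply: c1; rewrite tps_coefC.
Qed.

Local Notation U := {poly {poly {poly R}}}.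
Let phiU : {rmorphism R -> U} := @polyC _ \o (@polyC _ \o @polyC R).
Let xiU : U := ('X%:P)%:P.
Let xiU' : U := 'X%:P.
(** The difference of the two sides with independent variables for xi, xi^-1 and eta; [to_h] and
    [to_eta] are its specialisations with eta replaced by [h] and by [eta]. *)
Let DeltaU : tps N U := \det (gD phiU p' xiU xiU' 'X N r Q) -
  target p' s (fun i => wT i) k phiU xiU 'X.
Let to_h : {rmorphism U -> A} := comp_poly h \o map_poly psi0.
Let to_eta : {rmorphism U -> B} := horner_eval eta \o map_poly psi0.

Let DeltaU_map (A0 : comNzRingType) (phi0 : {rmorphism R -> A0}) (g : {rmorphism U -> A0}) :
  (forall x, phi0 x = g (phiU x)) ->
  tps_map g DeltaU = \det (gD phi0 p' (g xiU) (g xiU') (g 'X) N r Q) -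
    target p' s (fun i => wT i) k phi0 (g xiU) (g 'X).
Proof.
move=> gphi; rewrite (gD_map gphi) (target_map gphi) /DeltaU.
by rewrite rmorphB /= -det_map_mx.
Qed.

Let psi0_xi : psi0 'X%:P = xi. Proof. by rewrite psi0C psi1X. Qed.

(** The specialisation at h vanishes after cancellation. As h has degree p and invertible leading
    coefficient xi^-1, substituting h is injective on polynomials over [B], so the difference
    vanishes as a polynomial in eta and may be evaluated at the given one. *)
Lemma det_eq_target :
  \det (gD phi p' xi xi^-1 eta N r Q) = target p' s (fun i => wT i) k phi xi eta.
Proof.
have Dh : tps_map to_h DeltaU = 0.
  apply: (tps_cancel (v := PhiA)); last first.
    rewrite (DeltaU_map (phi0 := phiA)) => [|x].
      have -> : to_h xiU = xiA by rewrite /to_h /= map_polyC /= comp_polyC; congr _%:P.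
      have -> : to_h xiU' = xiA' by rewrite /to_h /= map_polyC /= comp_polyC; congr _%:P; exact: psi0X.
      have -> : to_h 'X = h by rewrite /to_h /= map_polyX comp_polyX.
      exact: det_target_cancel.
    rewrite /to_h /= map_polyC /= comp_polyC; congr _%:P.
    by rewrite -[RHS]/(psi0 (x%:P)%:P) psi0C psi1C.
  move=> m; case: PhiA_cancelable => _; apply; rewrite tps_mapE.
  exists (DeltaU m \Po ('X%:P * ('X^p - 'X))).
  rewrite /to_h /= map_comp_poly rmorphM rmorphB /= map_polyXn map_polyX map_polyC /=.
  by congr (_ \Po (_%:P * _)); exact: esym (psi0X _ _).
have De : tps_map to_eta DeltaU = 0.
  apply: tpsP => m _; rewrite tps_coef0 tps_mapE.
  (* If f(h) = 0, its top coefficient, the leading coefficient of f times a power of xi^-1, is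
     zero. *)
  suff f0 : map_poly psi0 (DeltaU m) = 0 by rewrite /to_eta /= f0 /horner_eval horner0.
  have fh : map_poly psi0 (DeltaU m) \Po h = 0.
    by rewrite -[LHS]/(to_h (DeltaU m)) -tps_mapE Dh tps_coef0.
  move: (map_poly psi0 (DeltaU m)) fh => f fh; apply/eqP; rewrite -lead_coef_eq0; apply/eqP.
  have szh : (size h <= p.+1)%N.
    rewrite /h mul_polyC (leq_trans (size_scale_leq _ _)) // (leq_trans (size_polyD _ _)) //.
    by rewrite size_polyN size_polyXn size_polyX geq_max leqnn ltnS prime_gt0.
  have hp : h`_p = xi^-1.
    by rewrite /h mul_polyC coefZ coefB coefXn eqxx coefX gtn_eqF ?prime_gt1 // subr0 mulr1.
  have := congr1 (fun q : A => q`_((size f).-1 * p)) fh; rewrite comp_top // hp coef0.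
  move=> fx; have xu : xi^-1 ^+ (size f).-1 \is a GRing.unit by rewrite unitrX // unitrV (xi_unit par).
  by apply: (mulIr xu); rewrite fx mul0r.
have := De; rewrite (DeltaU_map (phi0 := phi)) => [|x]; last first.
  rewrite /to_eta /= map_polyC /= /horner_eval hornerC.
  by rewrite -[RHS]/(psi0 (x%:P)%:P) psi0C psi1C.
have -> : to_eta xiU = xi by rewrite /to_eta /= map_polyC /= /horner_eval hornerC.
have -> : to_eta xiU' = xi^-1 by rewrite /to_eta /= map_polyC /= /horner_eval hornerC; exact: psi0X.
have -> : to_eta 'X = eta by rewrite /to_eta /= map_polyX /horner_eval hornerX.
by move/eqP; rewrite subr_eq0 => /eqP.
Qed.
End Pointwise.

(** * Comparison with the given representation and conclusion *)

Section Bridge.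
Variables (R : comNzRingType) (B : comUnitRingType) (phi : {rmorphism R -> B}).
Variables (p' N : nat) (xi eta : B).
Local Notation p := p'.+1.
Hypotheses (p_pr : prime p) (charB : p%:R = 0 :> B) (xi_unit : xi \is a GRing.unit).

Lemma rho_xpowE a : rho_xpow p xi a = gxpow p' xi xi^-1 a.
Proof.
have xx : xi * xi^-1 = 1 by rewrite divrr.
have inv : invmx (rho_x p xi) = gx_inv p' xi xi^-1.
  have e : rho_x p xi *m gx_inv p' xi xi^-1 = 1%:M by exact: (gx_gx_inv p_pr charB xx).
  have [u _] := mulmx1_unit e.
  by rewrite -[LHS]mulmx1 -e mulmxA mulVmx // mul1mx.
by case: a => n //=; rewrite inv.
Qed.

Lemma rho_D_trunc r Q : map_mx (@tps_of N B) (rho_D phi p xi eta r Q) =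
  gD phi p' xi xi^-1 eta N r Q.
Proof.
apply/matrixP => i j; rewrite !mxE summxE; apply: tpsP => m le.
rewrite tps_ofE // coef_FPS tps_coefD tps_coefC tps_coef_sum; congr (_ + _).
rewrite (bigD1 (Ordinal (le : (m < N.+1)%N))) //= !mxE tps_coefXnM // leqnn subnn tps_coefC /=.
rewrite big1 ?addr0 => [|h hm]; last first.
  rewrite !mxE tps_coefXnM //; case: leqP => // hle; rewrite tps_coefC ifF //.
  apply: contraNF hm; rewrite subn_eq0 => lem; apply/eqP/val_inj/eqP.
  by rewrite /= eqn_leq hle.
rewrite /rho_diffop /gdiff; congr (fun_of_matrix _ i j).
by apply: eq_bigr => e _; rewrite rho_xpowE.
Qed.
End Bridge.

Lemma sum_class_mult (R : comNzRingType) (r : seq R) l (s : 'I_l -> R) :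
  smallest_reps r s -> (\sum_i class_mult r (s i))%N = size r.
Proof.
move=> [_ ne rep]; rewrite /class_mult.
elim: r rep => [|z r IH] rep /=; first by rewrite big1.
rewrite big_split IH => [|y yr]; last by apply: rep; rewrite in_cons yr orbT.
have [i [n zE]] := rep z (mem_head _ _).
have zi : int_diff z (s i) by exists n; rewrite zE addrC addKr.
rewrite (bigD1 i) //= asboolT // big1 ?addn0 // => j ji.
rewrite asboolF // => -[m zm]; apply: (ne j i ji); exists (n%:Z - m).
by rewrite intrB -zm zE -[n%:~R]/(n%:R); ring.
Qed.

(** The denominator is prime to p and hence invertible in A by an integer, so a is the image of an
    integer and is fixed by Frobenius. *)
Lemma frobenius_rational (A : comNzRingType) p (a : A) (num den : int) :
  prime p -> p%:R = 0 :> A -> (`|den| < p)%N -> den != 0 ->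
  den%:~R * a = num%:~R -> a ^+ p = a.
Proof.
move=> p_pr charA den_p den0 E.
have ch : p \in [pchar A] by rewrite inE p_pr charA eqxx.
have intp (z : int) : z%:~R ^+ p = z%:~R :> A.
  by rewrite -[LHS]/(pFrobenius_aut ch _) rmorph_int.
have /coprimezP[[u v] /= uv] : coprimez den p%:Z.
  rewrite coprimezE coprime_sym prime_coprime //; apply/negP => /dvdn_leq.
  by rewrite absz_gt0 den0 leqNgt den_p => /(_ isT).
have ud : u%:~R * den%:~R = 1 :> A.
  have := congr1 (fun z : int => z%:~R : A) uv.
  by rewrite intrD !intrM -[p%:Z%:~R]/(p%:R) charA mulr0 addr0.
rewrite -[LHS]mul1r -[RHS]mul1r -ud -!mulrA; congr (_ * _).
by rewrite E -(intp den) -exprMn E intp.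
Qed.

Section Domain.
Variables (K : fieldType) (charK : [pchar K] =i pred0).
Variables (S : fieldType) (incl : {rmorphism K -> S}).
Variables (R : idomainType) (iota : {rmorphism R -> K}) (iota_inj : injective iota).
Hypothesis R_fg : fin_gen_ring R.
Variables (k : nat) (r : k.-tuple R) (Q : nat -> diffop R) (Q0 : Q 0%N = [fsfun]).
Variables (l : nat) (s : 'I_l -> R) (s_reps : smallest_reps r s).
Variables (L : 'I_l -> nat) (L_gt0 : forall i, (0 < L i)%N).
Variable lam : forall i : 'I_l, 'I_(class_mult r (s i)) -> fps S.
Hypothesis lam_exp : forall i,
  is_exponents incl iota (iota (s i)) r Q (L i) (@lam i).
Variable w : 'I_l -> {poly (fps K)}.
Hypothesis w_def : forall i, map_poly (fps_ramify incl (L i)) (w i) =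
  \prod_(j < class_mult r (s i)) ('X - (@lam i j)%:P).
Variable N : nat.
Variable wR : 'I_l -> {poly (fps R)}.
Hypothesis wR_lift : forall i a m, (m <= N)%N -> iota ((wR i)`_a m) = (w i)`_a m.

Lemma det_rho_mod : exists C : nat, forall p, prime p -> (C < p)%N ->
   forall (B : comUnitRingType) (phi : {rmorphism R -> B}) (xi eta : B),
   is_param_ring p phi xi eta ->
   forall m, (m <= N)%N ->
     (\det (rho_D phi p xi eta r Q)) m =
     ((-1) ^+ k * \prod_(i < l) (map_poly (fps_map phi) (wR i)).[
          fpsC (- (xi ^+ p * eta ^+ p) - phi (s i) + phi (s i) ^+ p)]) m.
Proof.
have [b [n [e [G [[b0 nb] bandQ e0 G0 id0]]]]] :=
  char_zero_identity charK iota_inj Q0 s_reps L_gt0 lam_exp w_def wR_lift.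
have reg (h : R) : h != 0 -> forall x, h * x = 0 -> x = 0.
  by move=> h0 x /eqP; rewrite mulf_eq0 (negPf h0) => /eqP.
have [|C1 C1P] := regular_mod_prime R_fg (h := lead_coef e); first by apply: reg; rewrite lead_coef_eq0.
have [|C2 C2P] := regular_mod_prime R_fg (h := lead_coef (G 0%N)); first by apply: reg; rewrite lead_coef_eq0.
(* C1 and C2 keep the leading coefficients of e and G regular modulo p; n + b lets the window and
   its band fit into the cycle; k (N+1) bounds the nilpotency order of the companion matrices of the
   w_i. *)
exists (C1 + C2 + n + b + k * N.+1)%N => -[//|p'] p_pr p_big B phi xi eta par m le.
have d_sum : (\sum_i class_mult r (s i))%N = k by rewrite sum_class_mult // size_tuple.
have w_monic i : wT N (wR i) \is monic.
  have [m0 m0P] := class_bound charK iota r (s i).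
  exact: (wT_monic charK iota_inj Q0 bandQ (L_gt0 i) (lam_exp i) (w_def i) (wR_lift i) m0P).
have w_const i := wT_const iota_inj (lam_exp i) (w_def i) (wR_lift i).
have p_big_d i : (class_mult r (s i) * N.+1 <= p'.+1)%N.
  have dk : (class_mult r (s i) <= k)%N by apply: leq_trans (count_size _ _) _; rewrite size_tuple.
  by apply: (@leq_trans (k * N.+1)); [rewrite leq_mul2r dk orbT | lia].
have reg1 : regular_at p' (lead_coef e) by apply: C1P => //; lia.
have reg2 : regular_at p' (lead_coef (G 0%N)) by apply: C2P => //; lia.
have nb_lt : (n + b < p'.+1)%N by lia.
have main := det_eq_target Q0 w_monic w_const d_sum b0 nb bandQ e0 G0 id0 p_pr nb_lt p_big_d
  par reg1 reg2.
rewrite -(tps_ofE (N := N) _ le) -[X in _ = X](tps_ofE (N := N) _ le); congr (tps_fps _ m).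
rewrite -det_map_mx (rho_D_trunc phi N eta p_pr (param_char par) (xi_unit par)) main.
rewrite /target rmorphM rmorphXn rmorphN1 rmorph_prod; congr (_ * _); apply: eq_bigr => i _.
rewrite -horner_map; congr _.[_]; rewrite -!map_poly_comp; apply: eq_map_poly => x /=.
exact: tps_map_of.
Qed.
End Domain.

(** Phrased as an equality of rings so that the ring of the theorem, with everything depending on
    it, can be replaced by one carrying the domain structure. *)
Lemma idomain_structure (R : comNzRingType) : (forall x y : R, x * y = 0 -> x = 0 \/ y = 0) ->
  exists RI : idomainType, (RI : comNzRingType) = R.
Proof. move=> H; exists (idomain_of H); case: R H => T [*]. reflexivity. Qed.

Theorem corollary3p1
  (* the field, its algebraic closure, and the finitely generated subring R *)
  (K : fieldType) (charK : [pchar K] =i pred0)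
  (Kbar : closedFieldType) (incl : {rmorphism K -> Kbar})
  (Kbar_alg : forall z : Kbar, algebraicOver incl z)
  (R : comNzRingType) (iota : {rmorphism R -> K})
  (iota_inj : injective iota) (R_fg : fin_gen_ring R)
  (* D = P + Q with P = prod_j (x d/dx - r_j) and Q in t Diff[[t]] *)
  (k : nat) (r : k.-tuple R)
  (Q : nat -> diffop R) (Q0 : Q 0%N = [fsfun])
  (* s_i, lambda_ij and w_i *)
  (l : nat) (s : 'I_l -> R) (s_reps : smallest_reps r s)
  (L : 'I_l -> nat) (L_gt0 : forall i, (0 < L i)%N)
  (lam : forall i : 'I_l, 'I_(class_mult r (s i)) -> fps Kbar)
  (lam_exp : forall i,
     is_exponents incl iota (iota (s i)) r Q (L i) (lam i))
  (w : 'I_l -> {poly (fps K)})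
  (w_def : forall i, map_poly (fps_ramify incl (L i)) (w i) =
     \prod_(j < class_mult r (s i)) ('X - (lam i j)%:P))
  (* the coefficients of the w_i modulo t^N lie in R *)
  (N : nat) (N_gt0 : (0 < N)%N)
  (wR : 'I_l -> {poly (fps R)})
  (wR_lift : forall i a m, (m < N)%N -> iota ((wR i)`_a m) = (w i)`_a m) :
  ((forall i, exists q : rat, iota (s i) = ratr q) ->
   exists C : nat, forall p, prime p -> (C < p)%N ->
     forall (B : comUnitRingType) (phi : {rmorphism R -> B}) (xi eta : B),
     is_param_ring p phi xi eta ->
     forall m, (m < N)%N ->
       (\det (rho_D phi p xi eta r Q)) m =
       ((-1) ^+ k * \prod_(i < l) (map_poly (fps_map phi) (wR i)).[
            fpsC (- (xi ^+ p * eta ^+ p))]) m)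
  /\
  (exists C : nat, forall p, prime p -> (C < p)%N ->
     forall (B : comUnitRingType) (phi : {rmorphism R -> B}) (xi eta : B),
     is_param_ring p phi xi eta ->
     forall m, (m < N)%N ->
       (\det (rho_D phi p xi eta r Q)) m =
       ((-1) ^+ k * \prod_(i < l) (map_poly (fps_map phi) (wR i)).[
            fpsC (- (xi ^+ p * eta ^+ p) - phi (s i) + phi (s i) ^+ p)]) m).
Proof.
have integral (x y : R) : x * y = 0 -> x = 0 \/ y = 0.
  move=> xy; have /eqP : iota x * iota y = 0 by rewrite -rmorphM xy rmorph0.
  rewrite mulf_eq0 => /orP[] /eqP e; [left|right]; apply: iota_inj;
    by rewrite e rmorph0.
have [RI RE] := idomain_structure integral; subst R.
(* [tps N] retains the coefficients up to t^N inclusive, so working modulo t^N means taking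
   [N.-1]. *)
have wR_lift' i a m : (m <= N.-1)%N -> iota ((wR i)`_a m) = (w i)`_a m.
  by move=> le; apply: wR_lift; rewrite -(prednK N_gt0) ltnS.
have [C CP] := @det_rho_mod K charK Kbar incl RI iota iota_inj
  R_fg k r Q Q0 l s s_reps L L_gt0 lam lam_exp w w_def N.-1 wR wR_lift'.
have main p : prime p -> (C < p)%N ->
     forall (B : comUnitRingType) (phi : {rmorphism RI -> B}) (xi eta : B),
     is_param_ring p phi xi eta ->
     forall m, (m < N)%N ->
       (\det (rho_D phi p xi eta r Q)) m =
       ((-1) ^+ k * \prod_(i < l) (map_poly (fps_map phi) (wR i)).[
            fpsC (- (xi ^+ p * eta ^+ p) - phi (s i) + phi (s i) ^+ p)]) m.
  move=> p_pr p_big B phi xi eta par m lt.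
  by apply: (CP p p_pr p_big B phi xi eta par); rewrite -ltnS prednK.
split; last by exists C.
(* Beyond all denominators of the s_i, each phi (s_i) lies in the prime field and the two correction
   terms of (b) cancel. *)
move=> /choice[q qE]; exists (C + \sum_i `|denq (q i)|)%N => p p_pr p_big B phi xi eta par m lt.
rewrite main //; last by apply: leq_ltn_trans p_big; rewrite leq_addr.
congr (coef_fps (_ * _) m); apply: eq_bigr => i _; congr (_.[fpsC _]).
rewrite (@frobenius_rational _ p (phi (s i)) (numq (q i)) (denq (q i))) //.
- by rewrite subrK.
- exact: (param_char par).
- apply: leq_ltn_trans p_big; rewrite (bigD1 i) //=; lia.
rewrite -(rmorph_int phi) -[in RHS](rmorph_int phi) -rmorphM; congr (phi _).
apply: iota_inj; rewrite rmorphM !rmorph_int qE /ratr mulrC divfK //.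
by rewrite (intr_eq0_char0 charK) denq_neq0.
Qed.
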